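(* Let $(V,\omega)$ be a real $2n$-dimensional symplectic vector space. For any triple $\vec n=(n_0,n_+,n_-)$ of nonnegative integers with $n_0+n_++n_-=n$, the spaces $\operatorname{Gr}(\vec n;V)$, $\operatorname{Lag}^{\mathbb C}(\vec n;V)$ and $\operatorname{Lag}^{\mathbb C}_\oplus(\vec n;V)$ are each homotopy equivalent to the compact left coset space $$\operatorname U(n)/(\operatorname O(n_0)\times\operatorname U(n_+)\times\operatorname U(n_-)).$$
   Context: For a subspace $W\subseteq V$: $W^\omega=\{v\in V:\omega(v,w)=0\ \forall w\in W\}$, $W_0=W\cap W^\omega$. $W$ has type $\vec n$ if $\dim_{\mathbb R}W_0=n_0$, $\dim_{\mathbb R}W/W_0=2n_+$, $\dim_{\mathbb R}W^\omega/W_0=2n_-$. $\operatorname{Gr}(\vec n;V)$ is the manifold of subspaces of type $\vec n$, a submanifold of the Grassmannian of real $(n_0+2n_+)$-dimensional subspaces of $V$ (it is an $\operatorname{Sp}(V)$-orbit). $V^{\mathbb C}=V\otimes_{\mathbb R}\mathbb C$, $\omega^{\mathbb C}$ is the complex bilinear extension of $\omega$, and $\kappa(v,w)=-i\omega^{\mathbb C}(v,\overline w)$, a Hermitian form. A complex Lagrangian subspace is a complex $n$-dimensional subspace $\mathbf F\subseteq V^{\mathbb C}$ on which $\omega^{\mathbb C}$ vanishes. It has type $\vec n$ if $\kappa|_{\mathbf F}$ has inertia $(n_0,n_+,n_-)$ (dimension of the kernel, number of positive, number of negative eigenvalues). $\operatorname{Lag}^{\mathbb C}(\vec n;V)$ is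 the space of complex Lagrangian subspaces of type $\vec n$; it is an $\operatorname{Sp}(V)$-orbit in the Grassmannian $\operatorname{Lag}^{\mathbb C}(V)$ of all complex Lagrangian subspaces. Let $\mathbf F_0=\ker\kappa|_{\mathbf F}$. A splitting of $\mathbf F$ is a triple $(\mathbf F,\mathbf F_+,\mathbf F_-)$ with $\mathbf F=\mathbf F_0\oplus\mathbf F_+\oplus\mathbf F_-$, $\mathbf F_+$ and $\mathbf F_-$ $\kappa$-orthogonal, and $\kappa|_{\mathbf F_+}$, $-\kappa|_{\mathbf F_-}$ positive definite. Two splittings of $\mathbf F$ are equivalent if they have the same $\mathbf F_0\oplus\mathbf F_+$ and the same $\mathbf F_0\oplus\mathbf F_-$. $\operatorname{Lag}^{\mathbb C}_\oplus(\vec n;V)$ is the space of equivalence classes of splittings of complex Lagrangian subspaces of type $\vec n$, topologized as a homogeneous space of $\operatorname{Sp}(V)$ (which acts transitively). *)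

(* Defs.v *)
From HB Require Import structures.
From mathcomp Require Import all_boot all_order all_algebra.
From mathcomp Require Import sesquilinear spectral complex.
From mathcomp Require Import all_classical all_reals all_analysis.
From mathcomp Require Import ring.

Set Implicit Arguments.
Unset Strict Implicit.
Unset Printing Implicit Defensive.

Import Order.TTheory GRing.Theory Num.Theory.
Import numFieldNormedType.Exports.
Import passmx.

Local Open Scope quotient_scope.
Local Open Scope classical_set_scope.
Local Open Scope ring_scope.

(* The library puts the norm topology on K^o for every numFieldType K but      *)
(* declares it on no concrete type of complex numbers.                         *)
HB.instance Definition _ (R : realType) := PseudoPointedMetric.copy R[i] R[i]^o.

Section Homotopy.
Variable R : realType.

Definition homotopic (X Y : topologicalType) (f g : X -> Y) : Prop :=
  exists H : X * R -> Y,
    [/\ {within [set: X] `*` `[0, 1], continuous H},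
        forall x, H (x, 0) = f x & forall x, H (x, 1) = g x].

Definition homotopy_equivalent (X Y : topologicalType) : Prop :=
  exists (f : X -> Y) (g : Y -> X),
    [/\ continuous f, continuous g,
        homotopic (g \o f) id & homotopic (f \o g) id].

End Homotopy.

Section Grassmannian.
Variables (K : numFieldType) (U : vectType K) (k : nat).

Definition frame_coord (e : k.-tuple U) : 'M[K]_(k, \dim {:U}) :=
  \matrix_(i, j) coord (vbasis {:U}) j (tnth e i).

Definition tuple_space := initial_topology frame_coord.
HB.instance Definition _ := Topological.on tuple_space.

Definition frame : topologicalType :=
  set_type [set e : tuple_space | free (e : k.-tuple U)].

Definition grassmannian := set_type [set W : {vspace U} | \dim W = k].
HB.instance Definition _ := Choice.on grassmannian.

Definition span_of_frame (e : frame) : {vspace U} := <<(val e : k.-tuple U)>>%VS.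

Lemma span_of_frame_dim (e : frame) :
  span_of_frame e \in [set W : {vspace U} | \dim W = k].
Proof.
by apply/mem_set => /=; have /set_mem/eqP/= := valP e; rewrite size_tuple.
Qed.

Definition frame_span (e : frame) : grassmannian := SigSub (span_of_frame_dim e).

(* The quotient topology of the space of frames. *)
Definition grassmannian_open (A : set grassmannian) := open (frame_span @^-1` A).

Lemma grassmannian_openT : grassmannian_open setT.
Proof. exact: openT. Qed.

Lemma grassmannian_openI : setI_closed grassmannian_open.
Proof. by move=> A B; exact: openI. Qed.

Lemma grassmannian_openU (I : Type) (A : I -> set grassmannian) :
  (forall i, grassmannian_open (A i)) -> grassmannian_open (\bigcup_i A i).
Proof. by move=> oA; apply: bigcup_open => i _; exact: oA. Qed.

HB.instance Definition _ := isOpenTopological.Build grassmannian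
  grassmannian_openT grassmannian_openI grassmannian_openU.

End Grassmannian.

Section RealSubspaces.
Variables (R : realType) (V : vectType R) (omega : {skew_symmetric V}).
Variables n0 np nm : nat.

Definition symp_radical (W : {vspace V}) : {vspace V} := (W :&: orthov omega W)%VS.

(* symp_radical W is contained in W and in its symplectic complement, so the   *)
(* truncated subtractions are the dimensions of the two quotients.             *)
Definition subspace_type (W : {vspace V}) : Prop :=
  [/\ \dim (symp_radical W) = n0,
      (\dim W - \dim (symp_radical W))%N = np.*2 &
      (\dim (orthov omega W) - \dim (symp_radical W))%N = nm.*2].

Definition Gr : topologicalType :=
  set_type [set W : grassmannian V (n0 + np.*2) | subspace_type (val W)].

End RealSubspaces.

(* The pair (x, y) stands for x + iy. *)
Definition complexification (R : realType) (V : vectType R) : Type := (V * V)%type.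

Section Complexification.
Variables (R : realType) (V : vectType R).
Local Notation VC := (complexification V).

HB.instance Definition _ := GRing.Zmodule.copy VC (V * V)%type.

Definition cscale (c : R[i]) (z : VC) : VC :=
  (complex.Re c *: z.1 - complex.Im c *: z.2,
   complex.Re c *: z.2 + complex.Im c *: z.1).

Lemma cscaleA a b z : cscale a (cscale b z) = cscale (a * b) z.
Proof.
case: a b z => [a a'] [b b'] [x y]; rewrite /cscale /=.
by congr (_, _); rewrite ?(scalerBr, scalerDr, scalerBl, scalerDl) ?scalerA
  ?opprD -!addrA; congr (_ + _); rewrite addrA addrC.
Qed.

Lemma cscale1 : left_id 1 cscale.
Proof. by case=> x y; rewrite /cscale /= !scale1r !scale0r subr0 addr0. Qed.

Lemma cscaleDr : right_distributive cscale +%R.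
Proof.
case=> a a' [x y] [x' y']; rewrite /cscale /=.
by congr (_, _); rewrite !scalerDr ?opprD addrACA.
Qed.

Lemma cscaleDl z : {morph cscale^~ z : a b / a + b}.
Proof.
case: z => x y [a a'] [b b']; rewrite /cscale /=.
by congr (_, _); rewrite !scalerDl ?opprD addrACA.
Qed.

HB.instance Definition _ :=
  GRing.Zmodule_isLmodule.Build R[i] VC cscaleA cscale1 cscaleDr cscaleDl.

Lemma complexification_vect_iso : Vector.axiom (\dim {:V}) VC.
Proof.
pose e := vbasis {:V}; have be : basis_of {:V} e := vbasisP _.
exists (fun z : VC => \row_i (Complex (rVof e z.1 0 i) (rVof e z.2 0 i))).
  move=> [a a'] [x y] [x' y']; apply/rowP => i; rewrite !mxE /=.
  by rewrite !linearD linearN /= !linearZ /= scalerN.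
exists (fun r : 'rV[R[i]]_(\dim {:V}) => (vecof e (\row_i complex.Re (r 0 i)),
                  vecof e (\row_i complex.Im (r 0 i))) : VC).
- case=> x y /=; congr (_, _); rewrite -[RHS](rVofK be); congr vecof;
  by apply/rowP => i; rewrite !mxE.
- move=> r; apply/rowP => i; rewrite !mxE /= !coord_vecof // !mxE.
  by case: (r 0 i).
Qed.

HB.instance Definition _ :=
  Lmodule_hasFinDim.Build R[i] VC complexification_vect_iso.

End Complexification.

Section ComplexLagrangians.
Variables (R : realType) (V : vectType R) (omega : {skew_symmetric V}).
Local Notation VC := (complexification V).

Definition conj_cplx (z : VC) : VC := (z.1, - z.2).

Definition omegaC (z w : VC) : R[i] :=
  Complex (omega z.1 w.1 - omega z.2 w.2) (omega z.1 w.2 + omega z.2 w.1).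

Definition kappa (z w : VC) : R[i] := - ('i * omegaC z (conj_cplx w)).

Lemma kappa_hermitian z w : kappa z w = (-1) ^+ false * Num.conj (kappa w z).
Proof.
have omegaE x y : omega x y = - omega y x by rewrite [LHS]hermC expr1 mulN1r.
have omegaN x y : omega x (- y) = - omega x y by rewrite linearNr.
case: z w => [x y] [u v]; apply/eqP; rewrite mul1r /kappa /omegaC eq_complex /=.
rewrite !omegaN (omegaE u x) (omegaE u y) (omegaE v x) (omegaE v y).
by apply/andP; split; apply/eqP; ring.
Qed.

Lemma kappa_linearl w : linear_for *%R (kappa ^~ w).
Proof.
move: w => [u v] [c c'] [x y] [x' y']; apply/eqP.
rewrite /kappa /omegaC eq_complex /=.
rewrite !(linearDl, linearNl, linearZl_LR, linearNr) /=.
by apply/andP; split; apply/eqP; ring.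
Qed.

Lemma kappa_linearr z : linear_for (Num.conj \; *%R) (kappa z).
Proof.
move=> c u v; rewrite !(kappa_hermitian z) !mul1r kappa_linearl /=.
by rewrite rmorphD rmorphM.
Qed.

HB.instance Definition _ :=
  bilinear_isBilinear.Build R[i] VC VC R[i] *%R (Num.conj \; *%R) kappa
    (kappa_linearl, kappa_linearr).

HB.instance Definition _ :=
  isHermitianSesquilinear.Build R[i] VC false Num.conj kappa kappa_hermitian.

Variables n0 np nm : nat.
Local Notation n := (n0 + np + nm)%N.

Definition complex_lagrangian (F : {vspace VC}) : Prop :=
  \dim F = n /\ {in F &, forall z w, omegaC z w = 0}.

Definition kappa_ker (F : {vspace VC}) : {vspace VC} := (F :&: orthov kappa F)%VS.

(* closed_field_poly_normal lists the roots of a polynomial, each repeated      *)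
(* according to its multiplicity.                                              *)
Definition eigenvalues m (A : 'M[R[i]]_m) : seq R[i] :=
  sval (closed_field_poly_normal (char_poly A)).

Definition gram m (e : m.-tuple VC) : 'M[R[i]]_m :=
  \matrix_(i, j) kappa (tnth e i) (tnth e j).

(* By Sylvester's law of inertia the choice of the basis e does not matter.     *)
Definition lagrangian_type (F : {vspace VC}) : Prop :=
  \dim (kappa_ker F) = n0 /\
  exists e : n.-tuple VC,
    [/\ basis_of F e,
        count (fun a => 0 < a) (eigenvalues (gram e)) = np &
        count (fun a => a < 0) (eigenvalues (gram e)) = nm].

Definition LagC : topologicalType :=
  set_type [set F : grassmannian VC n |
    complex_lagrangian (val F) /\ lagrangian_type (val F)].

(* Triples (F, F+, F-). *)
Definition splits (s : {vspace VC} * {vspace VC} * {vspace VC}) : Prop :=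
  let: (F, Fp, Fm) := s in
  [/\ F = (kappa_ker F + Fp + Fm)%VS,
      directv (kappa_ker F + Fp + Fm),
      {in Fp & Fm, forall z w, kappa z w = 0},
      {in Fp, forall z, z != 0 -> 0 < kappa z z} &
      {in Fm, forall z, z != 0 -> 0 < - kappa z z}].

Definition splitting := set_type
  [set s | [/\ complex_lagrangian s.1.1, lagrangian_type s.1.1 & splits s]].
HB.instance Definition _ := Choice.on splitting.

Definition splitting_eqv (s t : splitting) : bool :=
  let: (F, Fp, Fm) := val s in let: (F', Fp', Fm') := val t in
  [&& F == F', (kappa_ker F + Fp == kappa_ker F' + Fp')%VS &
      (kappa_ker F + Fm == kappa_ker F' + Fm')%VS].

Lemma splitting_eqv_equiv : equiv_class_of splitting_eqv.
Proof.
split=> [s|s t|t s u]; rewrite /splitting_eqv.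
- by case: (val s) => [[F Fp] Fm]; rewrite !eqxx.
- case: (val s) => [[F Fp] Fm]; case: (val t) => [[F' Fp'] Fm'].
  by rewrite (eq_sym F) (eq_sym (_ + Fp)%VS) (eq_sym (_ + Fm)%VS).
- case: (val s) => [[F Fp] Fm]; case: (val t) => [[F' Fp'] Fm'].
  case: (val u) => [[F'' Fp''] Fm''].
  by move=> /and3P[/eqP-> /eqP-> /eqP->].
Qed.

Canonical splitting_equiv := EquivRelPack splitting_eqv_equiv.

Definition LagC_oplus := {eq_quot splitting_equiv}.
HB.instance Definition _ := Choice.on LagC_oplus.
HB.instance Definition _ := EqQuotient.on LagC_oplus.

Definition End_space := initial_topology (mxof (vbasis {:V}) (vbasis {:V})).
HB.instance Definition _ := Topological.on End_space.

Definition symplectic_map (g : 'End(V)) : Prop :=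
  lker g = 0%VS /\ forall v w, omega (g v) (g w) = omega v w.

Definition Sp : topologicalType :=
  set_type [set g : End_space | symplectic_map (g : 'End(V))].

Definition cplx_map (g : 'End(V)) (z : VC) : VC := (g z.1, g z.2).

Lemma cplx_map_linear g : linear (cplx_map g).
Proof.
move=> [c c'] [x y] [x' y']; rewrite /cplx_map /=.
by congr (_, _) => /=; rewrite !linearD ?linearN /= !linearZ.
Qed.

HB.instance Definition _ g :=
  GRing.isLinear.Build R[i] VC VC *:%R (cplx_map g) (cplx_map_linear g).

Section Invariance.
Variable g : 'End(V).
Hypothesis g_symp : symplectic_map g.
Let gC := linfun (cplx_map g).

Lemma kappa_cplx_map z w : kappa (gC z) (gC w) = kappa z w.
Proof.
case: g_symp => _ gE; rewrite /gC !lfunE /kappa /omegaC /=.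
have omegaN x y : omega x (- y) = - omega x y by rewrite linearNr.
by rewrite !omegaN !gE.
Qed.

Lemma omegaC_cplx_map z w : omegaC (gC z) (gC w) = omegaC z w.
Proof. by case: g_symp => _ gE; rewrite /gC !lfunE /omegaC /= !gE. Qed.

Lemma cplx_map_ker : lker gC = 0%VS.
Proof.
case: g_symp => /eqP/lker0P g_inj _; apply/eqP/lker0P => -[x y] [x' y'].
by rewrite !lfunE => -[/g_inj-> /g_inj->].
Qed.

Lemma dim_cplx_map F : \dim (gC @: F) = \dim F.
Proof. by rewrite limg_dim_eq // cplx_map_ker capv0. Qed.

Lemma kappa_ker_cplx_map F : kappa_ker (gC @: F) = (gC @: kappa_ker F)%VS.
Proof.
apply/vspaceP => z; apply/idP/memv_imgP.
  rewrite memv_cap => /andP[/memv_imgP[w Fw ->] /mem_orthovP ort].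
  exists w => //; rewrite memv_cap Fw /=; apply/mem_orthovP => u Fu.
  by apply: etrans (esym (kappa_cplx_map w u)) _; rewrite ort ?memv_img.
move=> [w]; rewrite memv_cap => /andP[Fw /mem_orthovP ort] ->.
rewrite memv_cap memv_img //=; apply/mem_orthovP => _ /memv_imgP[u Fu ->].
by rewrite [LHS]kappa_cplx_map ort.
Qed.

Lemma complex_lagrangian_cplx_map F :
  complex_lagrangian F -> complex_lagrangian (gC @: F).
Proof.
move=> [dF isoF]; split; first by rewrite dim_cplx_map.
move=> _ _ /memv_imgP[z Fz ->] /memv_imgP[w Fw ->].
by rewrite omegaC_cplx_map isoF.
Qed.

Lemma lagrangian_type_cplx_map F :
  lagrangian_type F -> lagrangian_type (gC @: F).
Proof.
move=> [d0 [e [be ep em]]]; split; first by rewrite kappa_ker_cplx_map dim_cplx_map.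
exists (map_tuple gC e).
have -> : gram (map_tuple gC e) = gram e.
  by apply/matrixP => i j; rewrite !mxE !tnth_map kappa_cplx_map.
by split=> //; rewrite limg_basis_of // cplx_map_ker capv0.
Qed.

Lemma splits_cplx_map F Fp Fm :
  splits (F, Fp, Fm) -> splits (gC @: F, gC @: Fp, gC @: Fm)%VS.
Proof.
have gC_eq0 z : (gC z == 0) = (z == 0).
  by rewrite -memv_ker cplx_map_ker memv0.
move=> [eF /directvP/= dF ort pos neg]; split.
- by rewrite kappa_ker_cplx_map -!limgD -eF.
- apply/directvP => /=.
  by rewrite kappa_ker_cplx_map -!limgD !dim_cplx_map.
- move=> _ _ /memv_imgP[z Fz ->] /memv_imgP[w Fw ->].
  by rewrite kappa_cplx_map ort.
- move=> _ /memv_imgP[z Fz ->]; rewrite gC_eq0 kappa_cplx_map; exact: pos.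
- move=> _ /memv_imgP[z Fz ->]; rewrite gC_eq0 kappa_cplx_map; exact: neg.
Qed.

End Invariance.

Definition Sp_act_triple (g : Sp) (s : {vspace VC} * {vspace VC} * {vspace VC}) :=
  let gC := linfun (cplx_map (val g : 'End(V))) in
  ((gC @: s.1.1)%VS, (gC @: s.1.2)%VS, (gC @: s.2)%VS).

Lemma Sp_act_subproof (g : Sp) (s : splitting) :
  Sp_act_triple g (val s) \in
  [set s | [/\ complex_lagrangian s.1.1, lagrangian_type s.1.1 & splits s]].
Proof.
have gS : symplectic_map (val g : 'End(V)) by have /set_mem := valP g.
have /set_mem/= := valP s; case: (val s) => [[F Fp] Fm] /= [lF tF sF].
apply/mem_set; split; first exact: complex_lagrangian_cplx_map.
- exact: lagrangian_type_cplx_map.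
- exact: splits_cplx_map.
Qed.

Definition Sp_act (g : Sp) (s : splitting) : splitting :=
  SigSub (Sp_act_subproof g s).

(* The topology making LagC_oplus a homogeneous space: the final topology for   *)
(* the orbit maps, which by transitivity of the action is the quotient topology *)
(* of Sp for any single one of them.                                           *)
Definition LagC_oplus_open (A : set LagC_oplus) : Prop :=
  forall s : splitting, open [set g : Sp | A (\pi_LagC_oplus (Sp_act g s))].

Lemma LagC_oplus_openT : LagC_oplus_open setT.
Proof. by move=> s; exact: openT. Qed.

Lemma LagC_oplus_openI : setI_closed LagC_oplus_open.
Proof. by move=> A B oA oB s; exact: (openI (oA s) (oB s)). Qed.

Lemma LagC_oplus_openU (I : Type) (A : I -> set LagC_oplus) :
  (forall i, LagC_oplus_open (A i)) -> LagC_oplus_open (\bigcup_i A i).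
Proof.
move=> oA s; rewrite (_ : [set _ | _] =
  \bigcup_i [set g | A i (\pi_LagC_oplus (Sp_act g s))]) //.
by apply: bigcup_open => i _; exact: oA.
Qed.

HB.instance Definition _ := isOpenTopological.Build LagC_oplus
  LagC_oplus_openT LagC_oplus_openI LagC_oplus_openU.

End ComplexLagrangians.

Section UnitaryCosets.
Variables (R : realType) (n0 np nm : nat).

Definition unitary_group n : topologicalType :=
  set_type [set g : 'M[R[i]]_n | g \is unitarymx].

(* The image of O(n0) x U(np) x U(nm) in U(n0 + np + nm). *)
Definition block_group : set 'M[R[i]]_(n0 + np + nm) :=
  [set h | exists (A : 'M[R]_n0) (B : 'M[R[i]]_np) (C : 'M[R[i]]_nm),
    [/\ A *m A^T = 1%:M, B \is unitarymx, C \is unitarymx &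
        h = block_mx (block_mx (map_mx (real_complex R) A) 0 0 B) 0 0 C]].

Definition same_coset (g h : unitary_group (n0 + np + nm)) : bool :=
  `[< exists2 k, block_group k & val h = val g *m k >].

Lemma block_group1 : block_group 1%:M.
Proof.
exists 1%:M, 1%:M, 1%:M; split; first by rewrite trmx1 mulmx1.
- by apply/unitarymxP; rewrite trmx1 map_mx1 mulmx1.
- by apply/unitarymxP; rewrite trmx1 map_mx1 mulmx1.
- by rewrite map_mx1 -!scalar_mx_block.
Qed.

Lemma block_groupM h k : block_group h -> block_group k -> block_group (h *m k).
Proof.
move=> [A [B [C [oA uB uC ->]]]] [A' [B' [C' [oA' uB' uC' ->]]]].
exists (A *m A'), (B *m B'), (C *m C'); split.
- by rewrite trmx_mul mulmxA -(mulmxA A) oA' mulmx1.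
- exact: mul_unitarymx.
- exact: mul_unitarymx.
- by rewrite !mulmx_block !(mulmx0, mul0mx, addr0, add0r) map_mxM.
Qed.

Lemma block_groupV h : block_group h -> exists2 k, block_group k & h *m k = 1%:M.
Proof.
move=> [A [B [C [oA uB uC ->]]]].
pose B' := map_mx Num.conj B^T; pose C' := map_mx Num.conj C^T.
exists (block_mx (block_mx (map_mx (real_complex R) A^T) 0 0 B') 0 0 C').
  exists A^T, B', C'; split=> //; first by rewrite trmxK (mulmx1C oA).
  - by rewrite trmxC_unitary.
  - by rewrite trmxC_unitary.
rewrite !mulmx_block !(mulmx0, mul0mx, addr0, add0r) -map_mxM oA map_mx1.
by rewrite (unitarymxP uB) (unitarymxP uC) -!scalar_mx_block.
Qed.

Lemma same_coset_equiv : equiv_class_of same_coset.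
Proof.
have sym g h : same_coset g h -> same_coset h g.
  move=> /asboolP[k /block_groupV[k' Hk' kk'] hg]; apply/asboolP; exists k' => //.
  by rewrite hg -mulmxA kk' mulmx1.
split=> [g|g h|h g l].
- by apply/asboolP; exists 1%:M; [exact: block_group1 | rewrite mulmx1].
- by apply/idP/idP; exact: sym.
- move=> /asboolP[k Hk gh] /asboolP[k' Hk' hl]; apply/asboolP.
  by exists (k *m k'); [exact: block_groupM | rewrite hl gh mulmxA].
Qed.

Canonical same_coset_equivRel := EquivRelPack same_coset_equiv.

Definition unitary_coset_space : topologicalType :=
  quotient_topology {eq_quot same_coset_equivRel}.

End UnitaryCosets.

(* Main.v *)
(* In complex Darboux coordinates the symplectic group becomes the group of
   matrices col_mx l (cj l) with l = (a, b), a a^* - b b^* = 1 and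
   l G (cj l)^* = 0, where G is the signature form, and U(n) is the locus
   b = 0. Left multiplication by h in U(n) commutes with the polar retraction
   (a, b) |-> (a a^* - t^2 b b^* )^(-1/2) (a, t b). Each of the three spaces X is
   an orbit, and the stabilizer of its base point is larger than
   H = O(n0) x U(np) x U(nm); but a point x of X has a canonical frame l,
   unique up to H: diagonalize the Hermitian form kappa with respect to the
   Hermitian inner product of the coordinates on the subspaces attached to x
   (the kernel of kappa carries a real structure, which is where O(n0) comes
   from), and rescale. Then x |-> [retraction of l at time 0] is a homotopy
   inverse of U(n)/H -> X, and moving t from 0 to 1 is the homotopy. Since l
   is only defined up to H, continuity is proved by compactness: the relation
   that l is a canonical frame of x is closed with l in a compact set. *)

Require Import Defs.
From HB Require Import structures.
From mathcomp Require Import all_boot all_order all_algebra.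
From mathcomp Require Import sesquilinear spectral complex.
From mathcomp Require Import all_classical all_reals all_analysis.
From mathcomp Require Import ring lra zify.

Set Implicit Arguments.
Unset Strict Implicit.
Unset Printing Implicit Defensive.

Import Order.TTheory GRing.Theory Num.Theory.
Import numFieldNormedType.Exports.
Import passmx.

Local Open Scope quotient_scope.
Local Open Scope classical_set_scope.
Local Open Scope ring_scope.
Local Open Scope sesquilinear_scope.

(** The compactness argument needs a closed relation between points and frames, whereas the sign
    conditions that make a frame unique up to H are strict and hence not closed. The relation is
    therefore stated with weak inequalities, and strictness is recovered from the point: the null
    block already fills the kernel with n0 rows, and the other rows are Euclidean orthogonal to it,
    so none of them can have eigenvalue 0. The same comparison of two frames of one point gives both
    strictness and uniqueness. Frames are stored as rows, so H acts on them from the left, while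
    cosets are formed with H on the right; adjoints mediate between the two conventions. Only one of
    the two composites needs a real homotopy. The frame of a unitary matrix is canonical for its own
    point, so the composite on the coset space is already the identity. The three spaces enter only
    through the incidence relation between points and frames, which is why the main construction is
    carried out for an abstract relation. *)

Local Notation mxbar A := (map_mx Num.conj A).

(** * Continuity of maps defined by compact relations *)

Section CompactRelation.
Variables X T Y : topologicalType.

(** A form of the tube lemma. At a pair (x, q) outside [rel] a whole neighbourhood misses [rel], and
    at a pair inside it [F] is continuous relative to [rel]; compactness of [Q] then gives one
    neighbourhood of x that works for every q. This replaces a continuous choice of q, which need
    not exist. *)
Lemma compact_relation_continuous (Q : set T) (rel : set (X * T))
    (F : X * T -> Y) (f : X -> Y) :
  compact Q -> closed rel ->
  (forall x q, rel (x, q) -> Q q) ->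
  (forall x, exists q, rel (x, q)) ->
  (forall x q, rel (x, q) -> F (x, q) = f x) ->
  (forall x q, rel (x, q) -> F y @[y --> within rel (nbhs (x, q))] --> F (x, q)) ->
  continuous f.
Proof.
move=> /compact_near_coveringP Qc relC relQ ex Ff Fc x B Bfx.
have : \near x, Q `<=` (fun y q => rel (y, q) -> B (F (y, q))) x.
  apply: Qc => q _.
  have : \forall p \near (x, q), rel p -> B (F p).
    have [rxq|nrxq] := pselect (rel (x, q)).
      by apply: (Fc _ _ rxq); rewrite (Ff _ _ rxq).
    have : nbhs (x, q) (~` rel) by apply: open_nbhs_nbhs; split=> //; exact: closed_openC.
    by apply: filterS => p np /np.
  by move=> [[N1 N2] /= [N1x N2q] N12]; exists (N2, N1) => //= -[q' x'] [? ?]; exact: N12.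
apply: filterS => y Ny /=; have [q rq] := ex y.
by rewrite /= -(Ff _ _ rq); apply: Ny => //; exact: relQ rq.
Qed.

End CompactRelation.

(** * Limits of complex numbers and of matrices *)

Section ComplexTopology.
Variable R : realType.
Local Notation C := R[i].
Variables (T : Type) (F : set_system T).
Context {FF : Filter F}.

Lemma cvgC_D (f g : T -> C) (a b : C) :
  f @ F --> a -> g @ F --> b -> (fun x => f x + g x : C) @ F --> (a + b : C).
Proof. exact: (@cvgD C C^o). Qed.

Lemma cvgC_M (f g : T -> C) (a b : C) :
  f @ F --> a -> g @ F --> b -> (fun x => f x * g x : C) @ F --> (a * b : C).
Proof. exact: (@cvgM C). Qed.

(** The order of [R[i]] compares only numbers with equal imaginary parts, so a positive radius is
    real and real radii suffice. *)
Lemma cvgC_dist (f : T -> C) (a : C) :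
  (forall e : R, 0 < e -> \forall x \near F, `|a - f x| < e%:C%C) -> f @ F --> a.
Proof.
move=> h; apply/(@cvgrPdist_lt C C^o) => e e0.
have [r r0 ->] : exists2 r : R, 0 < r & e = r%:C%C.
  move: e0; case: e => a1 a2; rewrite ltcE /= => /andP[/eqP-> a10].
  by exists a1.
exact: h.
Qed.

Lemma cvgC_distP (f : T -> C) (a : C) : f @ F --> a ->
  forall e : R, 0 < e -> \forall x \near F, `|a - f x| < e%:C%C.
Proof.
move=> h e e0; have /(@cvgrPdist_lt C C^o) := h; apply.
by rewrite ltcR.
Qed.

Lemma cvgC_Re (f : T -> C) (a : C) : f @ F --> a ->
  (fun x => complex.Re (f x)) @ F --> complex.Re a.
Proof.
move=> /cvgC_distP h; apply/cvgrPdist_lt => e e0.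
apply: filterS (h e e0) => x; rewrite -raddfB -ltcR /=.
by apply: le_lt_trans; exact: normc_ge_Re.
Qed.

Lemma cvgC_R (f : T -> R) (a : R) : f @ F --> a ->
  (fun x => (f x)%:C%C : C) @ F --> (a%:C%C : C).
Proof.
move=> /cvgrPdist_lt h; apply: cvgC_dist => e e0.
apply: filterS (h e e0) => x; rewrite -raddfB /= -ltcR.
by rewrite normc_def /= expr0n addr0 sqrtr_sqr.
Qed.

Lemma cvgC_conj (f : T -> C) (a : C) : f @ F --> a ->
  (fun x => (f x)^* : C) @ F --> (a^* : C).
Proof.
move=> /cvgC_distP h; apply: cvgC_dist => e e0.
by apply: filterS (h e e0) => x; rewrite -raddfB /= norm_conjC.
Qed.

End ComplexTopology.
Section MatrixTopology.
Variables (T : Type) (F : set_system T).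
Context {FF : Filter F}.

Lemma cvg_mx (K : topologicalType) m n (f : T -> 'M[K]_(m, n)) (A : 'M[K]_(m, n)) :
  (forall i j, (fun x => f x i j) @ F --> A i j) -> f @ F --> A.
Proof.
move=> h B [P PA PB].
have : \forall x \near F, forall ij : 'I_m * 'I_n, P ij.1 ij.2 (f x ij.1 ij.2).
  by apply: filter_forall => -[i j] /=; exact: (h i j _ (PA i j)).
by apply: filterS => x hx; apply: PB => i j; exact: (hx (i, j)).
Qed.

Lemma cvg_mx_coord (K : topologicalType) m n (f : T -> 'M[K]_(m, n)) (A : 'M[K]_(m, n)) i j :
  f @ F --> A -> (fun x => f x i j) @ F --> A i j.
Proof.
move=> h B BA; apply: (h [set M | B (M i j)]).
(* The basic neighbourhood constrains the entry (i, j) by [B] and leaves all other entries free. *)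
by exists (fun i' j' => [set y | i' = i -> j' = j -> B y]) => [i' j'|M /(_ i j)];
  [have [<-|ni] := eqVneq i i'; [have [<-|nj] := eqVneq j j'|] | exact]; 
  [ apply: filterS BA => ? ? _ _| apply: filterS (@filterT _ (nbhs (A i j')) _) => ? _ _ /eqP;
    rewrite eq_sym (negbTE nj) | apply: filterS (@filterT _ (nbhs (A i' j')) _) => ? _ /eqP;
      rewrite eq_sym (negbTE ni)].
Qed.

Variable R : realType.
Local Notation C := R[i].

Lemma cvgC_sum (I : Type) (s : seq I) (f : I -> T -> C) (a : I -> C) :
  (forall i, f i @ F --> a i) ->
  (fun x => \sum_(i <- s) f i x) @ F --> (\sum_(i <- s) a i : C).
Proof.
move=> h; elim: s => [|i s IH].
  by rewrite big_nil; under eq_fun do rewrite big_nil; exact: cvg_cst.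
rewrite big_cons; under eq_fun do rewrite big_cons.
exact: (@cvgC_D _ _ _ _ (f i) _ _ _ (h i) IH).
Qed.

Lemma cvg_mulmx m n p (f : T -> 'M[C]_(m, n)) (g : T -> 'M[C]_(n, p)) (A : 'M[C]_(m, n)) (B :
  'M[C]_(n, p)) :
  f @ F --> A -> g @ F --> B -> (fun x => f x *m g x) @ F --> A *m B.
Proof.
move=> fA gB; apply: cvg_mx => i j; rewrite mxE; under eq_fun do rewrite mxE.
by apply: cvgC_sum => k; apply: cvgC_M; exact: cvg_mx_coord.
Qed.

Lemma cvg_addmx m n (f : T -> 'M[C]_(m, n)) (g : T -> 'M[C]_(m, n)) (A : 'M[C]_(m, n)) (B :
  'M[C]_(m, n)) :
  f @ F --> A -> g @ F --> B -> (fun x => f x + g x) @ F --> A + B.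
Proof.
move=> fA gB; apply: cvg_mx => i j; rewrite mxE; under eq_fun do rewrite mxE.
exact: (cvgC_D (cvg_mx_coord (i:=i) (j:=j) fA) (cvg_mx_coord (i:=i) (j:=j) gB)).
Qed.

Lemma cvg_scalemx m n (f : T -> C) (g : T -> 'M[C]_(m, n)) (a : C) (B : 'M[C]_(m, n)) :
  f @ F --> a -> g @ F --> B -> (fun x => f x *: g x) @ F --> a *: B.
Proof.
move=> fA gB; apply: cvg_mx => i j; rewrite mxE; under eq_fun do rewrite mxE.
exact: (cvgC_M fA (cvg_mx_coord (i:=i) (j:=j) gB)).
Qed.

Lemma cvg_mxbar m n (f : T -> 'M[C]_(m, n)) (A : 'M[C]_(m, n)) :
  f @ F --> A -> (fun x => mxbar (f x)) @ F --> mxbar A.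
Proof.
move=> fA; apply: cvg_mx => i j; rewrite mxE; under eq_fun do rewrite mxE.
exact: (cvgC_conj (cvg_mx_coord (i:=i) (j:=j) fA)).
Qed.

Lemma cvg_trmx m n (f : T -> 'M[C]_(m, n)) (A : 'M[C]_(m, n)) :
  f @ F --> A -> (fun x => (f x)^T) @ F --> A^T.
Proof.
move=> fA; apply: cvg_mx => i j; rewrite mxE; under eq_fun do rewrite mxE.
exact: cvg_mx_coord.
Qed.

Lemma cvg_adjmx m n (f : T -> 'M[C]_(m, n)) (A : 'M[C]_(m, n)) :
  f @ F --> A -> (fun x => (f x)^t*) @ F --> A^t*.
Proof. by move=> fA; apply: cvg_mxbar; exact: cvg_trmx. Qed.

Lemma cvg_row_mx (m n p : nat) (f : T -> 'M[C]_(m, n)) (g : T ->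
  'M[C]_(m, p)) (A : 'M[C]_(m, n)) (B : 'M[C]_(m, p)) :
  f @ F --> A -> g @ F --> B -> (fun x => row_mx (f x) (g x)) @ F --> row_mx A B.
Proof.
move=> fA gB; apply: cvg_mx => i j; rewrite mxE; under eq_fun do rewrite mxE.
by case: split_ordP => k _; exact: cvg_mx_coord.
Qed.

Lemma cvg_col_mx (m n p : nat) (f : T -> 'M[C]_(m, n)) (g : T ->
  'M[C]_(p, n)) (A : 'M[C]_(m, n)) (B : 'M[C]_(p, n)) :
  f @ F --> A -> g @ F --> B -> (fun x => col_mx (f x) (g x)) @ F --> col_mx A B.
Proof.
move=> fA gB; apply: cvg_mx => i j; rewrite mxE; under eq_fun do rewrite mxE.
by case: split_ordP => k _; exact: cvg_mx_coord.
Qed.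

End MatrixTopology.

Lemma continuous_mx (X K : topologicalType) m n (f : X -> 'M[K]_(m, n)) :
  (forall i j, continuous (fun x => f x i j)) -> continuous f.
Proof. by move=> h x; apply: (@cvg_mx _ _ (nbhs_filter x)) => i j; exact: h. Qed.

Lemma continuous_coord (X K : topologicalType) m n (f : X -> 'M[K]_(m, n)) i j :
  continuous f -> continuous (fun x => f x i j).
Proof. by move=> h x; exact: (cvg_mx_coord (h x)). Qed.

(** * Closed and compact sets of complex matrices *)

Section ClosedConditions.
Variables (R : realType) (X : topologicalType).
Local Notation C := R[i].

Lemma continuous_closed_preimage (Y : topologicalType) (f : X -> Y) (A : set Y) :
  continuous f -> closed A -> closed (f @^-1` A).
Proof. by move=> cf; apply: preimage_closed => x _; exact: cf. Qed.

(** Being nonnegative in [R[i]] means having nonnegative real part and zero imaginary part. The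
    imaginary part of z is read off as the real part of -i z, so that continuity of the real part is
    enough. *)
Lemma closed_geC0 (f : X -> C) : continuous f -> closed [set x | 0 <= f x].
Proof.
move=> cf.
pose g x := complex.Re (f x); pose h x := complex.Re (- 'i * f x).
have -> : [set x | 0 <= f x] =
    (g @^-1` [set y | 0 <= y]) `&` (h @^-1` [set y | y = 0]).
  apply/seteqP; split=> x; rewrite /g /h /= lecE /=; case: (f x) => a b /=;
    rewrite !(mul0r, mulN1r, oppr0, opprK, mulr0, mul1r, subr0, add0r, opprK).
    by move=> /andP[/eqP <-].
  by move=> [-> ->]; rewrite eqxx.
have cg : continuous g by move=> x; exact: (cvgC_Re (cf x)).
have ch : continuous h.
  by move=> x; apply: cvgC_Re; apply: (cvgC_M (cvg_cst _) (cf x)).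
apply: closedI.
  exact: (continuous_closed_preimage cg (@closed_ge R 0)).
exact: (continuous_closed_preimage ch (@closed_eq R 0)).
Qed.

(** Antisymmetry of the order turns an equality into two nonnegativity conditions. *)
Lemma closed_eqC (f g : X -> C) :
  continuous f -> continuous g -> closed [set x | f x = g x].
Proof.
move=> cf cg.
have cN (a b : X -> C) : continuous a -> continuous b -> continuous (fun x => a x + (-1) * b x : C).
  by move=> ca cb x; exact: (cvgC_D (ca x) (cvgC_M (cvg_cst _) (cb x))).
have -> : [set x | f x = g x] =
    [set x | 0 <= f x + (-1) * g x] `&` [set x | 0 <= g x + (-1) * f x].
  apply/seteqP; split=> x /=; rewrite !mulN1r !subr_ge0; first by move->.
  by move=> [h1 h2]; apply/eqP; rewrite eq_le h1 h2.
by apply: closedI; apply: closed_geC0; exact: cN.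
Qed.

Lemma closed_eqmx m n (f g : X -> 'M[C]_(m, n)) :
  continuous f -> continuous g -> closed [set x | f x = g x].
Proof.
move=> cf cg.
have -> : [set x | f x = g x] = \bigcap_(ij in [set: 'I_m * 'I_n])
    [set x | f x ij.1 ij.2 = g x ij.1 ij.2].
  apply/seteqP; split=> [x /= e [i j] _|x h] /=; first by rewrite e.
  by apply/matrixP => i j; exact: (h (i, j)).
apply: closed_bigI => -[i j] _ /=.
by apply: closed_eqC => x; [exact: (cvg_mx_coord (cf x)) | exact: (cvg_mx_coord (cg x))].
Qed.

End ClosedConditions.

Section UnitBox.
Variable R : realType.
Local Notation C := R[i].

Lemma compact_mx m n (D : set C) :
  compact D -> compact [set A : 'M[C]_(m, n) | forall i j, D (A i j)].
Proof.
move=> cD.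
have : compact [set v : 'rV[C]_(m * n) | forall k, D (v ord0 k)].
  by apply: (@rV_compact C (m * n)%N (fun=> D)).
move=> /(@continuous_compact _ _ (vec_mx : 'rV[C]_(m * n) -> 'M[C]_(m, n)) _ _) h.
have -> : [set A : 'M[C]_(m, n) | forall i j, D (A i j)] =
   vec_mx @` [set v : 'rV[C]_(m * n) | forall k, D (v ord0 k)].
  apply/seteqP; split=> [A /= hA|_ [v /= hv] <- i j]; last by rewrite mxE.
  by exists (mxvec A); rewrite ?mxvecK//= => k; case/mxvec_indexP: k => i j; rewrite mxvecE.
apply: h; apply: continuous_subspaceT; apply: continuous_mx => i j.
under eq_fun do rewrite mxE.
by apply: continuous_coord => v; exact: cvg_id.
Qed.

(** A square rather than a disc: it is the image of a product of two real segments, which makes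
    compactness immediate. *)
Definition complex_square : set C :=
  [set z | -1 <= complex.Re z <= 1 /\ -1 <= complex.Im z <= 1].

Lemma compact_complex_square : compact complex_square.
Proof.
have c1 : compact `[(-1 : R), 1] by exact: segment_compact.
have : compact [set v : 'rV[R]_2 | forall k, `[(-1 : R), 1]%classic (v ord0 k)].
  by apply: (@rV_compact R 2 (fun=> `[(-1 : R), 1]%classic)).
pose h (v : 'rV[R]_2) : C := (v 0 0)%:C%C + 'i * (v 0 1)%:C%C.
move=> /(@continuous_compact _ _ h _ _) hc.
have hE v : h v = Complex (v 0 0) (v 0 1).
  by rewrite /h; apply/eqP; rewrite eq_complex /= !(mul0r, mul1r, mulr0, subr0, addr0, add0r) !eqxx.
have -> : complex_square = h @` [set v : 'rV[R]_2 | forall k, `[(-1 : R), 1]%classic (v ord0 k)].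
  apply/seteqP; split=> [[a b] /= [ha hb]|_ [v /= hv] <-].
    exists (\row_k (if k == 0 then a else b)); last by rewrite hE !mxE.
    by move=> k; rewrite !mxE in_itv /=; case: ifP.
  by rewrite hE; split => /=; [have := hv 0| have := hv 1]; rewrite in_itv.
apply: hc; apply: continuous_subspaceT => v.
have cc k : (fun w : 'rV[R]_2 => (w 0 k)%:C%C : C) @ v --> ((v 0 k)%:C%C : C).
  apply: (@cvgC_R _ _ _ (nbhs_filter v)).
  by apply: (continuous_coord (X := 'rV[R]_2) (f := id)) => w; exact: cvg_id.
exact: (cvgC_D (cc 0) (cvgC_M (cvg_cst _) (cc 1))).
Qed.

Definition unit_box m n : set 'M[C]_(m, n) :=
  [set A | forall i j, complex_square (A i j)].

Lemma compact_unit_box m n : compact (@unit_box m n).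
Proof. exact: compact_mx compact_complex_square. Qed.

(** The diagonal entries of the Gram matrix bound the squared moduli of all entries, and the unit
    disc lies in the square. *)
Lemma unit_box_rows m n (A : 'M[C]_(m, n)) :
  (forall i, (A *m A^t*) i i <= 1) -> unit_box A.
Proof.
move=> h i j.
have h1 : `|A i j| ^+ 2 <= 1.
  apply: le_trans (h i); rewrite mxE (bigD1 j) //= !mxE -normCK.
  by rewrite lerDl sumr_ge0 // => k _; rewrite !mxE -normCK exprn_ge0.
move: h1; rewrite -add_Re2_Im2 lecR => h1.
have hr := sqr_ge0 (complex.Re (A i j)); have hi := sqr_ge0 (complex.Im (A i j)).
by split; apply/andP; split; nra.
Qed.

End UnitBox.
(** * Spectral calculus of Hermitian matrices *)

Section Adjoint.
Variable C : numClosedFieldType.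

Lemma adjmxM m n p (A : 'M[C]_(m, n)) (B : 'M[C]_(n, p)) :
  (A *m B)^t* = B^t* *m A^t*.
Proof. by rewrite trmx_mul map_mxM. Qed.

Lemma adj_row_mx m n p (A : 'M[C]_(m, n)) (B : 'M[C]_(m, p)) :
  (row_mx A B)^t* = col_mx (A^t*) (B^t*).
Proof. by rewrite tr_row_mx map_col_mx. Qed.

Lemma adj_col_mx m n p (A : 'M[C]_(m, n)) (B : 'M[C]_(p, n)) :
  (col_mx A B)^t* = row_mx (A^t*) (B^t*).
Proof. by rewrite tr_col_mx map_row_mx. Qed.

Lemma adjmx0 m n : (0 : 'M[C]_(m, n))^t* = 0.
Proof. by rewrite trmx0 map_mx0. Qed.

Lemma adjmx1 n : (1%:M : 'M[C]_n)^t* = 1%:M.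
Proof. by rewrite trmx1 map_mx1. Qed.

Lemma adj_mxbar m n (A : 'M[C]_(m, n)) : (mxbar A)^t* = A^T.
Proof. by apply/matrixP => i j; rewrite !mxE conjCK. Qed.

Lemma adj_diag_mx n (d : 'rV[C]_n) : mxbar d = d -> (diag_mx d)^t* = diag_mx d.
Proof. by move=> dr; rewrite tr_diag_mx map_diag_mx dr. Qed.

Lemma mxbarK m n (A : 'M[C]_(m, n)) : mxbar (mxbar A) = A.
Proof. by apply/matrixP => i j; rewrite !mxE conjCK. Qed.

Lemma unitary_inv n (v : 'M[C]_n) : v \is unitarymx -> v^t* *m v = 1%:M.
Proof. by move=> /unitarymxP/mulmx1C. Qed.

Lemma tr_mul_adj_ge0 m n (A : 'M[C]_(m, n)) i : 0 <= (A *m A^t*) i i.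
Proof. by rewrite mxE sumr_ge0 // => j _; rewrite !mxE -normCK exprn_ge0. Qed.

(** The trace is the sum of the squared moduli of the entries of [A]. *)
Lemma mul_adj_eq0 m n (A : 'M[C]_(m, n)) : \tr (A *m A^t*) = 0 -> A = 0.
Proof.
move=> /eqP; rewrite psumr_eq0 => [/allP h|i _]; last exact: tr_mul_adj_ge0.
apply/matrixP => i j; rewrite mxE.
move: (h i); rewrite mem_index_enum => /(_ isT) /=.
rewrite mxE psumr_eq0 => [/allP/(_ j)|k _]; last by rewrite !mxE -normCK exprn_ge0.
by rewrite mem_index_enum => /(_ isT) /=; rewrite !mxE -normCK sqrf_eq0 normr_eq0 => /eqP.
Qed.

Lemma row_mul_adj_gt0 n (x : 'rV[C]_n) : x != 0 -> 0 < (x *m x^t*) 0 0.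
Proof.
move=> x0; rewrite lt_def tr_mul_adj_ge0 andbT; apply: contraNneq x0 => h.
by apply/eqP/mul_adj_eq0; rewrite /mxtrace big_ord1.
Qed.

End Adjoint.

Section FunctionalCalculus.
Variable C : numClosedFieldType.

(** Entrywise the equation reads w_ij d_j = d'_i w_ij: an intertwiner of diagonal matrices connects
    only equal eigenvalues. Both the functional calculus and the uniqueness of frames rest on
    this. *)
Lemma diag_intertwine m n (w : 'M[C]_(m, n)) d d' i j :
  w *m diag_mx d = diag_mx d' *m w -> w i j != 0 -> d 0 j = d' 0 i.
Proof.
move=> /matrixP/(_ i j); rewrite mul_mx_diag mul_diag_mx !mxE mulrC => h wij.
exact: (mulIf wij h).
Qed.

Lemma diag_intertwine_map m n (f : C -> C) (w : 'M[C]_(m, n)) d d' :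
  w *m diag_mx d = diag_mx d' *m w ->
  w *m diag_mx (map_mx f d) = diag_mx (map_mx f d') *m w.
Proof.
move=> h; apply/matrixP => i j; rewrite mul_mx_diag mul_diag_mx !mxE mulrC.
have [->|wij] := eqVneq (w i j) 0; first by rewrite !mulr0.
by rewrite (diag_intertwine h wij).
Qed.

Definition fun_calc (f : C -> C) n (q : 'M[C]_n) : 'M[C]_n :=
  (spectralmx q)^t* *m diag_mx (map_mx f (spectral_diag q)) *m spectralmx q.

Lemma hermitian_spectralE n (q : 'M[C]_n) : q^t* = q ->
  q = (spectralmx q)^t* *m diag_mx (spectral_diag q) *m spectralmx q.
Proof.
move=> qh; rewrite -invmx_unitary ?spectral_unitarymx //.
by apply/orthomx_spectralP/normalmxP; rewrite qh.
Qed.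

Lemma hermitian_spectral_real n (q : 'M[C]_n) : q^t* = q ->
  mxbar (spectral_diag q) = spectral_diag q.
Proof.
move=> qh; have u := spectral_unitarymx q; have := qh.
rewrite [in LHS](hermitian_spectralE qh) [in RHS](hermitian_spectralE qh).
rewrite !adjmxM trmxCK mulmxA tr_diag_mx map_diag_mx.
move=> /(congr1 (fun X => spectralmx q *m X *m (spectralmx q)^t*)).
rewrite !mulmxA !(unitarymxP u) !mul1mx -!mulmxA !(unitarymxP u) !mulmx1.
by move=> /matrixP h; apply/rowP => i; move: (h i i); rewrite !mxE eqxx.
Qed.

(** [fun_calc] is defined by one chosen diagonalization. The unitary matrix that passes from it to
    another one intertwines the two diagonal matrices, hence also their images under [f], so any
    diagonalization computes the same matrix. *)
Lemma fun_calcE (f : C -> C) n (v : 'M[C]_n) d : v \is unitarymx -> mxbar d = d ->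
  fun_calc f (v^t* *m diag_mx d *m v) = v^t* *m diag_mx (map_mx f d) *m v.
Proof.
move=> uv dr; set q := _ *m v.
have qh : q^t* = q by rewrite /q !adjmxM trmxCK adj_diag_mx // mulmxA.
have us := spectral_unitarymx q.
have : spectralmx q *m v^t* *m diag_mx d =
       diag_mx (spectral_diag q) *m (spectralmx q *m v^t*).
  have := hermitian_spectralE qh; rewrite {1}/q.
  move=> /(congr1 (fun X => spectralmx q *m X *m v^t*)).
  by rewrite !mulmxA (unitarymxP us) mul1mx -!mulmxA (unitarymxP uv) mulmx1.
move=> /(diag_intertwine_map f)/(congr1 (fun X => (spectralmx q)^t* *m X *m v)).
rewrite !mulmxA unitary_inv // mul1mx -!mulmxA unitary_inv // mulmx1 => ->.
by rewrite /fun_calc mulmxA.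
Qed.

Lemma fun_calc_conj (f : C -> C) n (q k : 'M[C]_n) : q^t* = q ->
  k \is unitarymx -> fun_calc f (k *m q *m k^t*) = k *m fun_calc f q *m k^t*.
Proof.
move=> qh uk; rewrite {1}(hermitian_spectralE qh).
have u : spectralmx q *m k^t* \is unitarymx.
  by rewrite mul_unitarymx ?spectral_unitarymx ?trmxC_unitary.
have := fun_calcE f u (hermitian_spectral_real qh).
by rewrite adjmxM trmxCK !mulmxA.
Qed.

Definition posdef n (q : 'M[C]_n) :=
  q^t* = q /\ forall x : 'rV[C]_n, x != 0 -> 0 < (x *m q *m x^t*) 0 0.

Lemma posdef_spectral n (q : 'M[C]_n) : posdef q -> forall i, 0 < spectral_diag q 0 i.
Proof.
move=> [qh qp] i; pose x : 'rV[C]_n := row i (spectralmx q).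
have us := spectral_unitarymx q.
have xE : x *m (spectralmx q)^t* = delta_mx 0 i.
  by rewrite /x -row_mul (unitarymxP us) row1.
have x0 : x != 0.
  apply/eqP => e; move: xE; rewrite e mul0mx => /matrixP/(_ 0 i).
  by rewrite !mxE !eqxx => /eqP; rewrite eq_sym oner_eq0.
have := qp x x0; rewrite {1}(hermitian_spectralE qh) !mulmxA xE.
have -> : (delta_mx 0 i : 'rV[C]_n) *m diag_mx (spectral_diag q) *m spectralmx q *m x^t* =
   (delta_mx 0 i : 'rV[C]_n) *m diag_mx (spectral_diag q) *m (x *m (spectralmx q)^t*)^t*.
  by rewrite adjmxM trmxCK !mulmxA.
rewrite xE -rowE mxE (bigD1 i) //= big1 ?addr0 => [|j ji].
  by rewrite !mxE !eqxx mulr1n rmorph1 mulr1.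
by rewrite !mxE eqxx (negbTE ji) /= rmorph0 mulr0.
Qed.

Lemma posdef_mul_adj m n (A : 'M[C]_(m, n)) : row_free A -> posdef (A *m A^t*).
Proof.
move=> Af; split=> [|x x0]; first by rewrite adjmxM trmxCK.
rewrite mulmxA -(mulmxA _ (A^t*)) -adjmxM; apply: row_mul_adj_gt0.
by apply: contraNneq x0 => xA; apply/eqP/(row_free_injr Af); rewrite /= xA mul0mx.
Qed.

Definition inv_sqrt (x : C) : C := (sqrtC x)^-1.

Lemma inv_sqrt_real x : 0 < x -> 0 < inv_sqrt x.
Proof. by move=> x0; rewrite /inv_sqrt invr_gt0 sqrtC_gt0. Qed.

Definition inv_sqrt_mx n (q : 'M[C]_n) := fun_calc inv_sqrt q.

Section InvSqrt.
Variables (n : nat) (q : 'M[C]_n).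
Hypothesis qp : posdef q.

Lemma inv_sqrt_diag_real :
  mxbar (map_mx inv_sqrt (spectral_diag q)) = map_mx inv_sqrt (spectral_diag q).
Proof.
apply/rowP => i; rewrite !mxE.
by apply/CrealP/ger0_real/ltW/inv_sqrt_real/posdef_spectral.
Qed.

Lemma inv_sqrt_mx_adj : (inv_sqrt_mx q)^t* = inv_sqrt_mx q.
Proof.
by rewrite /inv_sqrt_mx /fun_calc !adjmxM trmxCK adj_diag_mx ?mulmxA // inv_sqrt_diag_real.
Qed.

Lemma inv_sqrt_mxE : inv_sqrt_mx q *m q *m inv_sqrt_mx q = 1%:M.
Proof.
have us := spectral_unitarymx q; case: (qp) => qh _.
rewrite {2}(hermitian_spectralE qh) /inv_sqrt_mx /fun_calc !mulmxA.
rewrite -(mulmxA _ (spectralmx q) ((spectralmx q)^t*)) (unitarymxP us) mulmx1.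
rewrite -(mulmxA _ (spectralmx q) ((spectralmx q)^t*)) (unitarymxP us) mulmx1.
rewrite -(mulmxA ((spectralmx q)^t*) (diag_mx _)) -(mulmxA ((spectralmx q)^t*) (_ *m _)).
rewrite !mulmx_diag (_ : diag_mx _ = 1%:M) ?mulmx1 ?unitary_inv //.
rewrite -[RHS]diag_const_mx; congr diag_mx; apply/rowP => i; rewrite !mxE.
have d0 := posdef_spectral qp i; rewrite /inv_sqrt.
rewrite -[X in _ * X * _](sqrtCK (spectral_diag q 0 i)).
by field; rewrite sqrtC_eq0 gt_eqF.
Qed.

Lemma inv_sqrt_mx_unit : inv_sqrt_mx q \in unitmx.
Proof. by have := inv_sqrt_mxE; rewrite -mulmxA => /mulmx1_unit[]. Qed.

(** Conjugating a diagonalization of [q] gives one of its conjugate with the same real eigenvalues.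
    This is what keeps real frames real under orthonormalization. *)
Lemma inv_sqrt_mx_mxbar : inv_sqrt_mx (mxbar q) = mxbar (inv_sqrt_mx q).
Proof.
case: (qp) => qh _; have dr := hermitian_spectral_real qh.
have := @fun_calcE inv_sqrt n (mxbar (spectralmx q)) (spectral_diag q).
rewrite conjC_unitary spectral_unitarymx => /(_ isT dr).
have -> : (mxbar (spectralmx q))^t* *m diag_mx (spectral_diag q) *m mxbar (spectralmx q) = mxbar q.
  by rewrite [in RHS](hermitian_spectralE qh) !map_mxM /= map_diag_mx dr map_trmx.
rewrite -/(inv_sqrt_mx _) => ->; rewrite /inv_sqrt_mx /fun_calc !map_mxM /= map_diag_mx map_trmx.
by rewrite inv_sqrt_diag_real.
Qed.

End InvSqrt.

End FunctionalCalculus.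

(** * Orthonormalization and orthogonal projectors *)

Section Orthonormalization.
Variable C : numClosedFieldType.

Lemma unitary_row_free m n (A : 'M[C]_(m, n)) : A \is unitarymx -> row_free A.
Proof. by move=> /mxrank_unitary h; rewrite /row_free h. Qed.

(** The polar factor of [A]. On free families of rows it is continuous, and it is compatible with
    conjugation. *)
Definition orthonormalize m n (A : 'M[C]_(m, n)) := inv_sqrt_mx (A *m A^t*) *m A.

Lemma orthonormalize_unitary m n (A : 'M[C]_(m, n)) :
  row_free A -> orthonormalize A \is unitarymx.
Proof.
move=> /posdef_mul_adj qp; apply/unitarymxP; rewrite /orthonormalize adjmxM.
by rewrite inv_sqrt_mx_adj // mulmxA -(mulmxA _ A) inv_sqrt_mxE.
Qed.

Lemma orthonormalize_eqmx m n (A : 'M[C]_(m, n)) :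
  row_free A -> (orthonormalize A :=: A)%MS.
Proof.
move=> /posdef_mul_adj qp; apply: eqmxMfull.
by rewrite row_full_unit inv_sqrt_mx_unit.
Qed.

Lemma sub_unitaryE m n p (A : 'M[C]_(m, n)) (B : 'M[C]_(p, n)) : B \is unitarymx ->
  (A <= B)%MS = (A *m (B^t* *m B) == A).
Proof.
move=> uB; apply/idP/eqP => [/submxP[D ->]|<-]; last by rewrite mulmxA submxMl.
by rewrite mulmxA -(mulmxA D) (unitarymxP uB) mulmx1.
Qed.

Definition orthoprojector n (P : 'M[C]_n) := P^t* = P /\ P *m P = P.

Lemma orthoprojector_unitary m n (B : 'M[C]_(m, n)) :
  B \is unitarymx -> orthoprojector (B^t* *m B).
Proof.
by move=> uB; split; rewrite ?adjmxM ?trmxCK // mulmxA -(mulmxA _ B) (unitarymxP uB) mulmx1.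
Qed.

Lemma mxtrace_unitary_proj m n (B : 'M[C]_(m, n)) :
  B \is unitarymx -> \tr (B^t* *m B) = m%:R.
Proof. by move=> uB; rewrite mxtrace_mulC (unitarymxP uB) mxtrace1. Qed.

(** The difference of the two projectors is Hermitian and idempotent, so its squared Hilbert-Schmidt
    norm equals its trace, which is 0. *)
Lemma orthoprojectorE m n (B : 'M[C]_(m, n)) (P : 'M[C]_n) : B \is unitarymx ->
  orthoprojector P -> B *m P = B -> \tr P = m%:R -> P = B^t* *m B.
Proof.
move=> uB [Ph PP] BP trP; apply/eqP; rewrite -subr_eq0; apply/eqP.
set D := P - _.
have PB : P *m B^t* = B^t* by rewrite -{1}Ph -adjmxM BP.
have DE : D *m D^t* = D.
  have -> : D^t* = D.
    by rewrite /D linearB map_mxB /= Ph adjmxM trmxCK.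
  rewrite /D mulmxBl !mulmxBr PP mulmxA PB -(mulmxA _ B P) BP.
  by rewrite mulmxA -(mulmxA _ B) (unitarymxP uB) mulmx1 subrr subr0.
by apply: mul_adj_eq0; rewrite DE /D linearB /= trP mxtrace_unitary_proj // subrr.
Qed.

(** A matrix attached to the row space alone, by [eqmx_orthoproj]. Through it, containment in a
    varying subspace becomes an equation between continuous functions, hence a closed condition. *)
Definition orthoproj m n (A : 'M[C]_(m, n)) : 'M[C]_n :=
  (orthonormalize (row_base A))^t* *m orthonormalize (row_base A).

Lemma row_base_orthonormalize_unitary m n (A : 'M[C]_(m, n)) :
  orthonormalize (row_base A) \is unitarymx.
Proof. exact/orthonormalize_unitary/row_base_free. Qed.

Lemma orthoprojP m n (A : 'M[C]_(m, n)) : orthoprojector (orthoproj A).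
Proof. exact/orthoprojector_unitary/row_base_orthonormalize_unitary. Qed.

Lemma mxtrace_orthoproj m n (A : 'M[C]_(m, n)) : \tr (orthoproj A) = (\rank A)%:R.
Proof. exact/mxtrace_unitary_proj/row_base_orthonormalize_unitary. Qed.

Lemma sub_orthoproj m n p (A : 'M[C]_(m, n)) (B : 'M[C]_(p, n)) :
  (B <= A)%MS = (B *m orthoproj A == B).
Proof.
rewrite -sub_unitaryE ?row_base_orthonormalize_unitary //.
by rewrite (orthonormalize_eqmx (row_base_free A)) eq_row_base.
Qed.

Lemma eqmx_orthoproj m n p (A : 'M[C]_(m, n)) (B : 'M[C]_(p, n)) :
  (A :=: B)%MS -> orthoproj A = orthoproj B.
Proof.
move=> AB; apply: orthoprojectorE; first exact: row_base_orthonormalize_unitary.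
- exact: orthoprojP.
- apply/eqP; rewrite -sub_orthoproj AB.
  by rewrite (orthonormalize_eqmx (row_base_free B)) eq_row_base.
- by rewrite mxtrace_orthoproj AB.
Qed.

End Orthonormalization.
(** * Hermitian forms compatible with a real structure *)

Section KreinSpace.
Variables (C : numClosedFieldType) (N : nat) (G T : 'M[C]_N).
Hypotheses (G_herm : G^t* = G) (T_real : mxbar T = T) (T_sym : T^T = T).
Hypotheses (T_invol : T *m T = 1%:M) (T_G : T *m G *m T = - mxbar G).

(* Complex conjugation of V^C in coordinates, an antilinear involution. *)
Definition cj m (x : 'M[C]_(m, N)) : 'M[C]_(m, N) := mxbar x *m T.

Lemma T_adj : T^t* = T. Proof. by rewrite T_sym T_real. Qed.

Lemma cjK m (x : 'M[C]_(m, N)) : cj (cj x) = x.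
Proof. by rewrite /cj map_mxM mxbarK /= T_real -mulmxA T_invol mulmx1. Qed.

Lemma cjM m p (A : 'M[C]_(m, p)) (x : 'M[C]_(p, N)) : cj (A *m x) = mxbar A *m cj x.
Proof. by rewrite /cj map_mxM mulmxA. Qed.

Lemma cjD m (x y : 'M[C]_(m, N)) : cj (x + y) = cj x + cj y.
Proof. by rewrite /cj map_mxD mulmxDl. Qed.

Lemma cjB m (x y : 'M[C]_(m, N)) : cj (x - y) = cj x - cj y.
Proof. by rewrite /cj map_mxB mulmxBl. Qed.

Lemma cjZ m a (x : 'M[C]_(m, N)) : cj (a *: x) = a^* *: cj x.
Proof. by rewrite /cj map_mxZ scalemxAl. Qed.

Lemma cj_col_mx m p (x : 'M[C]_(m, N)) (y : 'M[C]_(p, N)) :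
  cj (col_mx x y) = col_mx (cj x) (cj y).
Proof. by rewrite /cj map_col_mx mul_col_mx. Qed.

Lemma cj_rowsub m p (f : 'I_p -> 'I_m) (x : 'M[C]_(m, N)) :
  cj (rowsub f x) = rowsub f (cj x).
Proof. by rewrite /cj map_mxsub mul_rowsub_mx. Qed.

Lemma cj_inner m p (x : 'M[C]_(m, N)) (y : 'M[C]_(p, N)) :
  cj x *m (cj y)^t* = mxbar (x *m y^t*).
Proof.
by rewrite /cj adjmxM T_adj mulmxA -(mulmxA _ T T) T_invol mulmx1 map_mxM map_trmx.
Qed.

(** The sign comes from [T_G]: conjugation exchanges positive and negative vectors. *)
Lemma cj_kappa m p (x : 'M[C]_(m, N)) (y : 'M[C]_(p, N)) :
  cj x *m G *m (cj y)^t* = - mxbar (x *m G *m y^t*).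
Proof.
have -> : cj x *m G *m (cj y)^t* = mxbar x *m (T *m G *m T) *m (mxbar y)^t*.
  by rewrite /cj adjmxM T_adj !mulmxA.
by rewrite T_G mulmxN mulNmx !map_mxM map_trmx.
Qed.

Lemma cj_unitary m (x : 'M[C]_(m, N)) : x \is unitarymx -> cj x \is unitarymx.
Proof.
by move=> /unitarymxP ux; apply/unitarymxP; rewrite cj_inner ux map_mx1.
Qed.

Lemma cjS m p (x : 'M[C]_(m, N)) (y : 'M[C]_(p, N)) : (x <= y)%MS -> (cj x <= cj y)%MS.
Proof. by move=> /submxP[D ->]; rewrite cjM submxMl. Qed.

(** The doubled real and imaginary parts of the rows of [Y] are fixed by [cj] and span the same
    space. A maximal free subfamily of them has a real Gram matrix, because [cj] conjugates inner
    products, so orthonormalizing it leaves it real. *)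
Lemma cj_stable_real_basis m (Y : 'M[C]_(m, N)) : (cj Y <= Y)%MS ->
  exists B : 'M[C]_(\rank Y, N), [/\ B \is unitarymx, cj B = B & (B :=: Y)%MS].
Proof.
move=> cY; pose Z := col_mx (Y + cj Y) ('i *: (Y - cj Y)).
have cZ : cj Z = Z.
  rewrite /Z cj_col_mx cjD cjZ cjB cjK conjCi addrC scaleNr -scalerN opprB.
  by [].
have ZY : (Z :=: Y)%MS.
  apply/eqmxP/andP; split.
    by rewrite col_mx_sub addmx_sub // scalemx_sub // addmx_sub // eqmx_opp.
  have -> : Y = 2^-1 *: ((Y + cj Y) + (- 'i) *: ('i *: (Y - cj Y))).
    rewrite scalerA mulNr -expr2 sqrCi opprK scale1r addrACA subrr addr0.
    by rewrite -mulr2n -[Y *+ 2]scaler_nat scalerA mulVf ?scale1r // pnatr_eq0.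
  apply/scalemx_sub/addmx_sub; first by rewrite -addsmxE addsmxSl.
  by apply: scalemx_sub; rewrite -addsmxE addsmxSr.
have rZ : \rank Z = \rank Y by rewrite ZY.
pose B0 := rowsub (maxrankfun Z) Z.
have B0f : row_free B0 by exact: maxrowsub_free.
have cB0 : cj B0 = B0 by rewrite cj_rowsub cZ.
have B0Z : (B0 :=: Z)%MS by exact: eq_maxrowsub.
rewrite -rZ; exists (orthonormalize B0); split.
- exact: orthonormalize_unitary.
- by rewrite /orthonormalize cjM cB0 -(inv_sqrt_mx_mxbar (posdef_mul_adj B0f)) -cj_inner cB0.
- by apply: eqmx_trans (orthonormalize_eqmx B0f) _; apply: eqmx_trans B0Z ZY.
Qed.

End KreinSpace.

(** * Orthonormal frames that diagonalize a Hermitian form *)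

Section SignFrames.
Variables (C : numClosedFieldType) (N : nat) (G : 'M[C]_N).

(** Sylvester's argument: if p exceeded the number of positive entries of [d], some nonzero
    combination of the rows of [A] would have no coordinate along the positive rows of [B], and the
    form would be nonpositive on it. *)
Lemma inertia_pos_le k p (B : 'M[C]_(k, N)) d (A : 'M[C]_(p, N)) :
  B *m G *m B^t* = diag_mx d -> (forall i, d 0 i \is Num.real) -> (A <= B)%MS ->
  (forall x : 'rV[C]_p, x != 0 -> 0 < (x *m A *m G *m (x *m A)^t*) 0 0) ->
  (p <= #|[pred i | (0 < d 0 i)%R]|)%N.
Proof.
move=> BE dr /submxP[M ->] pos; rewrite leqNgt; apply/negP => lt.
pose M1 := colsub (enum_val : 'I_#|[pred i | (0 < d 0 i)%R]| -> 'I_k) M.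
have /rowV0Pn[x /sub_kermxP xM x0] : kermx M1 != 0.
  rewrite kermx_eq0 /row_free neq_ltn; apply/orP; left.
  exact: leq_ltn_trans (rank_leq_col _) lt.
have := pos x x0; rewrite mulmxA adjmxM.
have -> : x *m M *m B *m G *m (B^t* *m (x *m M)^t*) = x *m M *m (B *m G *m B^t*) *m (x *m M)^t*.
  by rewrite !mulmxA.
rewrite BE mul_mx_diag mxE => /lt_geF/negP; apply.
rewrite sumr_le0 // => j _; rewrite mxE [_^t* j 0]mxE [_^T j 0]mxE mulrAC -normCK.
have [dj|] := boolP (0 < d 0 j).
  have -> : (x *m M) 0 j = 0.
    have jP : j \in [pred i | 0 < d 0 i] by rewrite inE.
    have /rowP/(_ (enum_rank_in jP j)) := xM.
    rewrite !mxE => h; rewrite -[RHS]h; apply: eq_bigr => i _.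
    by rewrite mxE enum_rankK_in.
  by rewrite normr0 expr0n mul0r.
by rewrite -real_leNgt ?real0 // => dj; rewrite mulr_ge0_le0 // exprn_ge0.
Qed.

(** The comparison is a parameter because the weak version is a closed condition while uniqueness
    needs the strict one. *)
Definition sign_frame (rel : C -> C -> bool) n0 np nm (E0 : 'M[C]_(n0, N))
    (Ep : 'M[C]_(np, N)) (Em : 'M[C]_(nm, N)) dp dm :=
  let E := col_mx E0 (col_mx Ep Em) in
  [/\ E \is unitarymx,
      E *m G *m E^t* = diag_mx (row_mx 0 (row_mx dp dm)),
      forall i, rel 0 (dp 0 i) & forall i, rel (dm 0 i) 0].

Definition strict_sign_frame := @sign_frame (fun x y => x < y).
Definition weak_sign_frame := @sign_frame (fun x y => x <= y).

Hypothesis G_herm : G^t* = G.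

Lemma card_sign_partition k (d : 'rV[C]_k) : (forall i, d 0 i \is Num.real) ->
  (#|[pred i | (d 0 i == 0)%R]| + (#|[pred i | (0 < d 0 i)%R]| + #|[pred i | (d 0 i < 0)%R]|))%N
    = k.
Proof.
move=> dr; rewrite -!sum1_card [X in (X + _)%N]big_mkcond.
rewrite [X in (_ + (X + _))%N]big_mkcond [X in (_ + (_ + X))%N]big_mkcond.
rewrite -!big_split /= -[RHS]card_ord -sum1_card.
apply: eq_bigr => i _; rewrite !inE.
by case: (real_ltgt0P (dr i)).
Qed.

(** Diagonalize the compression of [G] to the row space of [B] by a unitary matrix and sort the
    eigenvectors by the sign of their eigenvalues. *)
Lemma spectral_sign_frame k (B : 'M[C]_(k, N)) : B \is unitarymx ->
  exists (n0 np nm : nat) (E0 : 'M[C]_(n0, N)) (Ep : 'M[C]_(np, N)) (Em : 'M[C]_(nm, N))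
    (dp : 'rV[C]_np) (dm : 'rV[C]_nm),
  [/\ strict_sign_frame E0 Ep Em dp dm, (col_mx E0 (col_mx Ep Em) :=: B)%MS &
      (n0 + (np + nm))%N = k].
Proof.
move=> uB; pose h := B *m G *m B^t*.
have hh : h^t* = h by rewrite /h !adjmxM trmxCK G_herm mulmxA.
pose v := spectralmx h; pose d := spectral_diag h; pose f := v *m B.
have uv : v \is unitarymx by exact: spectral_unitarymx.
have uf : f \is unitarymx by exact: mul_unitarymx.
have fE : f *m G *m f^t* = diag_mx d.
  have -> : f *m G *m f^t* = v *m h *m v^t* by rewrite /f /h !adjmxM !mulmxA.
  rewrite (hermitian_spectralE hh) -/v -/d !mulmxA (unitarymxP uv) mul1mx.
  by rewrite -mulmxA (unitarymxP uv) mulmx1.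
have dr i : d 0 i \is Num.real.
  by apply/CrealP; have /rowP/(_ i) := hermitian_spectral_real hh; rewrite mxE.
have fB : (f :=: B)%MS.
  by apply: eqmxMfull; rewrite row_full_unit unitarymx_unit.
pose P0 := [pred i | d 0 i == 0]; pose Pp := [pred i | 0 < d 0 i]; pose Pm := [pred i | d 0 i < 0].
(* The sorting permutation: null eigenvalues first, then positive, then negative ones. *)
pose g (i : 'I_(#|P0| + (#|Pp| + #|Pm|))) : 'I_k := match fintype.split i with
  | inl a => enum_val a
  | inr b => match fintype.split b with inl a => enum_val a | inr a => enum_val a end end.
have gl a : g (lshift _ a) = enum_val a by rewrite /g (unsplitK (inl _)).
have grl a : g (rshift _ (lshift _ a)) = enum_val a.
  by rewrite /g (unsplitK (inr _)) (unsplitK (inl _)).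
have grr a : g (rshift _ (rshift _ a)) = enum_val a.
  by rewrite /g (unsplitK (inr _)) (unsplitK (inr _)).
have P0P a : d 0 (enum_val (a : 'I_#|P0|)) == 0 by have := enum_valP a; rewrite inE.
have PpP a : 0 < d 0 (enum_val (a : 'I_#|Pp|)) by have := enum_valP a; rewrite inE.
have PmP a : d 0 (enum_val (a : 'I_#|Pm|)) < 0 by have := enum_valP a; rewrite inE.
have g_inj : injective g.
  move=> i j.
  case: (split_ordP i) => [a ->|b ->]; last case: (split_ordP b) => [a ->|a ->];
  (case: (split_ordP j) => [c ->|b' ->]; last case: (split_ordP b') => [c ->|c ->]);
  rewrite ?(gl, grl, grr) => e; try by rewrite (enum_val_inj e).
  - by have := PpP c; rewrite -e (eqP (P0P a)) ltxx.
  - by have := PmP c; rewrite -e (eqP (P0P a)) ltxx.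
  - by have := PpP a; rewrite e (eqP (P0P c)) ltxx.
  - by have := PmP c; rewrite -e => /(lt_trans (PpP a)); rewrite ltxx.
  - by have := PmP a; rewrite e (eqP (P0P c)) ltxx.
  - by have := PmP a; rewrite e => /(lt_trans (PpP c)); rewrite ltxx.
pose E := rowsub g f.
have EE m (X : 'M[C]_(m, _)) : E *m X^t* = rowsub g (f *m X^t*) by rewrite mul_rowsub_mx.
have uE : E \is unitarymx.
  apply/unitarymxP; rewrite mul_rowsub_mx (_ : E^t* = colsub g (f^t*)); last first.
    by apply/matrixP => i j; rewrite !mxE.
  rewrite mulmx_colsub (unitarymxP uf); apply/matrixP => i j.
  by rewrite !mxE (inj_eq g_inj).
exists #|P0|, #|Pp|, #|Pm|, (usubmx E), (usubmx (dsubmx E)), (dsubmx (dsubmx E)).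
exists (\row_i d 0 (enum_val i)), (\row_i d 0 (enum_val i)).
have card := card_sign_partition dr.
rewrite !vsubmxK; split=> //.
  split; rewrite ?vsubmxK //.
  - have -> : E *m G *m E^t* = mxsub g g (f *m G *m f^t*).
      by apply/matrixP => i j; rewrite -mulmxA mul_rowsub_mx -mulmxA !mxE; apply: eq_bigr => a _;
        rewrite !mxE; congr (_ * _); apply: eq_bigr => b _; rewrite !mxE.
    rewrite fE (_ : row_mx _ _ = \row_i d 0 (g i)).
      by apply/matrixP => i j; rewrite !mxE (inj_eq g_inj).
    apply/rowP => i; rewrite [RHS]mxE.
    case: (split_ordP i) => [a ->|b ->]; last case: (split_ordP b) => [a ->|a ->];
      rewrite ?(gl, grl, grr, row_mxEl, row_mxEr) mxE //.
    exact/esym/eqP.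
  - by move=> i; rewrite mxE.
  - by move=> i; rewrite mxE.
apply: eqmx_trans fB; apply/eqmxP.
rewrite -(eq_leqif (mxrank_leqif_eq _)).
  by rewrite (mxrank_unitary uE) (mxrank_unitary uf) card.
by apply/row_subP => i; rewrite row_rowsub row_sub.
Qed.

End SignFrames.
Section SignFrameUniqueness.
Variables (C : numClosedFieldType) (N : nat) (G : 'M[C]_N).
Hypothesis G_herm : G^t* = G.

Lemma form_adj m p (A : 'M[C]_(m, N)) (B : 'M[C]_(p, N)) :
  (A *m G *m B^t*)^t* = B *m G *m A^t*.
Proof. by rewrite !adjmxM trmxCK G_herm mulmxA. Qed.

Lemma form_adj0 m p (A : 'M[C]_(m, N)) (B : 'M[C]_(p, N)) :
  A *m G *m B^t* = 0 -> B *m G *m A^t* = 0.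
Proof. by move=> h; rewrite -form_adj h adjmx0. Qed.

Lemma inner_adj0 m p (A : 'M[C]_(m, N)) (B : 'M[C]_(p, N)) :
  A *m B^t* = 0 -> B *m A^t* = 0.
Proof. by move=> h; rewrite -[LHS]trmxCK adjmxM trmxCK h adjmx0. Qed.

Lemma sub_col_mxl m p (A : 'M[C]_(m, N)) (B : 'M[C]_(p, N)) : (A <= col_mx A B)%MS.
Proof. by rewrite -addsmxE addsmxSl. Qed.

Lemma sub_col_mxr m p (A : 'M[C]_(m, N)) (B : 'M[C]_(p, N)) : (B <= col_mx A B)%MS.
Proof. by rewrite -addsmxE addsmxSr. Qed.

Lemma col_mx_form m p (H : 'M[C]_N) (A : 'M[C]_(m, N)) (B : 'M[C]_(p, N)) :
  col_mx A B *m H *m (col_mx A B)^t* =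
  block_mx (A *m H *m A^t*) (A *m H *m B^t*) (B *m H *m A^t*) (B *m H *m B^t*).
Proof. by rewrite mul_col_mx adj_col_mx mul_col_row. Qed.

Lemma col_mx_unitaryP m p (A : 'M[C]_(m, N)) (B : 'M[C]_(p, N)) :
  col_mx A B \is unitarymx <->
  [/\ A \is unitarymx, B \is unitarymx & A *m B^t* = 0].
Proof.
have E := col_mx_form 1%:M A B; rewrite !mulmx1 in E.
split=> [/unitarymxP|[/unitarymxP uA /unitarymxP uB AB]].
  rewrite E scalar_mx_block => /eq_block_mx[uA AB _ uB].
  by split=> //; apply/unitarymxP.
by apply/unitarymxP; rewrite E uA uB AB inner_adj0 // -scalar_mx_block.
Qed.

Lemma diag_row_mx m p (a : 'rV[C]_m) (b : 'rV[C]_p) :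
  diag_mx (row_mx a b) = block_mx (diag_mx a) 0 0 (diag_mx b).
Proof.
apply/matrixP => i j; rewrite mxE.
by case: (split_ordP i) => i' ->; case: (split_ordP j) => j' ->;
  rewrite ?(block_mxEul, block_mxEur, block_mxEdl, block_mxEdr) ?row_mxEl ?row_mxEr !mxE
    ?(inj_eq (@lshift_inj _ _)) ?(inj_eq (@rshift_inj _ _)) ?eq_lrshift ?eq_rlshift ?mulr0n.
Qed.

Lemma col_mx_diagP m p (A : 'M[C]_(m, N)) (B : 'M[C]_(p, N)) a b :
  col_mx A B *m G *m (col_mx A B)^t* = diag_mx (row_mx a b) <->
  [/\ A *m G *m A^t* = diag_mx a, A *m G *m B^t* = 0 & B *m G *m B^t* = diag_mx b].
Proof.
rewrite col_mx_form diag_row_mx; split=> [/eq_block_mx[-> -> _ ->]//|[-> AB ->]].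
by rewrite AB (form_adj0 AB).
Qed.

Lemma sign_frameP rel n0 np nm (E0 : 'M[C]_(n0, N))
    (Ep : 'M[C]_(np, N)) (Em : 'M[C]_(nm, N)) dp dm :
  sign_frame G rel E0 Ep Em dp dm <->
  [/\ [/\ E0 \is unitarymx, Ep \is unitarymx & Em \is unitarymx],
      [/\ E0 *m Ep^t* = 0, E0 *m Em^t* = 0 & Ep *m Em^t* = 0],
      [/\ E0 *m G *m E0^t* = 0, E0 *m G *m Ep^t* = 0 & E0 *m G *m Em^t* = 0],
      [/\ Ep *m G *m Ep^t* = diag_mx dp, Ep *m G *m Em^t* = 0 & Em *m G *m Em^t* = diag_mx dm] &
      (forall i, rel 0 (dp 0 i)) /\ (forall i, rel (dm 0 i) 0)].
Proof.
have d0 : diag_mx (0 : 'rV[C]_n0) = 0 by rewrite linear0.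
split.
  move=> [/col_mx_unitaryP[u0 /col_mx_unitaryP[up um pm]]].
  rewrite adj_col_mx mul_mx_row => /eqP; rewrite row_mx_eq0 => /andP[/eqP q0p /eqP q0m].
  move=> /col_mx_diagP[g0 h /col_mx_diagP[gp gpm gm]] rp rm.
  move: g0 h; rewrite d0 adj_col_mx mul_mx_row => g0 /eqP.
  by rewrite row_mx_eq0 => /andP[/eqP g0p /eqP g0m]; split.
move=> [[u0 up um] [q0p q0m pm] [g0 g0p g0m] [gp gpm gm] [rp rm]]; split=> //.
  apply/col_mx_unitaryP; split=> //; first exact/col_mx_unitaryP.
  by rewrite adj_col_mx mul_mx_row q0p q0m row_mx0.
apply/col_mx_diagP; rewrite d0; split=> //; last exact/col_mx_diagP.
by rewrite adj_col_mx mul_mx_row g0p g0m row_mx0.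
Qed.

(** The null block of any sign frame of [B] spans the kernel of the form on [B], so it can be
    exchanged for a prescribed orthonormal basis [F0] of that kernel. Prescribing [F0] makes it
    possible to use a real basis, and to share one basis between two frames. *)
Lemma spectral_sign_frame_kernel n0 k (F0 : 'M[C]_(n0, N)) (B : 'M[C]_(k, N)) :
  B \is unitarymx -> F0 \is unitarymx -> (F0 <= B)%MS -> F0 *m G *m B^t* = 0 ->
  (forall x : 'rV[C]_N, (x <= B)%MS -> x *m G *m B^t* = 0 -> (x <= F0)%MS) ->
  exists (np nm : nat) (Ep : 'M[C]_(np, N)) (Em : 'M[C]_(nm, N))
    (dp : 'rV[C]_np) (dm : 'rV[C]_nm),
  [/\ strict_sign_frame G F0 Ep Em dp dm, (col_mx F0 (col_mx Ep Em) :=: B)%MS &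
      (n0 + (np + nm))%N = k].
Proof.
move=> uB uF FB FGB ker.
have [m0 [np [nm [E0 [Ep [Em [dp [dm [sf EB ek]]]]]]]]] := spectral_sign_frame G_herm uB.
have [uE EG rp rm] := sf.
move: sf => /sign_frameP[[u0 up um] [q0p q0m qpm] [g0 g0p g0m] [gp gpm gm] _].
set E := col_mx _ _ in uE EG EB.
have E0F : (E0 <= F0)%MS.
  apply/row_subP => i; apply: ker.
    by apply: submx_trans (row_sub i E0) _; rewrite -EB /E -addsmxE addsmxSl.
  have /submxP[M ->] : (B <= E)%MS by rewrite EB.
  rewrite adjmxM mulmxA -!row_mul /E !adj_col_mx !mul_mx_row g0 g0p g0m.
  by rewrite !row_mx0 mul0mx row0.
have FE : (F0 <= E)%MS by rewrite EB.
have FEE : F0 = F0 *m E^t* *m E.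
  by move: FE; rewrite sub_unitaryE // => /eqP; rewrite mulmxA => ->.
have FE0 : (F0 <= E0)%MS.
  (* [F0] is orthogonal to all of [B] for the form, so its coordinates weighted by the eigenvalues
     vanish, and hence so do its coordinates along the nonzero eigenvalues. *)
  have h : F0 *m E^t* *m diag_mx (row_mx 0 (row_mx dp dm)) = 0.
    rewrite -EG !mulmxA -FEE.
    have /submxP[M ->] : (E <= B)%MS by rewrite EB.
    by rewrite adjmxM mulmxA FGB mul0mx.
  have z1 : F0 *m (col_mx Ep Em)^t* = 0.
    move: h; rewrite diag_row_mx /E adj_col_mx mul_mx_row mul_row_block !mulmx0 addr0 add0r.
    move=> /eqP; rewrite row_mx_eq0 => /andP[_ /eqP/matrixP {}h].
    have dn j : row_mx dp dm 0 j != 0.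
      case: (split_ordP j) => j' ->; rewrite ?row_mxEl ?row_mxEr.
        by rewrite gt_eqF ?rp.
      by rewrite lt_eqF ?rm.
    apply/matrixP => i j; have hij := h i j.
    rewrite mul_mx_diag [LHS]mxE [RHS]mxE in hij; rewrite [RHS]mxE.
    by move/eqP: hij; rewrite mulf_eq0 (negbTE (dn j)) orbF => /eqP.
  by rewrite FEE {2}/E adj_col_mx mul_mx_row z1 mul_row_col mul0mx addr0 submxMl.
have e0 : m0 = n0.
  apply/eqP; rewrite eqn_leq -(mxrank_unitary u0) -(mxrank_unitary uF).
  by rewrite !mxrankS.
subst m0; exists np, nm, Ep, Em, dp, dm; split=> //.
  have /submxP[w FwE] := FE0.
  apply/sign_frameP; split=> //.
  - by split=> //; rewrite FwE -mulmxA ?q0p ?q0m mulmx0.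
  - rewrite FwE adjmxM; split; last 2 first.
    + by rewrite -!mulmxA [E0 *m _]mulmxA g0p mulmx0.
    + by rewrite -!mulmxA [E0 *m _]mulmxA g0m mulmx0.
    by rewrite mulmxA -!(mulmxA w) g0 mul0mx mulmx0.
apply: eqmx_trans EB; apply/eqmxP; rewrite /E -!addsmxE.
by rewrite !addsmxS.
Qed.

(** The transition matrix [v] intertwines the two diagonal forms, so its entries between different
    eigenvalues vanish. Since the second frame is only weak, the null blocks have to be compared
    first; once [Ep'] and [Em'] are seen to be orthogonal to the kernel, signs separate the
    remaining blocks and [v] is block diagonal. *)
Lemma sign_frame_unique n0 np nm (E0 E0' : 'M[C]_(n0, N))
    (Ep Ep' : 'M[C]_(np, N)) (Em Em' : 'M[C]_(nm, N)) dp dm dp' dm' :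
  strict_sign_frame G E0 Ep Em dp dm -> weak_sign_frame G E0' Ep' Em' dp' dm' ->
  (col_mx E0' (col_mx Ep' Em') <= col_mx E0 (col_mx Ep Em))%MS ->
  [/\ strict_sign_frame G E0' Ep' Em' dp' dm',
      exists v, E0' = v *m E0, exists v, Ep' = v *m Ep & exists v, Em' = v *m Em].
Proof.
move=> sf sf' E'E.
have [uE EG rp rm] := sf; have [uE' E'G rp' rm'] := sf'.
move: sf => /sign_frameP[[u0 up um] [q0p q0m qpm] _ _ _].
move: (sf') => /sign_frameP[[u0' up' um'] [q0p' q0m' qpm'] g0' gpm' _].
set E := col_mx _ _ in uE EG E'E; set E' := col_mx _ _ in uE' E'G E'E.
pose v := E' *m E^t*.
have E'v : E' = v *m E by move: E'E; rewrite sub_unitaryE // mulmxA => /eqP.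
have vv : v^t* *m v = 1%:M.
  apply: mulmx1C; rewrite {2}/v adjmxM trmxCK mulmxA -E'v.
  exact/unitarymxP.
have vD : v *m diag_mx (row_mx 0 (row_mx dp dm)) = diag_mx (row_mx 0 (row_mx dp' dm')) *m v.
  have -> : diag_mx (row_mx 0 (row_mx dp' dm')) *m v = E' *m G *m (v^t* *m E')^t*.
    by rewrite -E'G adjmxM trmxCK !mulmxA.
  have -> : v^t* *m E' = E by rewrite E'v mulmxA vv mul1mx.
  by rewrite -EG !mulmxA -E'v.
have d1N j : row_mx dp dm 0 j != 0.
  case: (split_ordP j) => j' ->; rewrite ?row_mxEl ?row_mxEr.
    by rewrite gt_eqF ?rp.
  by rewrite lt_eqF ?rm.
have decomp m (X : 'M[C]_(m, N)) : (X <= E)%MS ->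
    X = X *m E0^t* *m E0 + (X *m Ep^t* *m Ep + X *m Em^t* *m Em).
  rewrite sub_unitaryE // => /eqP {1}<-.
  by rewrite /E !adj_col_mx !mul_row_col mulmxDr mulmxDr !mulmxA.
move: vD; rewrite /v /E /E' adj_col_mx mul_col_row !diag_row_mx !mulmx_block.
rewrite -!diag_row_mx !(mulmx0, mul0mx, addr0, add0r) linear0 !(mulmx0, mul0mx).
move=> /eq_block_mx[_ /matrixP v01 _ v11].
have {}v01 : E0' *m (col_mx Ep Em)^t* = 0.
  apply/matrixP => i j; have hij := v01 i j.
  rewrite mul_mx_diag [LHS]mxE [RHS]mxE in hij; rewrite [RHS]mxE.
  by move/eqP: hij; rewrite mulf_eq0 (negbTE (d1N j)) orbF => /eqP.
move: v01; rewrite adj_col_mx mul_mx_row => /eqP; rewrite row_mx_eq0 => /andP[/eqP v0p /eqP v0m].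
have E0'E : (E0' <= E)%MS.
  exact: submx_trans (sub_col_mxl _ _) E'E.
have E1'E : (col_mx Ep' Em' <= E)%MS.
  exact: submx_trans (sub_col_mxr _ _) E'E.
have Ep'E : (Ep' <= E)%MS.
  exact: submx_trans (sub_col_mxl _ _) E1'E.
have Em'E : (Em' <= E)%MS.
  exact: submx_trans (sub_col_mxr _ _) E1'E.
have E0'v : E0' = E0' *m E0^t* *m E0.
  by rewrite {1}(decomp _ _ E0'E) v0p v0m !mul0mx !addr0.
(* Both null blocks have n0 rows, so the isometry between them is square and thus invertible. Rows
   orthogonal to [E0'] are therefore orthogonal to [E0]. *)
have v00 : (E0' *m E0^t*)^t* \in unitmx.
  apply: (proj1 (mulmx1_unit (B := E0' *m E0^t*) _)); apply: mulmx1C.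
  by rewrite adjmxM trmxCK mulmxA -E0'v; apply/unitarymxP.
have vp0 : Ep' *m E0^t* = 0.
  have : Ep' *m E0'^t* = 0 by exact: inner_adj0.
  rewrite E0'v adjmxM mulmxA => /(congr1 (mulmx^~ (invmx ((E0' *m E0^t*)^t*)))).
  by rewrite mulmxK // mul0mx.
have vm0 : Em' *m E0^t* = 0.
  have : Em' *m E0'^t* = 0 by exact: inner_adj0.
  rewrite E0'v adjmxM mulmxA => /(congr1 (mulmx^~ (invmx ((E0' *m E0^t*)^t*)))).
  by rewrite mulmxK // mul0mx.
move: v11; rewrite adj_col_mx mul_col_row !diag_row_mx !mulmx_block.
rewrite !(mulmx0, mul0mx, addr0, add0r) => /eq_block_mx[vpp vpm vmp vmm].
(* A nonzero entry would equate a nonnegative eigenvalue with a negative one. *)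
have {}vpm : Ep' *m Em^t* = 0.
  apply/matrixP => i j; rewrite [RHS]mxE; apply/eqP/negPn/negP => nz.
  have := rm j; rewrite (diag_intertwine vpm nz) => /(le_lt_trans (rp' i)).
  by rewrite ltxx.
have {}vmp : Em' *m Ep^t* = 0.
  apply/matrixP => i j; rewrite [RHS]mxE; apply/eqP/negPn/negP => nz.
  have := rp j; rewrite (diag_intertwine vmp nz) => /lt_le_trans/(_ (rm' i)).
  by rewrite ltxx.
have Ep'v : Ep' = Ep' *m Ep^t* *m Ep.
  by rewrite {1}(decomp _ _ Ep'E) vp0 vpm !mul0mx addr0 add0r.
have Em'v : Em' = Em' *m Em^t* *m Em.
  by rewrite {1}(decomp _ _ Em'E) vm0 vmp !mul0mx !add0r.
(* Each row of [Ep'] has a nonzero coordinate along [Ep], so its eigenvalue is one of the strictly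
   positive [dp]; likewise for [Em']. This upgrades the weak signs to strict ones. *)
have row_nz m (X Y : 'M[C]_(m, N)) : X \is unitarymx -> X = X *m Y^t* *m Y ->
    forall i, exists j, (X *m Y^t*) i j != 0.
  move=> uX XY i; have : row i (X *m Y^t*) != 0.
    apply/eqP => r0; have /unitarymxP/matrixP/(_ i i) := uX.
    rewrite {1}XY -!mulmxA => h; move: h; rewrite mulmxA.
    have -> : (X *m Y^t* *m (Y *m X^t*)) i i = (row i (X *m Y^t*) *m (Y *m X^t*)) 0 i.
      by rewrite -row_mul [RHS]mxE.
    by rewrite r0 mul0mx !mxE eqxx => /eqP; rewrite eq_sym oner_eq0.
  by move=> /rV0Pn[j]; rewrite mxE => nz; exists j.
split; [split=> //|by eexists; exact: E0'v|by eexists; exact: Ep'v|by eexists; exact: Em'v].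
  by move=> i; have [j nz] := row_nz _ _ _ up' Ep'v i; rewrite -(diag_intertwine vpp nz).
by move=> i; have [j nz] := row_nz _ _ _ um' Em'v i; rewrite -(diag_intertwine vmm nz).
Qed.

End SignFrameUniqueness.
Section RealSignFrames.
Variables (C : numClosedFieldType) (N : nat) (G T : 'M[C]_N).
Hypotheses (G_herm : G^t* = G) (T_real : mxbar T = T) (T_sym : T^T = T).
Hypotheses (T_invol : T *m T = 1%:M) (T_G : T *m G *m T = - mxbar G).
Local Notation cj := (cj T).

Lemma diag_gram_pos p (E : 'M[C]_(p, N)) d : E *m G *m E^t* = diag_mx d ->
  (forall i, 0 < d 0 i) ->
  forall x : 'rV[C]_p, x != 0 -> 0 < (x *m E *m G *m (x *m E)^t*) 0 0.
Proof.
move=> EG dp x x0; rewrite adjmxM.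
have -> : x *m E *m G *m (E^t* *m x^t*) = x *m (E *m G *m E^t*) *m x^t* by rewrite !mulmxA.
rewrite EG mul_mx_diag mxE; have [j xj] := rV0Pn _ x0.
have ge k : 0 <= (\matrix_(i, j) (x i j * d 0 j)) 0 k * x^t* k 0.
  by rewrite !mxE mulrAC -normCK mulr_ge0 ?exprn_ge0 // ltW.
rewrite (bigD1 j) //= ltr_wpDr ?sumr_ge0 //.
by rewrite !mxE mulrAC -normCK mulr_gt0 // exprn_gt0 // normr_gt0.
Qed.

Lemma strict_sign_frame_real_diag n0 np nm (E0 : 'M[C]_(n0, N))
    (Ep : 'M[C]_(np, N)) (Em : 'M[C]_(nm, N)) dp dm (i : 'I_(n0 + (np + nm))) :
  strict_sign_frame G E0 Ep Em dp dm ->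
  (row_mx (0 : 'rV[C]_n0) (row_mx dp dm)) 0 i \is Num.real.
Proof.
move=> [_ _ rp rm]; case: (split_ordP i) => [j ->|j ->]; rewrite ?row_mxEl ?row_mxEr.
  by rewrite mxE real0.
case: (split_ordP j) => [k ->|k ->]; rewrite ?row_mxEl ?row_mxEr.
  exact: gtr0_real.
exact: ltr0_real.
Qed.

Lemma card_pos_sign_frame n0 np nm (E0 : 'M[C]_(n0, N))
    (Ep : 'M[C]_(np, N)) (Em : 'M[C]_(nm, N)) dp dm :
  strict_sign_frame G E0 Ep Em dp dm ->
  #|[pred i | (0 < (row_mx (0 : 'rV[C]_n0) (row_mx dp dm)) 0 i)%R]| = np.
Proof.
move=> [_ _ rp rm]; rewrite -sum1_card big_mkcond big_split_ord big_split_ord /=.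
rewrite big1 ?add0n; last by move=> i _; rewrite inE row_mxEl mxE ltxx.
rewrite [X in (_ + X)%N]big1 ?addn0; last first.
  by move=> i _; rewrite inE !row_mxEr lt_gtF.
rewrite (eq_bigr (fun=> 1%N)) ?sum1_card ?card_ord // => i _.
by rewrite inE row_mxEr row_mxEl rp.
Qed.

Lemma strict_sign_frame_cj n0 np nm (E0 : 'M[C]_(n0, N))
    (Ep : 'M[C]_(np, N)) (Em : 'M[C]_(nm, N)) dp dm : cj E0 = E0 ->
  strict_sign_frame G E0 Ep Em dp dm ->
  strict_sign_frame G E0 (cj Em) (cj Ep) (- dm) (- dp).
Proof.
move=> c0 /(sign_frameP G_herm)[[u0 up um] [q0p q0m qpm] [g0 g0p g0m] [gp gpm gm] [rp rm]].
have diag_conj m (d : 'rV[C]_m) : (forall i, d 0 i \is Num.real) ->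
    - mxbar (diag_mx d) = diag_mx (- d).
  move=> dr; rewrite linearN /= map_diag_mx; congr (- diag_mx _).
  by apply/rowP => i; rewrite mxE; apply/CrealP.
apply/(sign_frameP G_herm); split; last first.
- by split=> i; rewrite mxE ?oppr_gt0 ?oppr_lt0.
- split.
  + by rewrite cj_kappa // gm diag_conj // => i; exact: ltr0_real.
  + by rewrite cj_kappa // (form_adj0 G_herm gpm) map_mx0 oppr0.
  + by rewrite cj_kappa // gp diag_conj // => i; exact: gtr0_real.
- split=> //; first by rewrite -c0 cj_kappa // g0m map_mx0 oppr0.
  by rewrite -c0 cj_kappa // g0p map_mx0 oppr0.
- split; first by rewrite -c0 cj_inner // q0m map_mx0.
    by rewrite -c0 cj_inner // q0p map_mx0.
  by rewrite cj_inner // inner_adj0 ?map_mx0.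
- by split=> //; exact: cj_unitary.
Qed.

(** Conjugating a sign frame of a real subspace gives another one with the two signs exchanged.
    Inertia shows that the positive and negative blocks have equal size, and uniqueness that [cj Ep]
    lies in the span of [Em], so [cj Ep] can serve as the negative block. *)
Lemma real_spectral_sign_frame n0 k (F0 : 'M[C]_(n0, N)) (B : 'M[C]_(k, N)) :
  B \is unitarymx -> F0 \is unitarymx -> (F0 <= B)%MS -> F0 *m G *m B^t* = 0 ->
  (forall x : 'rV[C]_N, (x <= B)%MS -> x *m G *m B^t* = 0 -> (x <= F0)%MS) ->
  cj F0 = F0 -> (cj B <= B)%MS ->
  exists (p : nat) (Ep : 'M[C]_(p, N)) (dp : 'rV[C]_p),
  [/\ strict_sign_frame G F0 Ep (cj Ep) dp (- dp),
      (col_mx F0 (col_mx Ep (cj Ep)) :=: B)%MS & (n0 + (p + p))%N = k].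
Proof.
move=> uB uF FB FGB ker cF cB.
have [p [q [Ep [Em [dp [dm [sf EB ek]]]]]]] := spectral_sign_frame_kernel G_herm uB uF FB FGB ker.
have sf' := strict_sign_frame_cj cF sf.
have E'E : (col_mx F0 (col_mx (cj Em) (cj Ep)) <= col_mx F0 (col_mx Ep Em))%MS.
  have cE : (cj (col_mx F0 (col_mx Ep Em)) <= col_mx F0 (col_mx Ep Em))%MS.
    by rewrite EB; apply: submx_trans cB; apply: cjS; rewrite EB.
  apply: submx_trans cE; rewrite !cj_col_mx cF -!addsmxE addsmxS //.
  by rewrite -!addsmxE addsmxC.
have EE' : (col_mx F0 (col_mx Ep Em) <= col_mx F0 (col_mx (cj Em) (cj Ep)))%MS.
  have [uE _ _ _] := sf; have [uE' _ _ _] := sf'.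
  rewrite -(geq_leqif (mxrank_leqif_sup E'E)) (mxrank_unitary uE) (mxrank_unitary uE').
  by rewrite (addnC q).
have le m m' (A0 : 'M[C]_(n0, N)) (Ap Bm : 'M[C]_(m, N)) (Am Bp : 'M[C]_(m', N)) dAp dAm dBp dBm :
    strict_sign_frame G A0 Ap Am dAp dAm -> strict_sign_frame G A0 Bp Bm dBp dBm ->
    (col_mx A0 (col_mx Bp Bm) <= col_mx A0 (col_mx Ap Am))%MS -> (m' <= m)%N.
  move=> sfA sfB BA; have [_ AG _ _] := sfA.
  have /(sign_frameP G_herm)[_ _ _ [BG _ _] [rB _]] := sfB.
  rewrite -(card_pos_sign_frame sfA).
  apply: (inertia_pos_le AG _ _ (diag_gram_pos BG rB)).
    by move=> i; exact: strict_sign_frame_real_diag sfA.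
  apply: submx_trans BA; apply: submx_trans (sub_col_mxr _ _); exact: sub_col_mxl.
have pq : p = q.
  by apply/eqP; rewrite eqn_leq (le _ _ _ _ _ _ _ _ _ _ _ sf' sf EE') (le _ _ _ _ _ _ _ _ _ _ _
    sf sf' E'E).
subst q.
have [_ _ _ [w cEp]] : [/\ strict_sign_frame G F0 (cj Em) (cj Ep) (- dm) (- dp),
      exists v, F0 = v *m F0, exists v, cj Em = v *m Ep & exists v, cj Ep = v *m Em].
  apply: (sign_frame_unique G_herm sf _ E'E).
  by have [? ? rp rm] := sf'; split=> // i; apply: ltW; [exact: rp | exact: rm].
move: (sf) => /(sign_frameP G_herm)[[u0 up um] [q0p q0m qpm] [g0 g0p g0m] [gp gpm gm] [rp rm]].
move: sf' => /(sign_frameP G_herm)[[_ _ ucp] [_ q0cp _] [_ _ g0cp] [_ _ gcp] _].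
have sf2 : strict_sign_frame G F0 Ep (cj Ep) dp (- dp).
  apply/(sign_frameP G_herm); split=> //.
  - by split=> //; rewrite cEp adjmxM mulmxA qpm mul0mx.
  - by split=> //; rewrite cEp adjmxM mulmxA gpm mul0mx.
  - by split=> // i; rewrite mxE oppr_lt0.
exists p, Ep, dp; split=> //.
have sub : (col_mx F0 (col_mx Ep (cj Ep)) <= col_mx F0 (col_mx Ep Em))%MS.
  by rewrite -!addsmxE addsmxS // -!addsmxE addsmxS // cEp submxMl.
apply: eqmx_trans EB; apply/eqmxP; rewrite -(eq_leqif (mxrank_leqif_eq sub)).
by have [uE _ _ _] := sf; have [uE2 _ _ _] := sf2; rewrite (mxrank_unitary uE) (mxrank_unitary uE2).
Qed.

End RealSignFrames.

(** * The standard Hermitian form and complex Darboux bases *)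

Section StandardForm.
Variable C : numClosedFieldType.

(** In a symplectic basis made of n positive vectors and their conjugates, [std_form] is the matrix
    of kappa, and conjugation is entrywise conjugation followed by [swap_mx]. *)
Definition std_form n : 'M[C]_(n + n) := block_mx 1%:M 0 0 (- 1%:M).
Definition swap_mx n : 'M[C]_(n + n) := block_mx 0 1%:M 1%:M 0.

Variable n : nat.
Local Notation G := (std_form n).
Local Notation T := (swap_mx n).

Lemma std_form_herm : G^t* = G.
Proof.
rewrite /std_form tr_block_mx map_block_mx !trmx0 !map_mx0 trmx1 map_mx1.
by rewrite linearN /= trmx1 map_mxN map_mx1.
Qed.

Lemma std_form_invol : G *m G = 1%:M.
Proof.
rewrite /std_form mulmx_block !(mulmx0, mul0mx, mulmxN, mulNmx, mulmx1, addr0, add0r).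
by rewrite opprK -scalar_mx_block.
Qed.

Lemma swap_mx_real : mxbar T = T.
Proof. by rewrite /swap_mx map_block_mx !map_mx0 !map_mx1. Qed.

Lemma swap_mx_sym : T^T = T.
Proof. by rewrite /swap_mx tr_block_mx !trmx0 !trmx1. Qed.

Lemma swap_mx_invol : T *m T = 1%:M.
Proof.
by rewrite /swap_mx mulmx_block !(mulmx0, mul0mx, mulmx1, addr0, add0r) -scalar_mx_block.
Qed.

Lemma swap_std_form : T *m G *m T = - mxbar G.
Proof.
rewrite /std_form map_block_mx !map_mx0 map_mxN map_mx1 /swap_mx opp_block_mx !mulmx_block.
by rewrite !(mulmx0, mul0mx, mulmx1, mul1mx, mulmxN, mulNmx, addr0, add0r) oppr0 opprK.
Qed.

Lemma mul_row_swap m (a b : 'M[C]_(m, n)) : row_mx a b *m T = row_mx b a.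
Proof. by rewrite /swap_mx mul_row_block !(mulmx0, mulmx1, addr0, add0r). Qed.

Lemma mul_row_std_form m (a b : 'M[C]_(m, n)) : row_mx a b *m G = row_mx a (- b).
Proof. by rewrite /std_form mul_row_block !(mulmx0, mulmxN, mulmx1, addr0, add0r). Qed.

Lemma mul_swap_col m (a b : 'M[C]_(n, m)) : T *m col_mx a b = col_mx b a.
Proof. by rewrite /swap_mx mul_block_col !(mul0mx, mul1mx, addr0, add0r). Qed.

Lemma cj_row_mx m (a b : 'M[C]_(m, n)) : cj T (row_mx a b) = row_mx (mxbar b) (mxbar a).
Proof. by rewrite /cj map_row_mx mul_row_swap. Qed.

Lemma row_std_form m p (a b : 'M[C]_(m, n)) (c d : 'M[C]_(p, n)) :
  row_mx a b *m G *m (row_mx c d)^t* = a *m c^t* - b *m d^t*.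
Proof. by rewrite mul_row_std_form adj_row_mx mul_row_col mulNmx. Qed.

Lemma row_inner m p (a b : 'M[C]_(m, n)) (c d : 'M[C]_(p, n)) :
  row_mx a b *m (row_mx c d)^t* = a *m c^t* + b *m d^t*.
Proof. by rewrite adj_row_mx mul_row_col. Qed.

Lemma mulmx_eq1C d k (A : 'M[C]_(d, k)) (B : 'M[C]_(k, d)) :
  d = k -> A *m B = 1%:M -> B *m A = 1%:M.
Proof. by move=> e; subst d; exact: mulmx1C. Qed.

Lemma inv_sqrt_diag_gram m p (H : 'M[C]_m) (E : 'M[C]_(p, m)) (dp : 'rV[C]_p) :
  E *m H *m E^t* = diag_mx dp -> (forall i, 0 < dp 0 i) ->
  let l := diag_mx (map_mx (@inv_sqrt C) dp) *m E in l *m H *m l^t* = 1%:M.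
Proof.
move=> EH dpos l; rewrite /l adjmxM.
have -> : diag_mx (map_mx (@inv_sqrt C) dp) *m E *m H *m (E^t* *m (diag_mx (map_mx (@inv_sqrt C)
  dp))^t*) =
   diag_mx (map_mx (@inv_sqrt C) dp) *m (E *m H *m E^t*) *m (diag_mx (map_mx (@inv_sqrt C) dp))^t*.
  by rewrite !mulmxA.
rewrite EH adj_diag_mx; last first.
  by apply/rowP => i; rewrite !mxE; apply/CrealP/gtr0_real/inv_sqrt_real.
rewrite !mulmx_diag -[RHS]diag_const_mx; congr diag_mx.
apply/rowP => i; rewrite !mxE /inv_sqrt.
rewrite -[X in _ * X * _](sqrtCK (dp 0 i)).
by field; rewrite sqrtC_eq0 gt_eqF.
Qed.

(* With respect to the trivial conjugation, [H] plays the role of [-i omega]: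
   its positive eigenvectors and their conjugates form the symplectic basis. *)
Lemma darboux_mx d (H : 'M[C]_d) : H^t* = H -> mxbar H = - H -> H \in unitmx ->
  d = (n + n)%N ->
  exists (M : 'M[C]_(n + n, d)) (Psi : 'M[C]_(d, n + n)),
  [/\ M *m Psi = 1%:M, Psi *m M = 1%:M, cj T Psi = Psi &
      Psi *m G *m Psi^t* = H].
Proof.
move=> Hh Hc Hu dn.
have t1 : mxbar (1%:M : 'M[C]_d) = 1%:M by rewrite map_mx1.
have t4 : 1%:M *m H *m 1%:M = - mxbar H by rewrite mul1mx mulmx1 Hc opprK.
have uB : (1%:M : 'M[C]_d) \is unitarymx by apply/unitarymxP; rewrite adjmx1 mulmx1.
have uF : (0 : 'M[C]_(0, d)) \is unitarymx by apply/unitarymxP/matrixP => -[].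
(* [H] is invertible, so the null block is a matrix with no rows. *)
have [p [Ep [dp [sf EB ek]]]] : exists (p : nat) (Ep : 'M[C]_(p, d)) (dp : 'rV[C]_p),
  [/\ strict_sign_frame H (0 : 'M[C]_(0, d)) Ep (cj 1%:M Ep) dp (- dp),
      (col_mx (0 : 'M[C]_(0, d)) (col_mx Ep (cj 1%:M Ep)) :=: (1%:M : 'M[C]_d))%MS & (0 + (p +
        p))%N = d].
  apply: (real_spectral_sign_frame Hh t1 (trmx1 _ _) (mulmx1 _) t4 uB uF).
  - exact: sub0mx.
  - by rewrite !mul0mx.
  - move=> x _; rewrite adjmx1 mulmx1 => /(congr1 (mulmx^~ (invmx H))).
    by rewrite mulmxK // mul0mx => ->; exact: sub0mx.
  - by apply/matrixP => -[].
  - exact: submx1.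
have pn : p = n by move: ek; rewrite add0n dn !addnn => /double_inj.
subst p; have /(sign_frameP Hh)[_ _ _ [gp gpm _] [rp _]] := sf.
pose l := diag_mx (map_mx (@inv_sqrt C) dp) *m Ep.
have lH : l *m H *m l^t* = 1%:M by exact: inv_sqrt_diag_gram.
have cl : mxbar l = diag_mx (map_mx (@inv_sqrt C) dp) *m cj 1%:M Ep.
  rewrite /cj mulmx1 /l map_mxM /= map_diag_mx; congr (diag_mx _ *m _).
  by apply/rowP => i; rewrite !mxE; apply/CrealP/gtr0_real/inv_sqrt_real.
pose D := diag_mx (map_mx (@inv_sqrt C) dp).
have lHc : l *m H *m (mxbar l)^t* = 0.
  have -> : l *m H *m (mxbar l)^t* = D *m (Ep *m H *m (cj 1%:M Ep)^t*) *m D^t*.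
    by rewrite cl adjmxM /l !mulmxA.
  by rewrite gpm mulmx0 mul0mx.
pose M := col_mx l (mxbar l).
have cM : mxbar M = T *m M by rewrite /M map_col_mx mxbarK mul_swap_col.
have MH : M *m H *m M^t* = G.
  rewrite /M (col_mx_form H) lH lHc (form_adj0 Hh lHc) /std_form; congr block_mx.
  have := @cj_kappa _ _ H 1%:M t1 (trmx1 _ _) t4 _ _ l l.
  by rewrite /cj !mulmx1 lH map_mx1.
(* The inverse of [M], read off from [MH] and from [G] being an involution. *)
pose Psi := H *m M^t* *m G.
have MP : M *m Psi = 1%:M by rewrite /Psi !mulmxA MH std_form_invol.
have PM : Psi *m M = 1%:M by apply: mulmx_eq1C MP; rewrite dn.
have cPsi : cj T Psi = Psi.
  have cMa : mxbar (M^t*) = M^t* *m T.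
    rewrite -[T in RHS](T_adj swap_mx_real swap_mx_sym) -adjmxM -cM adj_mxbar.
    by apply/matrixP => i j; rewrite !mxE conjCK.
  rewrite /cj /Psi !map_mxM /= Hc cMa -[mxbar G]opprK -swap_std_form.
  rewrite !(mulNmx, mulmxN) opprK !mulmxA.
  by rewrite -(mulmxA _ T T) swap_mx_invol mulmx1 -(mulmxA _ T T) swap_mx_invol mulmx1.
clearbody Psi; exists M, Psi; split=> //.
have : M *m (Psi *m G *m Psi^t*) *m M^t* = M *m H *m M^t*.
  by rewrite MH !mulmxA MP mul1mx -mulmxA -adjmxM MP adjmx1 mulmx1.
move=> /(congr1 (fun X => Psi *m X *m Psi^t*)); rewrite !mulmxA PM !mul1mx.
by rewrite -!(mulmxA _ (M^t*)) -!adjmxM PM adjmx1 !mulmx1.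
Qed.

End StandardForm.
(** * Symplectic frames and their unitary part *)

Section SymplecticFrames.
Variables (C : numClosedFieldType) (n : nat).
Local Notation G := (std_form C n).
Local Notation T := (swap_mx C n).
Local Notation cj := (cj T).
Implicit Types (l : 'M[C]_(n, n + n)) (t : C).

(* The rows l encode the symplectic map with matrix col_mx l (cj l) in
   complex Darboux coordinates. *)
Definition symp_frame l := l *m G *m l^t* = 1%:M /\ l *m G *m (cj l)^t* = 0.

Lemma adjmxZ m p a (A : 'M[C]_(m, p)) : (a *: A)^t* = a^* *: A^t*.
Proof. by apply/matrixP => i j; rewrite !mxE rmorphM. Qed.

Lemma cj_std_form m p (x : 'M[C]_(m, n + n)) (y : 'M[C]_(p, n + n)) :
  cj x *m G *m (cj y)^t* = - mxbar (x *m G *m y^t*).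
Proof. exact: cj_kappa (swap_mx_real _ _) (swap_mx_sym _ _) (swap_std_form _ _) _ _ _ _. Qed.

Lemma symp_frame_mx l : symp_frame l ->
  col_mx l (cj l) *m G *m (col_mx l (cj l))^t* = G.
Proof.
move=> [h1 h2]; rewrite (col_mx_form G) h1 h2 (form_adj0 (std_form_herm _ _) h2).
by rewrite cj_std_form h1 map_mx1.
Qed.

Lemma symp_frame_unitary (u : 'M[C]_n) : u \is unitarymx -> symp_frame (row_mx u 0).
Proof.
move=> /unitarymxP uu; rewrite /symp_frame cj_row_mx !row_std_form uu.
by rewrite !map_mx0 !adjmx0 !mulmx0 mul0mx !subr0.
Qed.

Lemma unitary_of_symp_frame (u : 'M[C]_n) : symp_frame (row_mx u 0) -> u \is unitarymx.
Proof. by move=> [+ _]; rewrite row_std_form mul0mx subr0 => /unitarymxP. Qed.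

Definition shrink t l := row_mx (lsubmx l) (t *: rsubmx l).
Definition shrink_gram t l := shrink t l *m G *m (shrink t l)^t*.
(* For l = (a, b) this is (a a^* - t^2 b b^* )^(-1/2) (a, t b), a path from
   a unitary matrix (t = 0) to l (t = 1) that commutes with left
   multiplication by unitary matrices. *)
Definition retract t l := inv_sqrt_mx (shrink_gram t l) *m shrink t l.

(** Substitute a a^* = 1 + b b^* for the frame (a, b). The resulting form makes positivity on the
    time interval [0, 1] evident. *)
Lemma shrink_gramE t l : symp_frame l -> t^* = t ->
  shrink_gram t l = 1%:M + (1 - t ^+ 2) *: (rsubmx l *m (rsubmx l)^t*).
Proof.
move=> [h _] tr; have {}h : lsubmx l *m (lsubmx l)^t* - rsubmx l *m (rsubmx l)^t* = 1%:M.
  by rewrite -row_std_form hsubmxK.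
rewrite -h /shrink_gram /shrink row_std_form.
rewrite -scalemxAl adjmxZ tr -scalemxAr scalerA -expr2 scalerBl scale1r.
by rewrite addrA subrK.
Qed.

Lemma shrink_gram_posdef t l : symp_frame l -> 0 <= t <= 1 -> posdef (shrink_gram t l).
Proof.
move=> sl /andP[t0 t1]; have tr : t^* = t by apply/CrealP/ger0_real.
have c0 : 0 <= 1 - t ^+ 2 by rewrite subr_ge0 expr_le1.
split=> [|x x0].
  by rewrite /shrink_gram (form_adj (std_form_herm _ _)).
pose y := x *m rsubmx l.
have -> : x *m shrink_gram t l *m x^t* = x *m x^t* + (1 - t ^+ 2) *: (y *m y^t*).
  rewrite shrink_gramE // mulmxDr mulmx1 mulmxDl -scalemxAr -scalemxAl.
  by rewrite /y adjmxM !mulmxA.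
rewrite mxE [X in _ + X]mxE ltr_wpDr ?row_mul_adj_gt0 //.
by rewrite mulr_ge0 // tr_mul_adj_ge0.
Qed.

(** For l = (a, b) the isotropy condition is a b^T - b a^T = 0. Each term contains b once, so
    scaling b by t multiplies the expression by t. *)
Lemma shrink_symp0 t l : symp_frame l -> t^* = t ->
  shrink t l *m G *m (cj (shrink t l))^t* = 0.
Proof.
move=> [_ h] tr; have : t *: (row_mx (lsubmx l) (rsubmx l) *m G *m
    (cj (row_mx (lsubmx l) (rsubmx l)))^t*) = 0 by rewrite hsubmxK h scaler0.
rewrite /shrink !cj_row_mx !row_std_form !adj_mxbar => <-.
by rewrite linearZ /= -scalemxAr -scalemxAl scalerBr.
Qed.

Lemma retract_symp t l : symp_frame l -> 0 <= t <= 1 -> symp_frame (retract t l).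
Proof.
move=> sl t01; have qp := shrink_gram_posdef sl t01.
have tr : t^* = t by case/andP: t01 => t0 _; apply/CrealP/ger0_real.
rewrite /retract; set m := inv_sqrt_mx _; split.
  have -> : m *m shrink t l *m G *m (m *m shrink t l)^t* = m *m shrink_gram t l *m m^t*.
    by rewrite adjmxM !mulmxA.
  by rewrite inv_sqrt_mx_adj // inv_sqrt_mxE.
have -> : m *m shrink t l *m G *m (cj (m *m shrink t l))^t* =
    m *m (shrink t l *m G *m (cj (shrink t l))^t*) *m (mxbar m)^t*.
  by rewrite cjM adjmxM !mulmxA.
by rewrite shrink_symp0 // mulmx0 mul0mx.
Qed.

Lemma inv_sqrt_mx1 : inv_sqrt_mx (1%:M : 'M[C]_n) = 1%:M.
Proof.
have u1 : (1%:M : 'M[C]_n) \is unitarymx by apply/unitarymxP; rewrite adjmx1 mulmx1.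
have d1 : mxbar (const_mx 1 : 'rV[C]_n) = const_mx 1 by apply/rowP => i; rewrite !mxE rmorph1.
have := fun_calcE (@inv_sqrt C) u1 d1.
rewrite adjmx1 !mulmx1 !mul1mx diag_const_mx map_const_mx => e.
by rewrite /inv_sqrt_mx e {1}/inv_sqrt sqrtC1 invr1 diag_const_mx.
Qed.

Lemma retract1 l : symp_frame l -> retract 1 l = l.
Proof.
move=> sl; rewrite /retract shrink_gramE ?rmorph1 // expr1n subrr scale0r addr0.
by rewrite inv_sqrt_mx1 mul1mx /shrink scale1r hsubmxK.
Qed.

Lemma retract_mul t (k : 'M[C]_n) l : k \is unitarymx ->
  retract t (k *m l) = k *m retract t l.
Proof.
move=> uk; have sk : shrink t (k *m l) = k *m shrink t l.
  by rewrite /shrink mul_mx_row -mulmx_lsub -mulmx_rsub -scalemxAr.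
rewrite /retract {1}/shrink_gram sk.
have -> : k *m shrink t l *m G *m (k *m shrink t l)^t* = k *m shrink_gram t l *m k^t*.
  by rewrite adjmxM /shrink_gram !mulmxA.
rewrite /inv_sqrt_mx fun_calc_conj //; last by rewrite /shrink_gram (form_adj (std_form_herm _ _)).
by rewrite -!mulmxA (mulmxA (k^t*)) unitary_inv // mul1mx.
Qed.

Lemma retract_unitary t (u : 'M[C]_n) : u \is unitarymx ->
  retract t (row_mx u 0) = row_mx u 0.
Proof.
move=> /unitarymxP uu; rewrite /retract /shrink_gram /shrink row_mxKl row_mxKr scaler0.
by rewrite row_std_form uu mul0mx subr0 inv_sqrt_mx1 mul1mx.
Qed.

Lemma retract0 l : symp_frame l ->
  retract 0 l = row_mx (lsubmx (retract 0 l)) 0 /\ lsubmx (retract 0 l) \is unitarymx.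
Proof.
move=> sl; have e : retract 0 l = row_mx (lsubmx (retract 0 l)) 0.
  rewrite -[LHS]hsubmxK; congr row_mx.
  by rewrite /retract -mulmx_rsub /shrink row_mxKr scale0r mulmx0.
split=> //; apply: unitary_of_symp_frame; rewrite -e.
by apply: retract_symp; rewrite // lexx ler01.
Qed.

End SymplecticFrames.
Section SetTypeTopology.
Variables (T : choiceType) (Y : topologicalType).

Lemma cvg_initial (f : T -> Y) (S : Type) (F : set_system S) {FF : Filter F}
    (g : S -> T) (a : T) :
  (fun x => f (g x)) @ F --> f a -> (g x : initial_topology f) @[x --> F] --> (a :
    initial_topology f).
Proof.
move=> h B; rewrite nbhsE => -[U [[W openW <-] /= fa] WB].
have hW := h W (open_nbhs_nbhs (conj openW fa)).
exact: (@filterS _ F FF (fun x => W (f (g x))) (fun x => B (g x)) (fun x => @WB (g x)) hW).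
Qed.

End SetTypeTopology.

Lemma cvg_set_type (Y : topologicalType) (A : set Y) (S : Type) (F : set_system S)
    {FF : Filter F} (g : S -> set_type A) (a : set_type A) :
  (fun x => val (g x)) @ F --> val a -> g @ F --> a.
Proof. exact: cvg_initial. Qed.

Lemma continuous_val (Y : topologicalType) (A : set Y) :
  continuous (val : set_type A -> Y).
Proof. exact: initial_continuous. Qed.

(** * Continuity of the inverse square root of positive matrices *)

Section InvSqrtContinuity.
Variable R : realType.
Local Notation C := R[i].

(* Agrees with inv_sqrt on positive numbers and, unlike it, is obviously
   continuous there. *)
Definition inv_sqrt_Re (z : C) : C := ((Num.sqrt (complex.Re z))^-1)%:C%C.

Lemma inv_sqrt_ReE (z : C) : 0 < z -> inv_sqrt_Re z = inv_sqrt z.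
Proof.
move=> z0; rewrite /inv_sqrt_Re /inv_sqrt.
have zE : z = (complex.Re z)%:C%C by case: z z0 => a b; rewrite ltcE /= => /andP[/eqP->].
have r0 : 0 < complex.Re z by move: z0; rewrite {1}zE ltcR.
have e : z = ((Num.sqrt (complex.Re z))%:C%C) ^+ 2.
  by rewrite -rmorphXn /= sqr_sqrtr ?ltW.
by rewrite [in RHS]e sqrCK ?fmorphV // lecR sqrtr_ge0.
Qed.

Lemma cvgC_inv_sqrt_Re (S : Type) (F : set_system S) {FF : Filter F} (f : S -> C) (a : C) :
  0 < a -> f @ F --> a -> (fun x => inv_sqrt_Re (f x) : C) @ F --> (inv_sqrt_Re a : C).
Proof.
move=> a0 /cvgC_Re fa; apply: cvgC_R; apply: cvgV.
  by rewrite gt_eqF // sqrtr_gt0; move: a0; rewrite ltcE => /andP[].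
exact: (cvg_comp _ _ fa (@sqrt_continuous R _)).
Qed.

Definition diag_row n (A : 'M[C]_n) : 'rV[C]_n := \row_i A i i.

Lemma cvg_diag_row (S : Type) (F : set_system S) {FF : Filter F} n (f : S ->
  'M[C]_n) (A : 'M[C]_n) :
  f @ F --> A -> (fun x => diag_row (f x)) @ F --> diag_row A.
Proof.
move=> fA; apply: cvg_mx => i j; rewrite mxE; under eq_fun do rewrite mxE.
exact: (cvg_mx_coord fA).
Qed.

Lemma cvg_diag_mx (S : Type) (F : set_system S) {FF : Filter F} n (f : S ->
  'rV[C]_n) (a : 'rV[C]_n) :
  f @ F --> a -> (fun x => diag_mx (f x) : 'M[C]_n) @ F --> (diag_mx a : 'M[C]_n).
Proof.
move=> fa; apply: cvg_mx => i j; rewrite mxE; under eq_fun do rewrite mxE.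
case: (i == j); last by rewrite mulr0n; under eq_fun do rewrite mulr0n; exact: cvg_cst.
by rewrite mulr1n; under eq_fun do rewrite mulr1n; exact: (cvg_mx_coord fa).
Qed.

Lemma cvg_map_inv_sqrt_Re (S : Type) (F : set_system S) {FF : Filter F} n
    (f : S -> 'rV[C]_n) (a : 'rV[C]_n) : (forall i, 0 < a 0 i) ->
  f @ F --> a -> (fun x => map_mx inv_sqrt_Re (f x)) @ F --> map_mx inv_sqrt_Re a.
Proof.
move=> a0 fa; apply: cvg_mx => i j; rewrite mxE; under eq_fun do rewrite mxE.
rewrite (ord1 i); exact: (cvgC_inv_sqrt_Re (a0 j) (cvg_mx_coord (i := 0) (j := j) fa)).
Qed.

(** Eigenvectors cannot be chosen continuously where eigenvalues collide. The relation that v is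
    unitary and diagonalizes q(x) is however closed and bounded, and the matrix computed from v does
    not depend on v, so [compact_relation_continuous] applies. *)
Lemma inv_sqrt_mx_continuous (X : topologicalType) n (q : X -> 'M[C]_n) :
  continuous q -> (forall x, posdef (q x)) -> continuous (fun x => inv_sqrt_mx (q x)).
Proof.
move=> cq qp.
pose h (p : X * 'M[C]_n) := p.2 *m q p.1 *m p.2^t*.
pose d (p : X * 'M[C]_n) : 'rV[C]_n := diag_row (h p).
pose rel : set (X * 'M[C]_n) := [set p | p.2 *m p.2^t* = 1%:M] `&` [set p | h p = diag_mx (d p)].
have c1 : continuous (fun p : X * 'M[C]_n => q p.1).
  by move=> p; apply: (@continuous_comp _ _ _ fst q); [exact: cvg_fst | exact: cq].
have c2 : continuous (fun p : X * 'M[C]_n => p.2) by move=> p; exact: cvg_snd.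
have ch : continuous h.
  by move=> p; exact: (cvg_mulmx (cvg_mulmx (c2 p) (c1 p)) (cvg_adjmx (c2 p))).
have cvv : continuous (fun p : X * 'M[C]_n => p.2 *m p.2^t*).
  by move=> p; exact: (cvg_mulmx (c2 p) (cvg_adjmx (c2 p))).
have c1' : continuous (fun p : X * 'M[C]_n => (1%:M : 'M[C]_n)) by move=> p; exact: cvg_cst.
have cd : continuous (fun p => diag_mx (d p) : 'M[C]_n).
  by move=> p; apply: cvg_diag_mx; exact: (cvg_diag_row (ch p)).
have relE x v : rel (x, v) -> v \is unitarymx /\ q x = v^t* *m diag_mx (d (x, v)) *m v.
  move=> [/= /unitarymxP uv hd]; split=> //; rewrite -hd /h /= !mulmxA unitary_inv // mul1mx.
  by rewrite -mulmxA unitary_inv // mulmx1.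
have dpos x v i : rel (x, v) -> 0 < d (x, v) 0 i.
  move=> /relE[uv _]; rewrite mxE /h /=.
  have -> : (v *m q x *m v^t*) i i = (row i v *m q x *m (row i v)^t*) 0 0.
    rewrite -!row_mul !mxE; apply: eq_bigr => k _; rewrite !mxE.
    by congr (_ * _); rewrite !mxE.
  apply: (proj2 (qp x)); apply/eqP => r0.
  have /matrixP/(_ i i) := unitarymxP uv.
  have -> : (v *m v^t*) i i = (row i v *m v^t*) 0 i by rewrite -row_mul [RHS]mxE.
  by rewrite r0 mul0mx !mxE eqxx => /eqP; rewrite eq_sym oner_eq0.
apply: (@compact_relation_continuous _ _ _ (@unit_box R n n) rel
  (fun p => p.2^t* *m diag_mx (map_mx inv_sqrt_Re (d p)) *m p.2)).
- exact: compact_unit_box.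
- exact: (closedI (closed_eqmx cvv c1') (closed_eqmx ch cd)).
- by move=> x v [/= vv _]; apply: unit_box_rows => i; rewrite vv mxE eqxx.
- move=> x; exists (spectralmx (q x)).
  have us := spectral_unitarymx (q x).
  have hE : h (x, spectralmx (q x)) = diag_mx (spectral_diag (q x)).
    have [qh _] := qp x; rewrite /h /= {2}(hermitian_spectralE qh) !mulmxA (unitarymxP us).
    by rewrite mul1mx -mulmxA (unitarymxP us) mulmx1.
  split; first exact/unitarymxP.
  rewrite /= /d hE; congr diag_mx; apply/rowP => i.
  by rewrite !mxE eqxx.
- move=> x v r; have [uv qE] := relE _ _ r.
  have dr : mxbar (d (x, v)) = d (x, v).
    by apply/rowP => i; rewrite [LHS]mxE; apply/CrealP/gtr0_real/dpos.
  have dI : map_mx inv_sqrt_Re (d (x, v)) = map_mx (@inv_sqrt C) (d (x, v)).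
    by apply/rowP => i; rewrite [LHS]mxE [RHS]mxE; apply: inv_sqrt_ReE; exact: dpos.
  by rewrite /inv_sqrt_mx [in RHS]qE (fun_calcE _ uv dr) -dI.
- move=> x v r; set Fw := within _ _.
  have FF : Filter Fw by exact: within_filter.
  have c2w : p.2 @[p --> Fw] --> v by apply: cvg_within_filter; exact: (c2 (x, v)).
  have chw : h p @[p --> Fw] --> h (x, v) by apply: cvg_within_filter; exact: (ch (x, v)).
  have cD : diag_mx (map_mx inv_sqrt_Re (d p)) @[p --> Fw] --> diag_mx (map_mx inv_sqrt_Re (d (x,
    v))).
    apply: cvg_diag_mx; apply: cvg_map_inv_sqrt_Re; last exact: (cvg_diag_row chw).
    by move=> i; exact: dpos.
  exact: (cvg_mulmx (cvg_mulmx (cvg_adjmx c2w) cD) c2w).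
Qed.

End InvSqrtContinuity.

(** * The space of symplectic frames and its retraction *)

Section SymplecticSpace.
Variables (R : realType) (n : nat).
Local Notation C := R[i].
Local Notation G := (std_form C n).
Local Notation T := (swap_mx C n).

Definition symp_space : topologicalType := set_type [set l : 'M[C]_(n, n + n) | symp_frame l].

Lemma symp_frame1 : symp_frame (row_mx (1%:M : 'M[C]_n) 0).
Proof. by apply: symp_frame_unitary; apply/unitarymxP; rewrite adjmx1 mulmx1. Qed.

(** Made total by a default value, the base frame (1, 0), so that frames can be built from plain
    matrices; [unitary_of] does the same with the identity matrix. *)
Definition symp_of (l : 'M[C]_(n, n + n)) : symp_space :=
  match pselect (symp_frame l) with
  | left sl => SigSub (mem_set sl : l \in [set l | symp_frame l])
  | right _ => SigSub (mem_set symp_frame1 : _ \in [set l | symp_frame l])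
  end.

Lemma val_symp_of l : symp_frame l -> val (symp_of l) = l.
Proof. by rewrite /symp_of; case: pselect. Qed.

Lemma symp_spaceP (s : symp_space) : symp_frame (val s).
Proof. by have /set_mem := valP s. Qed.

Lemma unitary1 : (1%:M : 'M[C]_n) \is unitarymx.
Proof. by apply/unitarymxP; rewrite adjmx1 mulmx1. Qed.

Definition unitary_of (u : 'M[C]_n) : unitary_group R n :=
  match pselect (u \is unitarymx) with
  | left uu => SigSub (mem_set uu : u \in [set g : 'M[C]_n | g \is unitarymx])
  | right _ => SigSub (mem_set unitary1 : _ \in [set g : 'M[C]_n | g \is unitarymx])
  end.

Lemma val_unitary_of u : u \is unitarymx -> val (unitary_of u) = u.
Proof. by rewrite /unitary_of; case: pselect. Qed.

Lemma unitary_groupP (u : unitary_group R n) : (val u : 'M[C]_n) \is unitarymx.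
Proof. by have /set_mem := valP u. Qed.

(* Homotopies are functions on X * R that matter only over [0, 1]. *)
Definition clamp (t : R) : R := 2^-1 * (`|t| - `|t - 1| + 1).

Lemma clamp01 t : 0 <= clamp t <= 1.
Proof.
rewrite /clamp; case: (ger0P t) => ht; case: (ger0P (t - 1)) => ht1; apply/andP; split; lra.
Qed.

Lemma clamp0 : clamp 0 = 0.
Proof. by rewrite /clamp normr0 !sub0r normrN normr1 addNr mulr0. Qed.

Lemma clamp1 : clamp 1 = 1.
Proof. by rewrite /clamp subrr normr0 normr1 subr0 -mulr2n mulVf // pnatr_eq0. Qed.

Lemma clamp_continuous : continuous clamp.
Proof.
move=> t; rewrite /clamp; apply: cvgM; first exact: cvg_cst.
apply: cvgD; last exact: cvg_cst.
apply: cvgB; first exact: norm_continuous.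
by apply: cvg_norm; apply: cvgB; [exact: cvg_id | exact: cvg_cst].
Qed.

Lemma clampC t : 0 <= (clamp t)%:C%C <= (1 : C).
Proof. by have /andP[h0 h1] := clamp01 t; apply/andP; split; [rewrite lecR | rewrite
  -[1]/(1%:C)%C lecR]. Qed.

Definition flow (p : R * symp_space) : symp_space :=
  symp_of (retract (clamp p.1)%:C%C (val p.2)).

Lemma val_flow p : val (flow p) = retract (clamp p.1)%:C%C (val p.2).
Proof. by rewrite val_symp_of //; apply: retract_symp; [exact: symp_spaceP | exact: clampC]. Qed.

Lemma flow1 s : flow (1, s) = s.
Proof. by apply: val_inj; rewrite val_flow /= clamp1 retract1 //; exact: symp_spaceP. Qed.

Lemma cvg_lsubmx (S : Type) (F : set_system S) {FF : Filter F} m a b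
    (f : S -> 'M[C]_(m, a + b)) (A : 'M[C]_(m, a + b)) :
  f @ F --> A -> (fun x => lsubmx (f x)) @ F --> lsubmx A.
Proof.
move=> fA; apply: cvg_mx => i j; rewrite mxE; under eq_fun do rewrite mxE.
exact: (cvg_mx_coord fA).
Qed.

Lemma cvg_rsubmx (S : Type) (F : set_system S) {FF : Filter F} m a b
    (f : S -> 'M[C]_(m, a + b)) (A : 'M[C]_(m, a + b)) :
  f @ F --> A -> (fun x => rsubmx (f x)) @ F --> rsubmx A.
Proof.
move=> fA; apply: cvg_mx => i j; rewrite mxE; under eq_fun do rewrite mxE.
exact: (cvg_mx_coord fA).
Qed.

Lemma flow_continuous : continuous flow.
Proof.
pose t (p : R * symp_space) : C := (clamp p.1)%:C%C.
pose l (p : R * symp_space) : 'M[C]_(n, n + n) := val p.2.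
have ct : continuous t.
  move=> p; apply: cvgC_R; apply: (@continuous_comp _ _ _ fst clamp); first exact: cvg_fst.
  exact: clamp_continuous.
have cl : continuous l.
  by move=> p; apply: (@continuous_comp _ symp_space 'M[C]_(n, n + n) snd val);
    [exact: cvg_snd | exact: continuous_val].
have cs : continuous (fun p => shrink (t p) (l p)).
  move=> p; exact: (cvg_row_mx (cvg_lsubmx (cl p)) (cvg_scalemx (ct p) (cvg_rsubmx (cl p)))).
have cG : continuous (fun p : R * symp_space => G) by move=> p; exact: cvg_cst.
have cg : continuous (fun p => shrink_gram (t p) (l p)).
  by move=> p; exact: (cvg_mulmx (cvg_mulmx (cs p) (cG p)) (cvg_adjmx (cs p))).
have gp p : posdef (shrink_gram (t p) (l p)).
  by apply: shrink_gram_posdef; [exact: symp_spaceP | exact: clampC].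
have ci := inv_sqrt_mx_continuous cg gp.
have e : (fun p => val (flow p)) = (fun p => retract (t p) (l p)).
  by apply/funext => p; exact: val_flow.
have cr : continuous (fun p => retract (t p) (l p)).
  by move=> p; exact: (cvg_mulmx (ci p) (cs p)).
by move=> p; apply: cvg_set_type; exact: (eq_ind_r (fun f => continuous f) cr e p).
Qed.

Definition gram_row (l : 'M[C]_(n, n + n)) : 'rV[C]_n := diag_row (l *m G *m l^t*).

Definition normalize (l : 'M[C]_(n, n + n)) := diag_mx (map_mx (@inv_sqrt_Re R) (gram_row l)) *m l.

(** The blocks of a canonical frame are normalized for the Euclidean inner product, so the frame is
    symplectic only up to a positive factor on each row. *)
Definition prenormal (l : 'M[C]_(n, n + n)) :=
  [/\ l *m G *m l^t* = diag_mx (gram_row l), forall i, 0 < gram_row l 0 i &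
      l *m G *m (cj T l)^t* = 0].

Lemma normalizeE l : prenormal l ->
  normalize l = diag_mx (map_mx (@inv_sqrt C) (gram_row l)) *m l.
Proof.
move=> [_ lp _]; congr (diag_mx _ *m _); apply/rowP => i.
by rewrite [LHS]mxE [RHS]mxE; apply: inv_sqrt_ReE; exact: lp.
Qed.

Lemma normalize_symp l : prenormal l -> symp_frame (normalize l).
Proof.
move=> pl; have [ld lp lc] := pl; rewrite (normalizeE pl); split.
  exact: (inv_sqrt_diag_gram ld lp).
set D := diag_mx _.
have -> : D *m l *m G *m (cj T (D *m l))^t* = D *m (l *m G *m (cj T l)^t*) *m (mxbar D)^t*.
  by rewrite cjM adjmxM !mulmxA.
by rewrite lc mulmx0 mul0mx.
Qed.

Lemma cvg_normalize (S : Type) (F : set_system S) {FF : Filter F}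
    (f : S -> 'M[C]_(n, n + n)) (l : 'M[C]_(n, n + n)) : prenormal l ->
  f @ F --> l -> (fun x => normalize (f x)) @ F --> normalize l.
Proof.
move=> [_ lp _] fl.
have cG : (fun=> G) @ F --> G by exact: cvg_cst.
have cg : (fun x => f x *m G *m (f x)^t*) @ F --> l *m G *m l^t*.
  exact: (cvg_mulmx (cvg_mulmx fl cG) (cvg_adjmx fl)).
have c1 : (fun x => map_mx (@inv_sqrt_Re R) (gram_row (f x))) @ F --> map_mx (@inv_sqrt_Re R)
  (gram_row l).
  exact: (cvg_map_inv_sqrt_Re lp (cvg_diag_row cg)).
exact: (cvg_mulmx (cvg_diag_mx c1) fl).
Qed.

End SymplecticSpace.
Lemma continuous_set_type (X Y : topologicalType) (A : set Y) (g : X -> set_type A) :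
  continuous (fun x => val (g x)) -> continuous g.
Proof. by move=> h x; apply: (@cvg_set_type _ _ _ _ (nbhs_filter x)); exact: h. Qed.

Lemma cvg_symp_of (R : realType) n (S : Type) (F : set_system S) {FF : Filter F}
    (g : S -> 'M[R[i]]_(n, n + n)) (l : 'M[R[i]]_(n, n + n)) :
  symp_frame l -> (\forall y \near F, symp_frame (g y)) -> g @ F --> l ->
  (fun y => symp_of (g y)) @ F --> symp_of l.
Proof.
move=> sl ng gl; apply: cvg_set_type.
have e : \forall y \near F, g y = val (symp_of (g y)).
  by apply: filterS ng => y sy; exact: (esym (val_symp_of sy)).
have h : (fun y => val (symp_of (g y))) @ F --> l.
  exact: cvg_trans (near_eq_cvg e) gl.
exact: (eq_ind_r (fun z => _ @ F --> z) h (val_symp_of sl)).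
Qed.

Section UnitaryPart.
Variables (R : realType) (n : nat).

Lemma flow0 (s : symp_space R n) :
  val (flow (0, s)) = row_mx (lsubmx (val (flow (0, s)))) 0 /\
  lsubmx (val (flow (0, s))) \is unitarymx.
Proof.
have h : val (flow (0, s)) = retract 0 (val s).
  by have := val_flow (0, s); rewrite [(0, s).1]/= clamp0.
have r0 := retract0 (symp_spaceP s).
exact: (eq_ind_r (fun z => z = row_mx (lsubmx z) 0 /\ lsubmx z \is unitarymx) r0 h).
Qed.

(** The adjoint turns left multiplication of frames by the block group into right multiplication, as
    required by left cosets. *)
Definition unitary_part (s : symp_space R n) : unitary_group R n :=
  unitary_of ((lsubmx (val (flow (0, s))))^t*).

Lemma val_unitary_part s : val (unitary_part s) = (lsubmx (val (flow (0, s))))^t*.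
Proof. by apply: val_unitary_of; rewrite trmxC_unitary; have [] := flow0 s. Qed.

Lemma unitary_part_continuous : continuous unitary_part.
Proof.
have c1 : continuous (fun s : symp_space R n => flow (0, s)).
  move=> s; have c2 : (fun s' : symp_space R n => (0 : R, s')) @ s --> (0 : R, s).
    have ca : (fun _ : symp_space R n => 0 : R) @ s --> (0 : R) by exact: (@cvg_cst R 0 _ (nbhs
      s) (nbhs_filter s)).
    have cb : (fun s' : symp_space R n => s') @ s --> s by exact: cvg_id.
    exact: (cvg_pair ca cb).
  exact: (cvg_comp _ _ c2 (@flow_continuous _ _ _)).
have c3 : continuous (fun s : symp_space R n => val (flow (0, s)) : 'M[R[i]]_(n, n + n)).
  by move=> s; exact: (cvg_comp _ _ (c1 s) (@continuous_val _ _ _)).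
have c4 : continuous (fun s : symp_space R n => (lsubmx (val (flow (0, s))))^t*).
  by move=> s; exact: (cvg_adjmx (cvg_lsubmx (c3 s))).
have e : (fun s => val (unitary_part s)) = (fun s => (lsubmx (val (flow (0, s))))^t*).
  by apply/funext => s; exact: val_unitary_part.
have c5 := eq_ind_r (fun f : symp_space R n -> 'M[R[i]]_n => continuous f) c4 e.
exact: continuous_set_type.
Qed.

Lemma symp_of_unitary_part (s : symp_space R n) :
  symp_of (row_mx ((val (unitary_part s))^t*) 0) = flow (0, s).
Proof.
have [e us] := flow0 s.
have h : (val (unitary_part s))^t* = lsubmx (val (flow (0, s))).
  exact: etrans (congr1 (fun z : 'M[R[i]]_n => z^t*) (val_unitary_part s)) (trmxCK _).
have sf : symp_frame (row_mx ((val (unitary_part s))^t*) 0).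
  exact: (eq_ind_r (fun z => symp_frame (row_mx z 0)) (symp_frame_unitary us) h).
apply: val_inj; apply: etrans (val_symp_of sf) _.
exact: etrans (congr1 (fun z : 'M[R[i]]_n => row_mx z (0 : 'M[R[i]]_n)) h) (esym e).
Qed.

Lemma unitary_part_symp_of (u : unitary_group R n) :
  unitary_part (symp_of (row_mx ((val u)^t*) 0)) = u.
Proof.
have uu : ((val u)^t* : 'M[R[i]]_n) \is unitarymx.
  by rewrite trmxC_unitary; exact: unitary_groupP.
apply: val_inj; apply: etrans (val_unitary_part _) _.
have h1 := val_flow (0, symp_of (row_mx ((val u)^t*) 0)).
have h2 := congr1 (retract (clamp 0)%:C%C) (val_symp_of (symp_frame_unitary uu)).
have h3 := retract_unitary (clamp 0)%:C%C uu.
have h := congr1 lsubmx (etrans h1 (etrans h2 h3)); rewrite row_mxKl in h.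
exact: etrans (congr1 (fun z : 'M[R[i]]_n => z^t*) h) (trmxCK _).
Qed.

End UnitaryPart.

(** * Retraction onto the coset space *)

Section RetractionToCosets.
Variables (R : realType) (n0 np nm : nat).
Local Notation n := (n0 + np + nm)%N.
Local Notation C := R[i].
Local Notation cosets := (unitary_coset_space R n0 np nm).
Local Notation K := (@block_group R n0 np nm).
Local Notation symp := (symp_space R n).

Lemma block_group_unitary k : K k -> k \is unitarymx.
Proof.
move=> [A [B [D [oA uB uD ->]]]]; apply/unitarymxP.
have oA' : map_mx (real_complex R) A *m (map_mx (real_complex R) A)^t* = 1%:M.
  have -> : (map_mx (real_complex R) A)^t* = map_mx (real_complex R) A^T.
    by apply/matrixP => i j; rewrite !mxE; apply/CrealP; rewrite complex_real.
  by rewrite -map_mxM oA map_mx1.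
rewrite !(tr_block_mx, map_block_mx) !trmx0 !map_mx0 !mulmx_block.
rewrite !(mulmx0, mul0mx, addr0, add0r) oA' (unitarymxP uB) (unitarymxP uD).
by rewrite -!scalar_mx_block.
Qed.

Lemma block_group_adj k : K k -> K (k^t*).
Proof.
move=> Kk; have [k' Kk' kk'] := block_groupV Kk.
have -> : k^t* = k' => //.
have uk := block_group_unitary Kk.
by rewrite -[LHS]mulmx1 -kk' mulmxA unitary_inv // mul1mx.
Qed.

Definition coset (u : unitary_group R n) : cosets :=
  \pi_({eq_quot (same_coset_equivRel R n0 np nm)}) u.

Lemma coset_continuous : continuous coset.
Proof. exact: pi_continuous. Qed.

Lemma eq_coset u v : (exists2 k, K k & val v = val u *m k) -> coset u = coset v.
Proof. by move=> h; apply/eqmodP/asboolP. Qed.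

Lemma coset_eqP u v : coset u = coset v -> exists2 k, K k & val v = val u *m k.
Proof. by move=> /eqmodP/asboolP. Qed.

Definition frame_coset (s : symp) : cosets := coset (unitary_part s).

Lemma frame_coset_continuous : continuous frame_coset.
Proof.
by move=> s; exact: (cvg_comp _ _ (@unitary_part_continuous _ _ s) (@coset_continuous _)).
Qed.

Variables (X : topologicalType) (p : symp -> X) (rel : set (X * 'M[C]_(n, n + n))).
Hypothesis p_continuous : continuous p.
Hypothesis p_block : forall s s' k, K k -> val s' = k *m val s -> p s' = p s.
(* rel (x, l) says that l is a canonical, not yet normalized, frame of x.
   There need not be a continuous choice of l; boundedness and closedness of
   rel replace it. *)
Hypothesis rel_closed : closed rel.
Hypothesis rel_bounded : forall x l, rel (x, l) -> unit_box l.
Hypothesis rel_prenormal : forall x l, rel (x, l) -> prenormal l.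
Hypothesis rel_ex : forall x, exists l, rel (x, l).
Hypothesis rel_proj : forall x l, rel (x, l) -> p (symp_of (normalize l)) = x.
Hypothesis rel_unique : forall x l l', rel (x, l) -> rel (x, l') ->
  exists2 k, K k & normalize l' = k *m normalize l.
Hypothesis rel_unitary : forall u : 'M[C]_n, u \is unitarymx ->
  exists2 l, rel (p (symp_of (row_mx u 0)), l) & normalize l = row_mx u 0.

(** An arbitrary choice of canonical frame, with no continuity of its own. The maps built from it
    are continuous because their values are the same for every frame related to x. *)
Let rep x := projT1 (cid (rel_ex x)).
Let repP x : rel (x, rep x). Proof. exact: (projT2 (cid (rel_ex x))). Qed.

Let nrm (l : 'M[C]_(n, n + n)) : symp := symp_of (normalize l).

Let val_nrm x l : rel (x, l) -> val (nrm l) = normalize l.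
Proof. by move=> r; apply: val_symp_of; apply: normalize_symp; exact: rel_prenormal r. Qed.

(** Two canonical frames of x differ by an element of the block group, and such elements are
    unitary, so the flow carries the ambiguity along unchanged. *)
Let flow_nrm x l l' t : rel (x, l) -> rel (x, l') ->
  exists2 k, K k & val (flow (t, nrm l')) = k *m val (flow (t, nrm l)).
Proof.
move=> r r'; have [k Kk kE] := rel_unique r r'; exists k => //.
have h1 := etrans (val_flow (t, nrm l')) (congr1 (retract (clamp t)%:C%C) (val_nrm r')).
have h2 := etrans (val_flow (t, nrm l)) (congr1 (retract (clamp t)%:C%C) (val_nrm r)).
have h3 := retract_mul (clamp t)%:C%C (normalize l) (block_group_unitary Kk).
rewrite -kE in h3.
exact: etrans h1 (etrans h3 (congr1 (mulmx k) (esym h2))).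
Qed.

Let homotopy (q : X * R) : X := p (flow (q.2, nrm (rep q.1))).

Let cvg_nrm (S : Type) (F : set_system S) {FF : Filter F} (f : S -> X * 'M[C]_(n, n + n)) x l :
  rel (x, l) -> (\forall y \near F, rel (f y)) -> (fun y => (f y).2) @ F --> l ->
  (fun y => nrm (f y).2) @ F --> nrm l.
Proof.
move=> r nr fl; apply: (cvg_symp_of _ _ (cvg_normalize (rel_prenormal r) fl)).
  exact: normalize_symp (rel_prenormal r).
by apply: filterS nr => y; case: (f y) => x' l' r'; exact: normalize_symp (rel_prenormal r').
Qed.

(** The compact relation argument with time carried along in the base X * R; by [flow_nrm] and
    [p_block] the value does not depend on the frame. *)
Let homotopy_continuous : continuous homotopy.
Proof.
pose rel' : set ((X * R) * 'M[C]_(n, n + n)) := (fun q => (q.1.1, q.2)) @^-1` rel.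
have cproj : continuous (fun q : (X * R) * 'M[C]_(n, n + n) => (q.1.1, q.2)).
  move=> q; have c1 : q'.1.1 @[q' --> q] --> q.1.1.
    by apply: (@continuous_comp _ _ _ fst fst); exact: cvg_fst.
  have c2 : q'.2 @[q' --> q] --> q.2 by exact: cvg_snd.
  exact: (cvg_pair c1 c2).
apply: (@compact_relation_continuous _ _ _ (@unit_box R n (n + n)) rel'
  (fun q => p (flow (q.1.2, nrm q.2)))).
- exact: compact_unit_box.
- exact: continuous_closed_preimage.
- by move=> q l r; exact: rel_bounded r.
- by move=> [x t]; exact: rel_ex.
- move=> [x t] l r; have [k Kk kE] := flow_nrm t (repP x) r.
  exact: p_block Kk kE.
- move=> [x t] l r; set Fw := within _ _.
  have FF : Filter Fw by exact: within_filter.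
  have c1 : (fun q => nrm q.2) @ Fw --> nrm l.
    apply: (@cvg_nrm _ Fw FF (fun q => (q.1.1, q.2)) x l r).
      exact: withinT.
    by apply: cvg_within_filter; exact: (@cvg_snd _ _ (nbhs (x, t)) (nbhs l)).
  have c2 : (fun q => q.1.2) @ Fw --> t.
    apply: cvg_within_filter; apply: (@continuous_comp _ _ _ fst snd (x, t, l)).
      exact: cvg_fst.
    exact: cvg_snd.
  have c3 : (fun q => (q.1.2, nrm q.2)) @ Fw --> (t, nrm l) by exact: (cvg_pair c2 c1).
  have c4 : p (flow z) @[z --> (t, nrm l)] --> p (flow (t, nrm l)).
    exact: (@continuous_comp _ _ _ (@flow R n) p (t, nrm l) (@flow_continuous _ _ _)
      (@p_continuous _)).
  exact: (cvg_comp _ _ c3 c4).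
Qed.

Let to_coset (x : X) : cosets := frame_coset (nrm (rep x)).

Let frame_coset_nrm x l l' : rel (x, l) -> rel (x, l') ->
  frame_coset (nrm l') = frame_coset (nrm l).
Proof.
move=> r r'; have [k Kk kE] := flow_nrm 0 r r'.
apply/esym/eq_coset; exists (k^t*); first exact: block_group_adj.
have h : lsubmx (val (flow (0, nrm l'))) = k *m lsubmx (val (flow (0, nrm l))).
  by have := congr1 lsubmx kE; rewrite -mulmx_lsub.
apply: etrans (val_unitary_part _) _; rewrite h adjmxM.
have h2 := esym (val_unitary_part (nrm l)).
exact: (congr1 (fun z : 'M[C]_n => z *m k^t*) h2).
Qed.

Let to_coset_continuous : continuous to_coset.
Proof.
apply: (@compact_relation_continuous _ _ _ (@unit_box R n (n + n)) rel
  (fun q => frame_coset (nrm q.2))).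
- exact: compact_unit_box.
- exact: rel_closed.
- by move=> x l r; exact: rel_bounded r.
- by move=> x; exact: rel_ex.
- by move=> x l r; exact: frame_coset_nrm (repP x) r.
- move=> x l r; set Fw := within _ _.
  have FF : Filter Fw by exact: within_filter.
  have c1 : (fun q => nrm q.2) @ Fw --> nrm l.
    apply: (@cvg_nrm _ Fw FF id x l r); first exact: withinT.
    by apply: cvg_within_filter; exact: (@cvg_snd _ _ (nbhs x) (nbhs l)).
  exact: (cvg_comp _ _ c1 (@frame_coset_continuous _)).
Qed.

Let of_unitary (u : unitary_group R n) : X := p (symp_of (row_mx ((val u)^t*) 0)).

Let of_unitary_continuous : continuous of_unitary.
Proof.
move=> u; have c1 : continuous (fun u : unitary_group R n => row_mx ((val u)^t*) 0 : 'M[C]_(n, n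
  + n)).
  move=> v; exact: (cvg_row_mx (cvg_adjmx (@continuous_val _ _ v)) (cvg_cst _)).
have sf (v : unitary_group R n) : symp_frame (row_mx ((val v)^t*) 0 : 'M[C]_(n, n + n)).
  by apply: symp_frame_unitary; rewrite trmxC_unitary; exact: unitary_groupP.
have ns : \forall v \near u, symp_frame (row_mx ((val v)^t*) 0 : 'M[C]_(n, n + n)).
  exact: (@filterE _ (nbhs u) (nbhs_filter u) _ sf).
have c2 : (fun v : unitary_group R n => symp_of (row_mx ((val v)^t*) 0)) @ u --> symp_of (row_mx
  ((val u)^t*) 0).
  exact: (@cvg_symp_of _ _ _ _ (nbhs_filter u) _ _ (sf u) ns (c1 u)).
exact: (cvg_comp _ _ c2 (@p_continuous _)).
Qed.

Let of_unitary_coset u v : coset u = coset v -> of_unitary u = of_unitary v.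
Proof.
move=> /coset_eqP[k Kk vE]; apply/esym.
have uu (w : unitary_group R n) : ((val w)^t* : 'M[C]_n) \is unitarymx.
  by rewrite trmxC_unitary; exact: unitary_groupP.
apply: (p_block (k := k^t*)); first exact: block_group_adj.
apply: etrans (val_symp_of (symp_frame_unitary (uu v))) _.
apply: etrans (congr1 (mulmx (k^t*)) (esym (val_symp_of (symp_frame_unitary (uu u))))).
by rewrite vE adjmxM mul_mx_row mulmx0.
Qed.

Let of_coset (z : cosets) : X := of_unitary (repr (z : {eq_quot (same_coset_equivRel R n0 np nm)})).

Let of_cosetE u : of_coset (coset u) = of_unitary u.
Proof. by apply: of_unitary_coset; rewrite /coset reprK. Qed.

Let of_coset_continuous : continuous of_coset.
Proof.
apply/quotient_continuous.
have -> : of_coset \o \pi_(quotient_topology {eq_quot (same_coset_equivRel R n0 np nm)}) =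
  of_unitary.
  by apply/funext => u; exact: of_cosetE.
exact: of_unitary_continuous.
Qed.

(** At time 0 the flowed frame is unitary and the homotopy is the composite through the coset space;
    at time 1 the frame is the canonical one and [rel_proj] returns x. *)
Lemma homotopy_equivalent_cosets : homotopy_equivalent R X cosets.
Proof.
exists to_coset, of_coset; split=> //.
- exists homotopy; split.
  + exact: continuous_subspaceT.
  + move=> x; apply: etrans (esym (of_cosetE _)).
    exact: (congr1 p (esym (symp_of_unitary_part (nrm (rep x))))).
  + move=> x; apply: etrans (congr1 p (flow1 _)) _; exact: rel_proj (repP x).
(* The other composite equals the identity: by [rel_unitary] the frame of a unitary matrix is
   canonical for its own point. Hence the constant homotopy. *)
- exists (fun q => q.1); split=> //.
  + by apply: continuous_subspaceT => q; exact: cvg_fst.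
  + move=> z; pose u : unitary_group R n := repr (z : {eq_quot (same_coset_equivRel R n0 np nm)}).
    have zE : z = coset u by rewrite /coset reprK.
    have uu : ((val u)^t* : 'M[C]_n) \is unitarymx.
      by rewrite trmxC_unitary; exact: unitary_groupP.
    have [l r nl] := rel_unitary uu.
    have h1 := frame_coset_nrm r (repP (of_unitary u)).
    have h2 : frame_coset (nrm l) = coset u.
      have h3 : nrm l = symp_of (row_mx ((val u)^t*) 0) by rewrite /nrm nl.
      exact: etrans (congr1 frame_coset h3) (congr1 coset (unitary_part_symp_of u)).
    exact: etrans zE (esym (etrans h1 h2)).
Qed.

End RetractionToCosets.
(** * Adapted frames *)

Section AdaptedFrames.
Variables (C : numClosedFieldType) (n n0 np nm : nat).
Local Notation G := (std_form C n).
Local Notation cj := (cj (swap_mx C n)).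

(** A row fixed by [cj] has the form (a, conj a). Its half (a, 0) recovers it as the sum of the half
    and its conjugate, and is the row that enters a symplectic frame. *)
Definition holo_part m (f : 'M[C]_(m, n + n)) := row_mx (lsubmx f) (0 : 'M[C]_(m, n)).

(* The base points of the three spaces are spanned by the rows (e, e), (e, 0)
   and (0, e); the symplectic map encoded by l sends them to frame0 l, framep l
   and framem l. Conversely of_frames recovers l from these three blocks. *)
Definition of_frames (f0 : 'M[C]_(n0, n + n)) (fp : 'M[C]_(np, n + n)) (fm : 'M[C]_(nm, n + n)) :
  'M[C]_(n0 + np + nm, n + n) :=
  col_mx (col_mx (holo_part f0) fp) (cj fm).

Definition frame0 (l : 'M[C]_(n0 + np + nm, n + n)) := usubmx (usubmx l) + cj (usubmx (usubmx l)).
Definition framep (l : 'M[C]_(n0 + np + nm, n + n)) := dsubmx (usubmx l).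
Definition framem (l : 'M[C]_(n0 + np + nm, n + n)) := cj (dsubmx l).

(* The Euclidean conditions f f^* = 1 are not invariant under the symplectic
   group: they single out one frame up to O(n0) x U(np) x U(nm). *)
Definition adapted (f0 : 'M[C]_(n0, n + n)) (fp : 'M[C]_(np, n + n)) (fm : 'M[C]_(nm, n + n)) dp
  dm :=
  [/\ [/\ f0 *m f0^t* = 1%:M, fp *m fp^t* = 1%:M & fm *m fm^t* = 1%:M],
      [/\ cj f0 = f0, f0 *m fp^t* = 0 & f0 *m fm^t* = 0],
      [/\ f0 *m G *m f0^t* = 0, f0 *m G *m fp^t* = 0 & f0 *m G *m fm^t* = 0],
      [/\ fp *m G *m fp^t* = diag_mx dp, fm *m G *m fm^t* = diag_mx dm &
          fp *m G *m fm^t* = 0] &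
      [/\ fp *m G *m (cj fp)^t* = 0, fm *m G *m (cj fm)^t* = 0 &
          fp *m G *m (cj fm)^t* = 0]].

Local Notation cjK := (cjK (swap_mx_real C n) (swap_mx_invol C n)).

Lemma real_frameE m (f : 'M[C]_(m, n + n)) : cj f = f ->
  f = row_mx (lsubmx f) (mxbar (lsubmx f)).
Proof.
move=> cf; rewrite -[LHS]hsubmxK; congr row_mx; rewrite -[in LHS]cf.
by rewrite -[in LHS](hsubmxK f) cj_row_mx row_mxKr.
Qed.

Lemma frame_of_frames (f0 : 'M[C]_(n0, n + n)) (fp : 'M[C]_(np, n + n)) (fm : 'M[C]_(nm, n + n))
  : cj f0 = f0 ->
  [/\ frame0 (of_frames f0 fp fm) = f0, framep (of_frames f0 fp fm) = fp &
      framem (of_frames f0 fp fm) = fm].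
Proof.
move=> c0; rewrite /frame0 /framep /framem /of_frames !(col_mxKu, col_mxKd) cjK.
split=> //; rewrite /holo_part cj_row_mx map_mx0 add_row_mx addr0 add0r.
by rewrite -real_frameE.
Qed.

Lemma cj_std_form0 m p (x : 'M[C]_(m, n + n)) (y : 'M[C]_(p, n + n)) :
  x *m G *m y^t* = 0 -> cj x *m G *m (cj y)^t* = 0.
Proof. by rewrite cj_std_form => ->; rewrite map_mx0 oppr0. Qed.

Section Adapted.
Variables (f0 : 'M[C]_(n0, n + n)) (fp : 'M[C]_(np, n + n)) (fm : 'M[C]_(nm, n + n)).
Variables (dp : 'rV[C]_np) (dm : 'rV[C]_nm).
Hypothesis ad : adapted f0 fp fm dp dm.

Local Notation l0 := (holo_part f0).

(** Write f0 = (a, conj a). The two hypotheses are the vanishing of the sum and of the difference of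
    the same two terms, so each term vanishes: each half of [f0] is separately orthogonal to [x] for
    the form. *)
Lemma holo_part_form m (x : 'M[C]_(m, n + n)) : f0 *m x^t* = 0 -> f0 *m G *m x^t* = 0 ->
  l0 *m G *m x^t* = 0 /\ cj l0 *m G *m x^t* = 0.
Proof.
have [_ [c0 _ _] _ _ _] := ad.
rewrite (real_frameE c0) -[x]hsubmxK row_inner row_std_form /holo_part row_mxKl cj_row_mx.
rewrite !row_std_form map_mx0 !mul0mx subr0 sub0r; set u := _ *m _; set v := _ *m _.
move=> /eqP; rewrite addr_eq0 => /eqP -> /eqP; rewrite -opprD oppr_eq0 -mulr2n -scaler_nat.
by rewrite scaler_eq0 pnatr_eq0 /= => /eqP ->; rewrite oppr0.
Qed.

Lemma of_frames_gram :
  of_frames f0 fp fm *m G *m (of_frames f0 fp fm)^t* =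
  diag_mx (row_mx (row_mx (const_mx 2^-1) dp) (- dm)).
Proof.
have [[u0 up um] [c0 q0p q0m] [g0 g0p g0m] [gp gm gpm] [gcp gcm gcpm]] := ad.
have Gh := std_form_herm C n.
have [h1 h2] := holo_part_form q0p g0p.
have [h3 h4] := holo_part_form q0m g0m.
rewrite /of_frames !(col_mx_form G) diag_row_mx diag_row_mx.
(* Since [f0] is isotropic, its two halves contribute equally to the Euclidean Gram matrix 1; this
   is the origin of the factor 1/2. *)
have aa : l0 *m G *m l0^t* = diag_mx (const_mx 2^-1).
  rewrite diag_const_mx /holo_part row_std_form mul0mx subr0.
  move: u0 g0; rewrite (real_frameE c0) row_inner row_std_form row_mxKl.
  set a := lsubmx f0; move=> e1 /eqP; rewrite subr_eq0 => /eqP e2; move: e1.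
  by rewrite -e2 -mulr2n -scaler_nat => /(congr1 ( *:%R 2^-1));
    rewrite scalerA mulVf ?pnatr_eq0 // scale1r scalemx1.
have h5 : l0 *m G *m (cj fm)^t* = 0.
  by have := cj_std_form0 h4; rewrite cjK.
have h6 : col_mx l0 fp *m G *m (cj fm)^t* = 0.
  by rewrite mul_col_mx mul_col_mx h5 gcpm col_mx0.
rewrite aa gp h1 (form_adj0 Gh h1) h6 (form_adj0 Gh h6) cj_std_form gm.
congr block_mx; rewrite map_diag_mx linearN /=; congr (- diag_mx _).
have := form_adj Gh fm fm; rewrite gm tr_diag_mx map_diag_mx => /matrixP e.
by apply/rowP => i; have := e i i; rewrite !mxE eqxx !mulr1n.
Qed.

Lemma of_frames_isotropic : of_frames f0 fp fm *m G *m (cj (of_frames f0 fp fm))^t* = 0.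
Proof.
have [[u0 up um] [c0 q0p q0m] [g0 g0p g0m] [gp gm gpm] [gcp gcm gcpm]] := ad.
have Gh := std_form_herm C n.
have [h1 h2] := holo_part_form q0p g0p.
have [h3 h4] := holo_part_form q0m g0m.
have h0 : l0 *m G *m (cj l0)^t* = 0.
  by rewrite /holo_part cj_row_mx row_std_form map_mx0 adjmx0 mulmx0 mul0mx subr0.
have h5 : l0 *m G *m (cj fp)^t* = 0 by have := cj_std_form0 h2; rewrite cjK.
have h6 := form_adj0 Gh h2.
have h7 : cj fm *m G *m (cj l0)^t* = 0 by exact: cj_std_form0 (form_adj0 Gh h3).
have h8 : cj fm *m G *m (cj fp)^t* = 0 by exact: cj_std_form0 (form_adj0 Gh gpm).
rewrite /of_frames !cj_col_mx cjK !mul_col_mx !adj_col_mx !mul_mx_row.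
rewrite h0 h5 h3 h6 gcp gpm h7 h8 (form_adj0 Gh gcm).
by rewrite !row_mx0 !col_mx0.
Qed.

End Adapted.

End AdaptedFrames.

(** * Normalization of adapted frames and its dependence on the block group *)

Lemma gram_intertwine (C : numClosedFieldType) k N (G : 'M[C]_N) (l l' : 'M[C]_(k, N)) V d d' :
  V \is unitarymx -> l' = V *m l -> l *m G *m l^t* = diag_mx d ->
  l' *m G *m l'^t* = diag_mx d' -> V *m diag_mx d = diag_mx d' *m V.
Proof.
move=> uV -> <- <-.
by rewrite adjmxM !mulmxA -[RHS]mulmxA unitary_inv // mulmx1.
Qed.

Lemma diag_intertwine_mul (C : numClosedFieldType) k N (f : C -> C) (l l' : 'M[C]_(k, N)) V d d' :
  V *m diag_mx d = diag_mx d' *m V -> l' = V *m l ->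
  diag_mx (map_mx f d') *m l' = V *m (diag_mx (map_mx f d) *m l).
Proof. by move=> VD ->; rewrite !mulmxA (diag_intertwine_map f VD). Qed.

Section AdaptedNormalization.
Variables (R : realType) (n0 np nm : nat).
Local Notation n := (n0 + np + nm)%N.
Local Notation C := R[i].
Local Notation G := (std_form C n).
Local Notation K := (@block_group R n0 np nm).

Definition strictly_adapted (f0 : 'M[C]_(n0, n + n)) (fp : 'M[C]_(np, n + n)) (fm : 'M[C]_(nm, n
  + n)) :=
  exists dp dm, [/\ adapted f0 fp fm dp dm, forall i, 0 < dp 0 i & forall i, dm 0 i < 0].

Lemma diag_row_diag_mx m (d : 'rV[C]_m) : diag_row (diag_mx d) = d.
Proof. by apply/rowP => i; rewrite mxE mxE eqxx. Qed.

Lemma conjC_fixed (z : C) : z^* = z -> z = (complex.Re z)%:C%C.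
Proof.
case: z => a b; move=> /eqP; rewrite eq_complex /= => /andP[_ /eqP h].
have b0 : b = 0 by lra.
by rewrite b0.
Qed.

Lemma adapted_prenormal (f0 : 'M[C]_(n0, n + n)) (fp : 'M[C]_(np, n + n)) (fm : 'M[C]_(nm, n +
  n)) : strictly_adapted f0 fp fm -> prenormal (of_frames f0 fp fm).
Proof.
move=> [dp [dm [ad rp rm]]]; have g := of_frames_gram ad.
have e : gram_row (of_frames f0 fp fm) = row_mx (row_mx (const_mx 2^-1) dp) (- dm).
  by rewrite /gram_row g diag_row_diag_mx.
split; [by rewrite e | | exact: of_frames_isotropic ad].
move=> i; rewrite e; case: (split_ordP i) => [j ->|j ->]; rewrite ?row_mxEl ?row_mxEr.
  case: (split_ordP j) => [k ->|k ->]; rewrite ?row_mxEl ?row_mxEr //.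
  by rewrite mxE invr_gt0 ltr0n.
by rewrite mxE oppr_gt0.
Qed.

Lemma adapted_gram (f0 : 'M[C]_(n0, n + n)) (fp : 'M[C]_(np, n + n)) (fm : 'M[C]_(nm, n + n)) :
  strictly_adapted f0 fp fm ->
  of_frames f0 fp fm *m G *m (of_frames f0 fp fm)^t* = diag_mx (gram_row (of_frames f0 fp fm)).
Proof. by move=> /adapted_prenormal[]. Qed.

Lemma of_frames_mul (f0 : 'M[C]_(n0, n + n)) (fp : 'M[C]_(np, n + n)) (fm : 'M[C]_(nm, n + n))
    (v0 : 'M[C]_n0) (vp : 'M[C]_np) (vm : 'M[C]_nm) : mxbar v0 = v0 ->
  of_frames (v0 *m f0) (vp *m fp) (vm *m fm) =
  block_mx (block_mx v0 0 0 vp) 0 0 (mxbar vm) *m of_frames f0 fp fm.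
Proof.
move=> v0r; rewrite /of_frames !mul_block_col !mul0mx !addr0 !add0r cjM.
by rewrite /holo_part mul_mx_row mulmx0 mulmx_lsub.
Qed.

(** Euclidean orthonormality makes the three transition matrices unitary. The first is also real,
    because both [f0] and [f0'] are fixed by [cj], hence it is orthogonal. The last block is
    conjugated because [of_frames] stores [cj fm]. Normalization commutes with the resulting block
    matrix, which intertwines the two diagonal Gram matrices. *)
Lemma of_frames_unique (f0 f0' : 'M[C]_(n0, n + n)) (fp fp' : 'M[C]_(np, n + n)) (fm fm' :
  'M[C]_(nm, n + n)) :
  strictly_adapted f0 fp fm -> strictly_adapted f0' fp' fm' ->
  (exists v, f0' = v *m f0) -> (exists v, fp' = v *m fp) -> (exists v, fm' = v *m fm) ->
  exists2 k, K k & normalize (of_frames f0' fp' fm') = k *m normalize (of_frames f0 fp fm).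
Proof.
move=> sf sf' [v0 e0] [vp ep] [vm em].
have [dp [dm [[[u0 up um] [c0 _ _] _ _ _] _ _]]] := sf.
have [dp' [dm' [[[u0' up' um'] [c0' _ _] _ _ _] _ _]]] := sf'.
have v_unitary m (v : 'M[C]_m) (f f' : 'M[C]_(m, n + n)) :
    f *m f^t* = 1%:M -> f' *m f'^t* = 1%:M -> f' = v *m f -> v *m v^t* = 1%:M.
  by move=> uf uf' e; rewrite -uf' e adjmxM mulmxA -(mulmxA v) uf mulmx1.
have uv0 := v_unitary _ _ _ _ u0 u0' e0.
have uvp := v_unitary _ _ _ _ up up' ep.
have uvm := v_unitary _ _ _ _ um um' em.
have v0r : mxbar v0 = v0.
  have : mxbar v0 *m f0 = v0 *m f0 by rewrite -{1}c0 -cjM -e0.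
  by move=> /(congr1 (fun z => z *m f0^t*)); rewrite -!mulmxA u0 !mulmx1.
set V := block_mx (block_mx v0 0 0 vp) 0 0 (mxbar vm).
have KV : K V.
  exists (map_mx (@complex.Re R) v0), vp, (mxbar vm).
  have v0E : map_mx (real_complex R) (map_mx (@complex.Re R) v0) = v0.
    apply/matrixP => i j; rewrite !mxE -conjC_fixed //.
    by have /matrixP/(_ i j) := v0r; rewrite mxE.
  split=> //.
  - have vT : v0^T = v0^t* by rewrite -[in LHS]v0r; apply/matrixP => i j; rewrite !mxE.
    apply: (@map_mx_inj _ _ (real_complex R)); rewrite map_mxM map_mx1 -map_trmx v0E vT.
    exact: uv0.
  - exact/unitarymxP.
  - by rewrite conjC_unitary; apply/unitarymxP.
  - by rewrite v0E.
have pl := adapted_prenormal sf; have pl' := adapted_prenormal sf'.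
have e : of_frames f0' fp' fm' = V *m of_frames f0 fp fm.
  by rewrite e0 ep em of_frames_mul.
have g := adapted_gram sf; have g' := adapted_gram sf'.
set l := of_frames f0 fp fm in pl e g *; set l' := of_frames f0' fp' fm' in pl' e g' *.
have uV := block_group_unitary KV.
have VD := gram_intertwine uV e g g'.
exists V; first exact: KV.
have h := diag_intertwine_mul (@inv_sqrt C) VD e.
exact: etrans (normalizeE pl') (etrans h (congr1 (mulmx V) (esym (normalizeE pl)))).
Qed.

End AdaptedNormalization.

(** * Row spaces of frames, bounds, and the frames of unitary matrices *)

Section FramesOfRows.
Variables (R : realType) (n0 np nm : nat).
Local Notation n := (n0 + np + nm)%N.
Local Notation C := R[i].
Local Notation G := (std_form C n).
Local Notation cj := (cj (swap_mx C n)).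
Local Notation K := (@block_group R n0 np nm).
Implicit Types (l : 'M[C]_(n, n + n)).
Implicit Types (fp : 'M[C]_(np, n + n)) (fm : 'M[C]_(nm, n + n)).

Definition spans l (f0 : 'M[C]_(n0, n + n)) fp fm :=
  [/\ (frame0 l :=: f0)%MS, (framep l :=: fp)%MS & (framem l :=: fm)%MS].

Lemma frames_block_mul (a : 'M[C]_n0) (b : 'M[C]_np) (c : 'M[C]_nm) l : mxbar a = a ->
  let l' := block_mx (block_mx a 0 0 b) 0 0 c *m l in
  [/\ frame0 l' = a *m frame0 l, framep l' = b *m framep l & framem l' = mxbar c *m framem l].
Proof.
move=> ar; rewrite /frame0 /framep /framem /=.
have -> : block_mx (block_mx a 0 0 b) 0 0 c *m l =
    col_mx (col_mx (a *m usubmx (usubmx l)) (b *m dsubmx (usubmx l))) (c *m dsubmx l).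
  rewrite -[in LHS](vsubmxK l) -[in LHS](vsubmxK (usubmx l)).
  by rewrite !mul_block_col !mul0mx !addr0 !add0r.
by rewrite !(col_mxKu, col_mxKd) !cjM ar mulmxDr.
Qed.

Lemma spans_block_mul (a : 'M[C]_n0) (b : 'M[C]_np) (c : 'M[C]_nm) l : mxbar a = a ->
  a \in unitmx -> b \in unitmx -> c \in unitmx ->
  spans (block_mx (block_mx a 0 0 b) 0 0 c *m l) (frame0 l) (framep l) (framem l).
Proof.
move=> ar ua ub uc; rewrite /spans; have [-> -> ->] := frames_block_mul b c l ar.
by split; apply: eqmxMfull; rewrite row_full_unit // map_unitmx.
Qed.

Lemma unitmx_mulmx1 m (a b : 'M[C]_m) : a *m b = 1%:M -> a \in unitmx.
Proof. by move=> /mulmx1_unit[]. Qed.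

Lemma spans_block_group k l : K k -> spans (k *m l) (frame0 l) (framep l) (framem l).
Proof.
move=> [a [b [c [oa /unitarymxP ub /unitarymxP uc ->]]]]; apply: spans_block_mul.
- by apply/matrixP => i j; rewrite !mxE; apply/eqP; rewrite eq_complex /= oppr0 !eqxx.
- have : map_mx (real_complex R) a *m map_mx (real_complex R) a^T = 1%:M.
    by rewrite -map_mxM oa map_mx1.
  exact: unitmx_mulmx1.
- exact: unitmx_mulmx1 ub.
- exact: unitmx_mulmx1 uc.
Qed.

Lemma diag_mx_unit m (d : 'rV[C]_m) : (forall i, d 0 i != 0) -> diag_mx d \in unitmx.
Proof. by move=> h; rewrite unitmxE det_diag unitfE; apply/prodf_neq0 => i _. Qed.

Lemma spans_normalize (f0 : 'M[C]_(n0, n + n)) fp fm : strictly_adapted f0 fp fm ->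
  spans (normalize (of_frames f0 fp fm)) f0 fp fm.
Proof.
move=> sf; have pl := adapted_prenormal sf.
have [dp [dm [[_ [c0 _ _] _ _ _] _ _]]] := sf.
have [_ gp _] := pl; set l := of_frames f0 fp fm in pl gp *.
pose d := map_mx (@inv_sqrt C) (gram_row l).
have d0 i : 0 < d 0 i by rewrite mxE; apply: inv_sqrt_real; exact: gp.
pose d1 := lsubmx (lsubmx d); pose d2 := rsubmx (lsubmx d); pose d3 := rsubmx d.
have dE : diag_mx d = block_mx (block_mx (diag_mx d1) 0 0 (diag_mx d2)) 0 0 (diag_mx d3).
  by rewrite -!diag_row_mx !hsubmxK.
have dr : mxbar (diag_mx d1) = diag_mx d1.
  rewrite map_diag_mx; congr diag_mx; apply/rowP => i; rewrite mxE.
  by apply/CrealP/gtr0_real; rewrite mxE mxE; exact: d0.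
have u m (e : 'rV[C]_m) : (forall i, 0 < e 0 i) -> diag_mx e \in unitmx.
  by move=> e0; apply: diag_mx_unit => i; rewrite gt_eqF.
have u1 : diag_mx d1 \in unitmx by apply: u => i; rewrite mxE mxE; exact: d0.
have u2 : diag_mx d2 \in unitmx by apply: u => i; rewrite mxE mxE; exact: d0.
have u3 : diag_mx d3 \in unitmx by apply: u => i; rewrite mxE; exact: d0.
have := spans_block_mul l dr u1 u2 u3; rewrite -dE -(normalizeE pl).
by have [-> -> ->] := frame_of_frames fp fm c0.
Qed.

(** The closed counterpart of [strictly_adapted], used in the relation to which compactness is
    applied. *)
Definition weakly_adapted (f0 : 'M[C]_(n0, n + n)) fp fm :=
  exists dp dm, [/\ adapted f0 fp fm dp dm, forall i, 0 <= dp 0 i & forall i, dm 0 i <= 0].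

Lemma unit_box_col_mx m p q (A : 'M[C]_(m, q)) (B : 'M[C]_(p, q)) :
  unit_box A -> unit_box B -> unit_box (col_mx A B).
Proof. by move=> hA hB i j; rewrite mxE; case: split_ordP. Qed.

Lemma unit_box_holo_part m (f : 'M[C]_(m, n + n)) : unit_box f -> unit_box (holo_part f).
Proof.
move=> hf i j; rewrite mxE; case: split_ordP => k _; rewrite mxE; first exact: hf.
by rewrite /complex_square /=; lra.
Qed.

Lemma unit_box_unitary m p (A : 'M[C]_(m, p)) : A *m A^t* = 1%:M -> unit_box A.
Proof. by move=> uA; apply: unit_box_rows => i; rewrite uA mxE eqxx. Qed.

Lemma unit_box_of_frames (f0 : 'M[C]_(n0, n + n)) fp fm : weakly_adapted f0 fp fm ->
  unit_box (of_frames f0 fp fm).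
Proof.
move=> [dp [dm [[[u0 up um] _ _ _ _] _ _]]]; apply: unit_box_col_mx.
  apply: unit_box_col_mx; first by apply: unit_box_holo_part; exact: unit_box_unitary.
  exact: unit_box_unitary.
apply: unit_box_unitary; apply/unitarymxP/cj_unitary; [exact: swap_mx_real | exact: swap_mx_sym |
  exact: swap_mx_invol | exact/unitarymxP].
Qed.

Section UnitaryFrames.
Variable u : 'M[C]_n.
Hypothesis uu : u \is unitarymx.

(** The rows of (u0, conj u0) have squared Euclidean norm 2, hence the factor 1 / sqrt 2. *)
Let a : C := sqrtC 2^-1.
Let u0 : 'M[C]_(n0, n) := usubmx (usubmx u).
Let up : 'M[C]_(np, n) := dsubmx (usubmx u).
Let um : 'M[C]_(nm, n) := dsubmx u.

Definition unitary_frame0 : 'M[C]_(n0, n + n) := a *: row_mx u0 (mxbar u0).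
Definition unitary_framep : 'M[C]_(np, n + n) := row_mx up 0.
Definition unitary_framem : 'M[C]_(nm, n + n) := row_mx 0 (mxbar um).

Let a2 : a * a = 2^-1. Proof. by rewrite -expr2 sqrtCK. Qed.
Let ar : a^* = a.
Proof. by apply/CrealP/ger0_real; rewrite sqrtC_ge0 invr_ge0 ler0n. Qed.

Lemma unitary_rows :
  [/\ u0 *m u0^t* = 1%:M, up *m up^t* = 1%:M & um *m um^t* = 1%:M] /\
  [/\ u0 *m up^t* = 0, u0 *m um^t* = 0 & up *m um^t* = 0].
Proof.
have : col_mx (col_mx u0 up) um \is unitarymx by rewrite !vsubmxK.
move=> /col_mx_unitaryP[/col_mx_unitaryP[/unitarymxP h0 /unitarymxP hp h0p] /unitarymxP hm].
rewrite mul_col_mx => /(congr1 (fun z => (usubmx z, dsubmx z))).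
by rewrite col_mxKu col_mxKd linear0 linear0 => -[h1 h2].
Qed.

(** The images of the base points under a unitary matrix carry orthonormal frames with eigenvalues 1
    and -1. The three extra orthogonality relations are the ones that the incidence relations of the
    individual spaces may ask for. *)
Lemma unitary_frames_adapted :
  [/\ adapted unitary_frame0 unitary_framep unitary_framem (const_mx 1) (- const_mx 1),
      unitary_framep *m unitary_framem^t* = 0,
      unitary_framep *m (cj unitary_framep)^t* = 0 &
      unitary_framem *m (cj unitary_framem)^t* = 0].
Proof.
have [[h0 hp hm] [h0p h0m hpm]] := unitary_rows.
have bb m p (x : 'M[C]_(m, n)) (y : 'M[C]_(p, n)) : mxbar x *m (mxbar y)^t* = mxbar (x *m y^t*).
  by rewrite map_mxM map_trmx.
have one m : mxbar (1%:M : 'M[C]_m) = 1%:M by rewrite map_mx1.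
rewrite /unitary_frame0 /unitary_framep /unitary_framem.
have sc m p q r (x : 'M[C]_(m, q)) (y : 'M[C]_(p, q)) (z : 'M[C]_(r, q)) :
    [/\ (a *: x) *m (a *: y)^t* = 2^-1 *: (x *m y^t*), (a *: x) *m z^t* = a *: (x *m z^t*) &
        z *m (a *: y)^t* = a *: (z *m y^t*)].
  by rewrite !adjmxZ ar -!scalemxAl -!scalemxAr scalerA a2.
have scG m p (x : 'M[C]_(m, n + n)) (y : 'M[C]_(p, n + n)) :
    (a *: x) *m G *m y^t* = a *: (x *m G *m y^t*) by rewrite -!scalemxAl.
have scG' m p (x : 'M[C]_(m, n + n)) (y : 'M[C]_(p, n + n)) :
    x *m G *m (a *: y)^t* = a *: (x *m G *m y^t*) by rewrite adjmxZ ar -!scalemxAr.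
split; last 3 first.
- by rewrite row_inner adjmx0 mulmx0 mul0mx addr0.
- by rewrite cj_row_mx row_inner map_mx0 adjmx0 mulmx0 mul0mx addr0.
- by rewrite cj_row_mx row_inner map_mx0 adjmx0 mulmx0 mul0mx addr0.
split; split.
- have [-> _ _] := sc _ _ _ n0 (row_mx u0 (mxbar u0)) (row_mx u0 (mxbar u0)) 0.
  by rewrite row_inner bb h0 one scalerDr -scalerDl -[2^-1]mul1r -splitr scale1r.
- by rewrite row_inner hp mul0mx addr0.
- by rewrite row_inner bb hm mul0mx add0r one.
- by rewrite cjZ ar cj_row_mx mxbarK.
- have [_ -> _] := sc _ n0 _ _ (row_mx u0 (mxbar u0)) 0 (row_mx up 0).
  by rewrite row_inner h0p adjmx0 mulmx0 addr0 scaler0.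
- have [_ -> _] := sc _ n0 _ _ (row_mx u0 (mxbar u0)) 0 (row_mx 0 (mxbar um)).
  by rewrite row_inner bb h0m map_mx0 adjmx0 mulmx0 addr0 scaler0.
- by rewrite scG scG' row_std_form bb h0 one subrr !scaler0.
- by rewrite scG row_std_form h0p adjmx0 mulmx0 subr0 scaler0.
- by rewrite scG row_std_form bb h0m adjmx0 mulmx0 map_mx0 subr0 scaler0.
- by rewrite row_std_form hp mul0mx subr0 diag_const_mx.
- by rewrite row_std_form bb hm mul0mx sub0r one linearN /= diag_const_mx.
- by rewrite row_std_form adjmx0 mulmx0 mul0mx subr0.
- by rewrite cj_row_mx row_std_form map_mx0 adjmx0 mulmx0 mul0mx subr0.
- by rewrite cj_row_mx row_std_form map_mx0 adjmx0 mulmx0 mul0mx subr0.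
- by rewrite cj_row_mx mxbarK map_mx0 row_std_form hpm mul0mx subr0.
Qed.

Lemma unitary_frames_strict :
  strictly_adapted unitary_frame0 unitary_framep unitary_framem.
Proof.
have [h _ _ _] := unitary_frames_adapted; exists (const_mx 1), (- const_mx 1).
by split=> // i; rewrite !mxE ?ltr01 // oppr_lt0 ltr01.
Qed.

(** [of_frames] multiplies the first n0 rows of (u, 0) by 1 / sqrt 2, and the Gram diagonal 1/2
    found there makes [normalize] undo exactly this factor. *)
Lemma normalize_unitary_frames :
  normalize (of_frames unitary_frame0 unitary_framep unitary_framem) = row_mx u 0.
Proof.
have [h _ _ _] := unitary_frames_adapted.
have pl := adapted_prenormal unitary_frames_strict.
have gE := of_frames_gram h.
have lE : of_frames unitary_frame0 unitary_framep unitary_framem =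
    diag_mx (row_mx (row_mx (const_mx a) (const_mx 1)) (const_mx 1)) *m row_mx u 0.
  rewrite -[in RHS](vsubmxK u) -[in RHS](vsubmxK (usubmx u)) !diag_row_mx !diag_const_mx.
  rewrite mul_mx_row mulmx0 !mul_block_col !mul0mx !addr0 !add0r !mul1mx mul_scalar_mx.
  rewrite /of_frames /holo_part cj_row_mx map_mx0 mxbarK /unitary_frame0 scale_row_mx row_mxKl.
  have rc m p (A : 'M[C]_(m, n)) (B : 'M[C]_(p, n)) :
      row_mx (col_mx A B) (0 : 'M[C]_(m + p, n)) = col_mx (row_mx A 0) (row_mx B 0).
    have -> : (0 : 'M[C]_(m + p, n)) = col_mx 0 0 by rewrite col_mx0.
    by rewrite -block_mxEh block_mxEv.
  by rewrite !rc.
have e : gram_row (of_frames unitary_frame0 unitary_framep unitary_framem) =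
    row_mx (row_mx (const_mx 2^-1) (const_mx 1)) (const_mx 1).
  by rewrite /gram_row gE diag_row_diag_mx opprK.
rewrite (normalizeE pl) e lE mulmxA mulmx_diag.
rewrite -[RHS]mul1mx -diag_const_mx; congr (diag_mx _ *m _).
apply/rowP => i; rewrite !mxE.
case: split_ordP => j _; rewrite !mxE; last by rewrite /inv_sqrt sqrtC1 invr1 mulr1.
case: split_ordP => k _; rewrite !mxE; last by rewrite /inv_sqrt sqrtC1 invr1 mulr1.
by rewrite /inv_sqrt mulVf // sqrtC_eq0 invr_eq0 pnatr_eq0.
Qed.

End UnitaryFrames.

End FramesOfRows.

(** * The homotopy equivalence for an abstract incidence relation *)

Section FrameRelation.
Variables (R : realType) (n0 np nm : nat).
Local Notation n := (n0 + np + nm)%N.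
Local Notation C := R[i].
Local Notation G := (std_form C n).
Local Notation cj := (cj (swap_mx C n)).
Local Notation symp := (symp_space R n).

Section Continuity.
Variables (S : Type) (F : set_system S) (FF : Filter F).
Variables (f : S -> 'M[C]_(n, n + n)) (l : 'M[C]_(n, n + n)).
Hypothesis fl : f @ F --> l.

Lemma cvg_cj m (g : S -> 'M[C]_(m, n + n)) (a : 'M[C]_(m, n + n)) :
  g @ F --> a -> (fun x => cj (g x)) @ F --> cj a.
Proof. by move=> ga; apply: (cvg_mulmx (cvg_mxbar ga)); exact: cvg_cst. Qed.

Lemma cvg_usubmx m p q (g : S -> 'M[C]_(m + p, q)) (a : 'M[C]_(m + p, q)) :
  g @ F --> a -> (fun x => usubmx (g x)) @ F --> usubmx a.
Proof.
move=> ga; apply: cvg_mx => i j; rewrite mxE; under eq_fun do rewrite mxE.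
exact: (cvg_mx_coord ga).
Qed.

Lemma cvg_dsubmx m p q (g : S -> 'M[C]_(m + p, q)) (a : 'M[C]_(m + p, q)) :
  g @ F --> a -> (fun x => dsubmx (g x)) @ F --> dsubmx a.
Proof.
move=> ga; apply: cvg_mx => i j; rewrite mxE; under eq_fun do rewrite mxE.
exact: (cvg_mx_coord ga).
Qed.

Lemma cvg_frame0 : (fun x => frame0 (f x)) @ F --> frame0 l.
Proof. by have h := cvg_usubmx (cvg_usubmx fl); exact: (cvg_addmx h (cvg_cj h)). Qed.

Lemma cvg_framep : (fun x => framep (f x)) @ F --> framep l.
Proof. exact: (cvg_dsubmx (cvg_usubmx fl)). Qed.

Lemma cvg_framem : (fun x => framem (f x)) @ F --> framem l.
Proof. exact: (cvg_cj (cvg_dsubmx fl)). Qed.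

Lemma cvg_of_frames (a0 : S -> 'M[C]_(n0, n + n)) (ap : S -> 'M[C]_(np, n + n))
    (am : S -> 'M[C]_(nm, n + n)) (b0 : 'M[C]_(n0, n + n)) bp bm :
  a0 @ F --> b0 -> ap @ F --> bp -> am @ F --> bm ->
  (fun x => of_frames (a0 x) (ap x) (am x)) @ F --> of_frames b0 bp bm.
Proof.
move=> h0 hp hm; apply: (cvg_col_mx (cvg_col_mx _ hp) (cvg_cj hm)).
by apply: (cvg_row_mx (cvg_lsubmx h0)); exact: cvg_cst.
Qed.

End Continuity.

Lemma closed_and (Y : topologicalType) (P Q : Y -> Prop) :
  closed [set y | P y] -> closed [set y | Q y] -> closed [set y | P y /\ Q y].
Proof. exact: closedI. Qed.

Lemma closed_forall (Y : topologicalType) (I : Type) (P : I -> Y -> Prop) :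
  (forall i, closed [set y | P i y]) -> closed [set y | forall i, P i y].
Proof.
move=> h; rewrite (_ : [set y | _] = \bigcap_i [set y | P i y]).
  by apply: closed_bigI => i _; exact: h.
by apply/seteqP; split=> [y hy i _|y hy i]; exact: hy.
Qed.

(** The diagonals [dp] and [dm] are existentially quantified, and projections of closed sets need
    not be closed. They are therefore read off from the Gram matrices as continuous functions, which
    leaves only equations and weak inequalities. *)
Lemma closed_weakly_adapted (Y : topologicalType) (f0 : Y -> 'M[C]_(n0, n + n))
    (fp : Y -> 'M[C]_(np, n + n)) (fm : Y -> 'M[C]_(nm, n + n)) :
  continuous f0 -> continuous fp -> continuous fm ->
  closed [set y | weakly_adapted (f0 y) (fp y) (fm y)].
Proof.
move=> c0 cp cm.
pose dp y := diag_row (fp y *m G *m (fp y)^t*); pose dm y := diag_row (fm y *m G *m (fm y)^t*).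
rewrite (_ : [set y | _] = [set y | adapted (f0 y) (fp y) (fm y) (dp y) (dm y) /\
  (forall i, 0 <= dp y 0 i) /\ (forall i, 0 <= (-1) * dm y 0 i)]); last first.
  apply/seteqP; split=> y /=.
    move=> [ep [em [ad h1 h2]]]; have [_ _ _ [gp gm _] _] := ad.
    have -> : dp y = ep by rewrite /dp gp diag_row_diag_mx.
    have -> : dm y = em by rewrite /dm gm diag_row_diag_mx.
    by split=> //; split=> // i; rewrite mulN1r oppr_ge0.
  move=> [ad [h1 h2]]; exists (dp y), (dm y); split=> // i.
  by have := h2 i; rewrite mulN1r oppr_ge0.
have cM m p q (a : Y -> 'M[C]_(m, p)) (b : Y -> 'M[C]_(p, q)) :
  continuous a -> continuous b -> continuous (fun y => a y *m b y).
  by move=> ca cb y; exact: (cvg_mulmx (ca y) (cb y)).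
have cA m p (a : Y -> 'M[C]_(m, p)) : continuous a -> continuous (fun y => (a y)^t*).
  by move=> ca y; exact: (cvg_adjmx (ca y)).
have cC m (a : Y -> 'M[C]_(m, n + n)) : continuous a -> continuous (fun y => cj (a y)).
  by move=> ca y; exact: (cvg_cj (nbhs_filter y) (ca y)).
have cK m p (a : 'M[C]_(m, p)) : continuous (fun _ : Y => a) by move=> y; exact: cvg_cst.
have cI m p (a : Y -> 'M[C]_(m, n + n)) (b : Y -> 'M[C]_(p, n + n)) :
    continuous a -> continuous b -> continuous (fun y => a y *m (b y)^t*).
  by move=> ca cb; exact: cM _ _ _ _ _ ca (cA _ _ _ cb).
have cG m p (a : Y -> 'M[C]_(m, n + n)) (b : Y -> 'M[C]_(p, n + n)) :
    continuous a -> continuous b -> continuous (fun y => a y *m G *m (b y)^t*).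
  by move=> ca cb; exact: cI _ _ _ _ (cM _ _ _ _ _ ca (cK _ _ G)) cb.
have cD m (a : Y -> 'M[C]_m) : continuous a -> continuous (fun y => diag_row (a y)).
  by move=> ca y; exact: (cvg_diag_row (ca y)).
have cDm m (a : Y -> 'rV[C]_m) : continuous a -> continuous (fun y => diag_mx (a y)).
  by move=> ca y; exact: (cvg_diag_mx (ca y)).
have cdp : continuous dp := cD _ _ (cG _ _ _ _ cp cp).
have cdm : continuous dm := cD _ _ (cG _ _ _ _ cm cm).
have cl m p (a b : Y -> 'M[C]_(m, p)) : continuous a -> continuous b ->
  closed [set y | a y = b y] by exact: closed_eqmx.
apply: closed_and; last first.
  apply: closed_and; apply: closed_forall => i; apply: closed_geC0.
    exact: (continuous_coord cdp).
  by move=> y; apply: (cvgC_M (cvg_cst _) (continuous_coord cdm (x := y))).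
have e5 (P1 P2 P3 P4 P5 : Y -> Prop) : closed [set y | P1 y] -> closed [set y | P2 y] ->
    closed [set y | P3 y] -> closed [set y | P4 y] -> closed [set y | P5 y] ->
    closed [set y | [/\ P1 y, P2 y, P3 y, P4 y & P5 y]].
  move=> h1 h2 h3 h4 h5.
  rewrite (_ : [set y | _] = [set y | P1 y /\ P2 y /\ P3 y /\ P4 y /\ P5 y]).
    by do 4?apply: closed_and.
  by apply/seteqP; split=> y /=; [case | case=> ? [? [? []]]].
have e3 (P1 P2 P3 : Y -> Prop) : closed [set y | P1 y] -> closed [set y | P2 y] ->
    closed [set y | P3 y] -> closed [set y | [/\ P1 y, P2 y & P3 y]].
  move=> h1 h2 h3.
  rewrite (_ : [set y | _] = [set y | P1 y /\ P2 y /\ P3 y]).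
    by do 2?apply: closed_and.
  by apply/seteqP; split=> y /=; [case | case=> ? []].
apply: e5; apply: e3.
- exact: cl _ _ _ _ (cI _ _ _ _ c0 c0) (cK _ _ _).
- exact: cl _ _ _ _ (cI _ _ _ _ cp cp) (cK _ _ _).
- exact: cl _ _ _ _ (cI _ _ _ _ cm cm) (cK _ _ _).
- exact: cl _ _ _ _ (cC _ _ c0) c0.
- exact: cl _ _ _ _ (cI _ _ _ _ c0 cp) (cK _ _ _).
- exact: cl _ _ _ _ (cI _ _ _ _ c0 cm) (cK _ _ _).
- exact: cl _ _ _ _ (cG _ _ _ _ c0 c0) (cK _ _ _).
- exact: cl _ _ _ _ (cG _ _ _ _ c0 cp) (cK _ _ _).
- exact: cl _ _ _ _ (cG _ _ _ _ c0 cm) (cK _ _ _).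
- exact: cl _ _ _ _ (cG _ _ _ _ cp cp) (cDm _ _ cdp).
- exact: cl _ _ _ _ (cG _ _ _ _ cm cm) (cDm _ _ cdm).
- exact: cl _ _ _ _ (cG _ _ _ _ cp cm) (cK _ _ _).
- exact: cl _ _ _ _ (cG _ _ _ _ cp (cC _ _ cp)) (cK _ _ _).
- exact: cl _ _ _ _ (cG _ _ _ _ cm (cC _ _ cm)) (cK _ _ _).
- exact: cl _ _ _ _ (cG _ _ _ _ cp (cC _ _ cm)) (cK _ _ _).
Qed.

Variables (X : topologicalType) (p : symp -> X).
(** Incidence between a point and the three blocks of a frame. It isolates all that distinguishes
    the three spaces from one another. *)
Variable P : X -> 'M[C]_(n0, n + n) -> 'M[C]_(np, n + n) -> 'M[C]_(nm, n + n) -> Prop.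
Hypothesis p_continuous : continuous p.
Hypothesis p_eqmx : forall s s', spans (val s) (frame0 (val s')) (framep (val s')) (framem (val
  s')) ->
  p s = p s'.
Hypothesis P_closed : forall (Y : topologicalType) (x : Y -> X) f0 fp fm,
  continuous x -> continuous f0 -> continuous fp -> continuous fm ->
  closed [set y | P (x y) (f0 y) (fp y) (fm y)].
Hypothesis P_ex : forall x, exists f0 fp fm, strictly_adapted f0 fp fm /\ P x f0 fp fm.
(** Incidence with a point of the right type restores the strict signs that closedness had to give
    up. *)
Hypothesis P_strict : forall x (f0 : 'M[C]_(n0, n + n)) fp fm, weakly_adapted f0 fp fm ->
  P x f0 fp fm ->
  strictly_adapted f0 fp fm.
Hypothesis P_unique : forall x f0 fp fm f0' fp' fm',
  strictly_adapted f0 fp fm -> P x f0 fp fm ->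
  strictly_adapted f0' fp' fm' -> P x f0' fp' fm' ->
  [/\ exists v, f0' = v *m f0, exists v, fp' = v *m fp & exists v, fm' = v *m fm].
Hypothesis P_proj : forall x f0 fp fm s, strictly_adapted f0 fp fm -> P x f0 fp fm ->
  spans (val s) f0 fp fm -> p s = x.
(** Applied to the frames of a unitary matrix, which satisfy the three displayed orthogonality
    relations; each concrete incidence relation draws on those that it contains. *)
Hypothesis P_frames : forall f0 fp fm s, strictly_adapted f0 fp fm ->
  fp *m fm^t* = 0 -> fp *m (cj fp)^t* = 0 -> fm *m (cj fm)^t* = 0 ->
  spans (val s) f0 fp fm -> P (p s) f0 fp fm.

Lemma strictly_weakly_adapted (f0 : 'M[C]_(n0, n + n)) (fp : 'M[C]_(np, n + n))
    (fm : 'M[C]_(nm, n + n)) : strictly_adapted f0 fp fm -> weakly_adapted f0 fp fm.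
Proof. by move=> [dp [dm [ad h1 h2]]]; exists dp, dm; split=> // i; exact: ltW. Qed.

Lemma homotopy_equivalent_of_frames :
  homotopy_equivalent R X (unitary_coset_space R n0 np nm).
Proof.
(* The first equation says that the null block of the matrix has the form (a, 0), so that the matrix
   is determined by its three blocks. *)
pose rel := [set q : X * 'M[C]_(n, n + n) |
  [/\ q.2 = of_frames (frame0 q.2) (framep q.2) (framem q.2),
      weakly_adapted (frame0 q.2) (framep q.2) (framem q.2) &
      P q.1 (frame0 q.2) (framep q.2) (framem q.2)]].
have relI x f0 fp fm : strictly_adapted f0 fp fm -> P x f0 fp fm ->
    rel (x, of_frames f0 fp fm).
  move=> sf Px; have [dp [dm [[_ [c0 _ _] _ _ _] _ _]]] := sf.
  rewrite /rel /=; have [-> -> ->] := frame_of_frames fp fm c0.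
  by split=> //; exact: strictly_weakly_adapted.
have relS x l : rel (x, l) -> strictly_adapted (frame0 l) (framep l) (framem l).
  by move=> [_ wl Px]; exact: P_strict wl Px.
have val_nrm (f0 : 'M[C]_(n0, n + n)) (fp : 'M[C]_(np, n + n)) (fm : 'M[C]_(nm, n + n)) :
    strictly_adapted f0 fp fm ->
    spans (val (symp_of (normalize (of_frames f0 fp fm)))) f0 fp fm.
  move=> sf; have e := val_symp_of (normalize_symp (adapted_prenormal sf)).
  refine (eq_ind_r (fun z : 'M[C]_(n, n + n) => spans z f0 fp fm) (spans_normalize sf) e).
apply: (@homotopy_equivalent_cosets R n0 np nm X p rel).
- exact: p_continuous.
- move=> s s' k Kk e; apply: p_eqmx.
  refine (eq_ind_r (fun z : 'M[C]_(n, n + n) => spans z _ _ _) (spans_block_group (val s) Kk) e).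
- have c1 : continuous (fst : X * 'M[C]_(n, n + n) -> X) by move=> q; exact: cvg_fst.
  have c2 : continuous (snd : X * 'M[C]_(n, n + n) -> 'M[C]_(n, n + n)) by move=> q; exact: cvg_snd.
  have d0 : continuous (fun q : X * 'M[C]_(n, n + n) => frame0 q.2) by move=> q;
    exact: (cvg_frame0 (nbhs_filter q) (c2 q)).
  have dp : continuous (fun q : X * 'M[C]_(n, n + n) => framep q.2) by move=> q;
    exact: (cvg_framep (nbhs_filter q) (c2 q)).
  have dm : continuous (fun q : X * 'M[C]_(n, n + n) => framem q.2) by move=> q;
    exact: (cvg_framem (nbhs_filter q) (c2 q)).
  rewrite (_ : rel = [set q | q.2 = of_frames (frame0 q.2) (framep q.2) (framem q.2) /\
    (weakly_adapted (frame0 q.2) (framep q.2) (framem q.2) /\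
      P q.1 (frame0 q.2) (framep q.2) (framem q.2))]); last first.
    by apply/seteqP; split=> q /=; [case | case=> ? []].
  apply: closed_and; first apply: (closed_eqmx c2).
    by move=> q; exact: (cvg_of_frames (nbhs_filter q) (d0 q) (dp q) (dm q)).
  apply: closed_and; first exact: closed_weakly_adapted d0 dp dm.
  exact: P_closed c1 d0 dp dm.
- by move=> x l [e wl _]; rewrite [l]e; exact: unit_box_of_frames.
- by move=> x l r; have [e _ _] := r; rewrite [l]e; apply: adapted_prenormal; exact: relS r.
- by move=> x; have [f0 [fp [fm [sf Px]]]] := P_ex x; exists (of_frames f0 fp fm); exact: relI.
- move=> x l r; have [/= e _ Px] := r; have sf := relS _ _ r.
  apply: (P_proj sf Px); rewrite [in normalize _]e; exact: val_nrm.
- move=> x l l' r r'; have [/= e _ Px] := r; have [/= e' _ Px'] := r'.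
  have sf := relS _ _ r; have sf' := relS _ _ r'.
  have [h0 hp hm] := P_unique sf Px sf' Px'.
  by rewrite e e'; exact: of_frames_unique.
- move=> u uu; have sf := unitary_frames_strict uu.
  have [_ h1 h2 h3] := unitary_frames_adapted uu.
  exists (of_frames (unitary_frame0 u) (unitary_framep u) (unitary_framem u)).
    apply: relI => //; apply: P_frames => //.
    have := val_nrm _ _ _ sf; rewrite normalize_unitary_frames //; exact.
  exact: normalize_unitary_frames.
Qed.

End FrameRelation.
Lemma orthoproj_free (C : numClosedFieldType) m N (Y : 'M[C]_(m, N)) : row_free Y ->
  orthoproj Y = (orthonormalize Y)^t* *m orthonormalize Y.
Proof.
move=> Yf; have uY := orthonormalize_unitary Yf.
apply: orthoprojectorE => //; first exact: orthoprojP.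
- by apply/eqP; rewrite -sub_orthoproj orthonormalize_eqmx.
- by rewrite mxtrace_orthoproj; congr (_%:R); apply/eqP.
Qed.

Lemma continuous_orthoproj (R : realType) (X : topologicalType) m N (Y : X -> 'M[R[i]]_(m, N)) :
  continuous Y -> (forall x, row_free (Y x)) -> continuous (fun x => orthoproj (Y x)).
Proof.
move=> cY Yf.
have cO : continuous (fun x => orthonormalize (Y x)).
  have cq : continuous (fun x => Y x *m (Y x)^t*).
    by move=> x; exact: (cvg_mulmx (cY x) (cvg_adjmx (cY x))).
  have ci := inv_sqrt_mx_continuous cq (fun x => posdef_mul_adj (Yf x)).
  by move=> x; exact: (cvg_mulmx (ci x) (cY x)).
rewrite (_ : (fun x => _) = fun x => (orthonormalize (Y x))^t* *m orthonormalize (Y x)).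
  by move=> x; exact: (cvg_mulmx (cvg_adjmx (cO x)) (cO x)).
by apply/funext => x; exact: orthoproj_free.
Qed.

(** * Coordinates of subspaces *)

Section Coordinates.
Variables (R : realType) (K : numFieldType) (iota : {rmorphism K -> R[i]}).
Local Notation C := R[i].
Variables (U : vectType K) (N : nat) (Psi : 'M[C]_(\dim {:U}, N)).
Hypothesis Psi_free : row_free Psi.
Local Notation b := (vbasis {:U}).
Local Notation d := (\dim {:U}).

Let be : basis_of {:U} b := vbasisP _.

(** [iota] is either the inclusion of the reals or the identity of the complex numbers, so one set
    of lemmas serves subspaces of V and of its complexification. *)
Definition coords (W : {vspace U}) : 'M[C]_(d, N) := map_mx iota (msof b W) *m Psi.
Definition coord_row (u : U) : 'rV[C]_N := map_mx iota (rVof b u) *m Psi.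

Lemma mem_coords u (W : {vspace U}) : (u \in W) = (coord_row u <= coords W)%MS.
Proof. by rewrite -{1}(rVofK be u) mem_vecof // submxMfree // map_submx. Qed.

Lemma sub_coords W W' : (W <= W')%VS = (coords W <= coords W')%MS.
Proof. by rewrite -(sub_msof be) submxMfree // map_submx. Qed.

Lemma coords_inj W W' : (coords W :=: coords W')%MS -> W = W'.
Proof. by move=> e; apply/eqP; rewrite eqEsubv !sub_coords !e submx_refl. Qed.

Lemma coords_vsof A : (coords (vsof b A) :=: map_mx iota A *m Psi)%MS.
Proof. by apply/eqmxP; rewrite !submxMfree // !map_submx vsofK. Qed.

Lemma frame_coord_free k (e : k.-tuple U) : row_free (frame_coord e) = free e.
Proof.
have sumE (c : 'rV[K]_k) : c *m frame_coord e = rVof b (\sum_i c 0 i *: e`_i).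
  apply/rowP => j; rewrite !mxE raddf_sum /=; apply: eq_bigr => i _.
  by rewrite !mxE linearZ (tnth_nth 0).
apply/idP/idP => [ef|/freeP ef].
  apply/freeP => c c0 i; pose x : 'rV[K]_k := \row_i c i.
  have : x *m frame_coord e = 0.
    have x0 : \sum_j x 0 j *: e`_j = 0.
      by rewrite -[RHS]c0; apply: eq_bigr => j _; rewrite mxE.
    by rewrite sumE x0 linear0.
  move=> /(congr1 (mulmx^~ (pinvmx (frame_coord e)))); rewrite mulmxKp // mul0mx => x0.
  by have := congr1 (fun z : 'rV__ => z 0 i) x0; rewrite !mxE.
rewrite -kermx_eq0; apply/rowV0P => x /sub_kermxP; rewrite sumE => /eqP.
by rewrite rVof_eq0 // => /eqP /ef x0; apply/rowP => i; rewrite x0 mxE.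
Qed.

Lemma msof_span k (e : k.-tuple U) : (msof b <<e>>%VS :=: frame_coord e)%MS.
Proof.
apply/eqmxP/andP; split.
  apply/rV_subP => v; rewrite -mem_vecof // => /coord_span h.
  apply/submxP; exists (\row_i coord e i (vecof b v)); rewrite -[LHS](vecofK be) [in LHS]h.
  apply/rowP => j; rewrite !mxE raddf_sum /=; apply: eq_bigr => i _.
  by rewrite !mxE linearZ (tnth_nth 0).
apply/row_subP => i; have -> : row i (frame_coord e) = rVof b (tnth e i).
  by apply/rowP => j; rewrite !mxE.
by rewrite -mem_vecof // rVofK // memv_span ?mem_tnth.
Qed.

Lemma coords_span k (e : k.-tuple U) :
  (coords <<e>>%VS :=: map_mx iota (frame_coord e) *m Psi)%MS.
Proof.
have /eqmxP/andP[h1 h2] := msof_span e.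
by apply/eqmxP; rewrite !submxMfree // !map_submx h1 h2.
Qed.

Lemma rank_coords W : \rank (coords W) = \dim W.
Proof.
have e := span_basis (vbasisP W).
rewrite -[in LHS]e coords_span mxrankMfree // mxrank_map; apply/eqP.
by have := frame_coord_free (vbasis W); rewrite /row_free => ->; exact: basis_free (vbasisP W).
Qed.

Section Topology.
Variable k : nat.
Hypothesis iota_continuous : forall (S : Type) (F : set_system S) (FF : Filter F) (f : S ->
  K) (a : K),
  f @ F --> a -> (fun x => iota (f x) : C) @ F --> (iota a : C).

Lemma frame_span_continuous : continuous (@frame_span K U k).
Proof. by apply/continuousP. Qed.

(** The Grassmannian has the quotient topology from frames, so continuity is checked on frames,
    whose coordinates give a continuous free family. *)
Lemma coords_proj_continuous :
  continuous (fun W : grassmannian U k => orthoproj (coords (val W))).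
Proof.
pose Y (e : frame U k) : 'M[C]_(k, N) := map_mx iota (frame_coord (val e)) *m Psi.
have Yf e : row_free (Y e).
  rewrite /row_free /Y mxrankMfree // mxrank_map.
  by have := frame_coord_free (val e); rewrite /row_free => ->; have /set_mem := valP e.
have cY : continuous Y.
  have c1 : continuous (fun e : frame U k => frame_coord (val e)).
    have h1 : continuous (val : frame U k -> tuple_space U k) by exact: continuous_val.
    have h2 : continuous (@frame_coord K U k : tuple_space U k -> _) by exact: initial_continuous.
    by move=> e; have h3 := continuous_comp (h1 e) (h2 (val e)); exact: h3.
  have c2 : continuous (fun e : frame U k => map_mx iota (frame_coord (val e))).
    apply: continuous_mx => i j; under eq_fun do rewrite mxE.
    by move=> e; exact: (iota_continuous (nbhs_filter e) (continuous_coord c1 (x := e))).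
  have c3 : continuous (fun _ : frame U k => Psi) by exact: cst_continuous.
  by move=> e; exact: (cvg_mulmx (c2 e) (c3 e)).
have cO := continuous_orthoproj cY Yf.
have cP : continuous (fun e : frame U k => orthoproj (coords (val (frame_span e)))).
  rewrite (_ : (fun e => _) = fun e => orthoproj (Y e)) //.
  by apply/funext => e; apply: eqmx_orthoproj; exact: coords_span.
by apply/continuousP => A oA; have /continuousP/(_ A oA) := cP.
Qed.

Lemma continuous_to_grassmannian (X : topologicalType) (A : X -> 'M[K]_(k, d))
    (g : X -> grassmannian U k) : continuous A ->
  (forall x, (coords (val (g x)) :=: map_mx iota (A x) *m Psi)%MS) -> continuous g.
Proof.
move=> cA gA; pose e x : k.-tuple U := [tuple vecof b (row i (A x)) | i < k].
have eE x : frame_coord (e x) = A x.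
  by apply/matrixP => i j; rewrite mxE tnth_mktuple coord_vecof // mxE.
have ef x : free (e x).
  rewrite -frame_coord_free eE /row_free -(mxrank_map iota) -(mxrankMfree _ Psi_free) -gA.
  by rewrite rank_coords; have /set_mem/eqP := valP (g x).
pose fr x : frame U k := SigSub (mem_set (ef x) : e x \in [set e : tuple_space U k | free (e :
  k.-tuple U)]).
have -> : g = @frame_span K U k \o fr.
  apply/funext => x; apply: val_inj; apply: coords_inj.
  by apply: (eqmx_trans (gA x)); apply: eqmx_sym; rewrite -eE; exact: coords_span.
have cfr : continuous fr.
  move=> x; apply: cvg_set_type; apply: cvg_initial.
  have -> : (fun y => frame_coord (val (fr y))) = A by apply/funext => y; exact: eE.
  by rewrite [frame_coord _]eE; exact: cA.
by move=> x; apply: continuous_comp; [exact: cfr | exact: frame_span_continuous].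
Qed.

End Topology.

End Coordinates.

(** * Adapted frames as sign frames, and their uniqueness for each kind of point *)

Section AdaptedSignFrames.
Variables (R : realType) (n0 np nm : nat).
Local Notation n := (n0 + np + nm)%N.
Local Notation C := R[i].
Local Notation G := (std_form C n).
Local Notation cj := (cj (swap_mx C n)).
Variables (f0 : 'M[C]_(n0, n + n)) (fp : 'M[C]_(np, n + n)) (fm : 'M[C]_(nm, n + n)).

Let Gh := std_form_herm C n.

Lemma adapted_sign_frame (rel : C -> C -> bool) dp dm : adapted f0 fp fm dp dm ->
  fp *m fm^t* = 0 -> (forall i, rel 0 (dp 0 i)) -> (forall i, rel (dm 0 i) 0) ->
  sign_frame G rel f0 fp fm dp dm.
Proof.
move=> [[/unitarymxP u0 /unitarymxP up /unitarymxP um] [_ q0p q0m] h [e1 e2 e3] _] qpm rp rm.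
by apply/(sign_frameP Gh); split.
Qed.

(** The empty third block lets the three-block uniqueness statement handle F0 + F+ by itself. *)
Lemma adapted_sign_framep (rel : C -> C -> bool) dp dm : adapted f0 fp fm dp dm ->
  (forall i, rel 0 (dp 0 i)) ->
  sign_frame G rel f0 fp (0 : 'M[C]_(0, n + n)) dp 0.
Proof.
move=> [[/unitarymxP u0 /unitarymxP up _] [_ q0p _] [h0 h0p _] [e1 _ _] _] rp.
apply/(sign_frameP Gh); split; split=> //; rewrite ?adjmx0 ?mulmx0 //.
- by apply/unitarymxP; rewrite [LHS]flatmx0 [RHS]flatmx0.
- by rewrite [RHS]flatmx0.
- by case.
Qed.

Lemma adapted_sign_framem (rel : C -> C -> bool) dp dm : adapted f0 fp fm dp dm ->
  (forall i, rel (dm 0 i) 0) ->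
  sign_frame G rel f0 (0 : 'M[C]_(0, n + n)) fm 0 dm.
Proof.
move=> [[/unitarymxP u0 _ /unitarymxP um] [_ _ q0m] [h0 _ h0m] [_ e2 _] _] rm.
apply/(sign_frameP Gh); split; split=> //; rewrite ?adjmx0 ?mulmx0 ?mul0mx //.
- by apply/unitarymxP; rewrite [LHS]flatmx0 [RHS]flatmx0.
- by rewrite [RHS]flatmx0.
- by case.
Qed.

(** The frame of a complexified real subspace: the conjugates of the positive rows form the negative
    block. *)
Lemma adapted_real_sign_framep (rel : C -> C -> bool) dp dm : adapted f0 fp fm dp dm ->
  fp *m (cj fp)^t* = 0 -> (forall i, rel 0 (dp 0 i)) -> (forall i, rel (- dp 0 i) 0) ->
  mxbar dp = dp -> sign_frame G rel f0 fp (cj fp) dp (- dp).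
Proof.
move=> [[u0 up _] [c0 q0p _] [h0 h0p _] [e1 _ _] [k1 _ _]] qc rp rp' dr.
apply/(sign_frameP Gh); split.
- split; [exact/unitarymxP | exact/unitarymxP |].
  by apply: cj_unitary; [exact: swap_mx_real | exact: swap_mx_sym | exact: swap_mx_invol |
    exact/unitarymxP].
- split; [exact: q0p | | exact: qc].
  by rewrite -{1}c0 cj_inner ?q0p ?map_mx0 //; [exact: swap_mx_real | exact: swap_mx_sym | exact:
    swap_mx_invol].
- by split; [exact: h0 | exact: h0p | rewrite -c0 cj_std_form0].
- by split; [exact: e1 | exact: k1 | rewrite cj_std_form e1 map_diag_mx dr linearN].
- by split=> i; [exact: rp | rewrite mxE; exact: rp'].
Qed.

Lemma adapted_real_sign_framem (rel : C -> C -> bool) dp dm : adapted f0 fp fm dp dm ->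
  fm *m (cj fm)^t* = 0 -> (forall i, rel 0 (- dm 0 i)) -> (forall i, rel (dm 0 i) 0) ->
  mxbar dm = dm -> sign_frame G rel f0 (cj fm) fm (- dm) dm.
Proof.
move=> [[u0 _ um] [c0 _ q0m] [h0 _ h0m] [_ e1 _] [_ k1 _]] qc rp rp' dr.
apply/(sign_frameP Gh); split.
- split; [exact/unitarymxP | | exact/unitarymxP].
  by apply: cj_unitary; [exact: swap_mx_real | exact: swap_mx_sym | exact: swap_mx_invol |
    exact/unitarymxP].
- split; [| exact: q0m | exact: inner_adj0].
  by rewrite -{1}c0 cj_inner ?q0m ?map_mx0 //; [exact: swap_mx_real | exact: swap_mx_sym | exact:
    swap_mx_invol].
- by split; [exact: h0 | rewrite -c0 cj_std_form0 | exact: h0m].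
- by split; [rewrite cj_std_form e1 map_diag_mx dr linearN | exact: (form_adj0 Gh) | exact: e1].
- by split=> i; [rewrite mxE; exact: rp | exact: rp'].
Qed.

End AdaptedSignFrames.

Section SubspaceFrameUniqueness.
Variables (R : realType) (n0 np nm : nat).
Local Notation n := (n0 + np + nm)%N.
Local Notation C := R[i].
Local Notation G := (std_form C n).
Local Notation cj := (cj (swap_mx C n)).
Variables (f0 g0 : 'M[C]_(n0, n + n)) (fp gp : 'M[C]_(np, n + n)) (fm gm : 'M[C]_(nm, n + n)).
Hypotheses (sf : strictly_adapted f0 fp fm) (wg : weakly_adapted g0 gp gm).

Let Gh := std_form_herm C n.

(** One comparison of frames yields both parts: strictness feeds [P_strict], the transition matrices
    feed [P_unique]. *)
Definition unique_frames := [/\ strictly_adapted g0 gp gm,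
  exists v, g0 = v *m f0, exists v, gp = v *m fp & exists v, gm = v *m fm].

Lemma mxbar_ge0 m (d : 'rV[C]_m) : (forall i, 0 <= d 0 i) -> mxbar d = d.
Proof. by move=> h; apply/rowP => i; rewrite mxE; apply/CrealP/ger0_real. Qed.

Lemma mxbar_le0 m (d : 'rV[C]_m) : (forall i, d 0 i <= 0) -> mxbar d = d.
Proof. by move=> h; apply/rowP => i; rewrite mxE; apply/CrealP/ler0_real. Qed.

Lemma lag_frames_unique : fp *m fm^t* = 0 -> gp *m gm^t* = 0 ->
  (col_mx g0 (col_mx gp gm) <= col_mx f0 (col_mx fp fm))%MS -> unique_frames.
Proof.
case: sf => [dp [dm [af rp rm]]]; case: wg => [ep [em [ag sp sm]]] qf qg sub.
have h1 : strict_sign_frame G f0 fp fm dp dm by exact: adapted_sign_frame.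
have h2 : weak_sign_frame G g0 gp gm ep em by exact: adapted_sign_frame.
have [[_ _ p m] v0 vp vm] := sign_frame_unique Gh h1 h2 sub.
by split; [exists ep, em; split; [exact: ag | exact: p | exact: m] | exact: v0 | exact: vp |
  exact: vm].
Qed.

(** F0 + F+ and F0 + F- are compared separately, each diagonalized on its own; they share the block
    [f0]. *)
Lemma oplus_frames_unique : (col_mx g0 gp <= col_mx f0 fp)%MS ->
  (col_mx g0 gm <= col_mx f0 fm)%MS -> unique_frames.
Proof.
case: sf => [dp [dm [af rp rm]]]; case: wg => [ep [em [ag sp sm]]].
rewrite !col_mx_sub => /andP[s0 s1] /andP[s0' s1'].
have h1 : strict_sign_frame G f0 fp (0 : 'M[C]_(0, _)) dp 0 by exact: (adapted_sign_framep af).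
have h2 : weak_sign_frame G g0 gp (0 : 'M[C]_(0, _)) ep 0 by exact: (adapted_sign_framep ag).
have h1' : strict_sign_frame G f0 (0 : 'M[C]_(0, _)) fm 0 dm by exact: (adapted_sign_framem af).
have h2' : weak_sign_frame G g0 (0 : 'M[C]_(0, _)) gm 0 em by exact: (adapted_sign_framem ag).
have z m1 m2 (x : 'M[C]_(m1, n + n)) (y : 'M[C]_(m2, n + n)) (e : 'M[C]_(0, n + n)) :
  [/\ (x <= col_mx x (col_mx y e))%MS, (y <= col_mx x (col_mx y e))%MS & (y <= col_mx x (col_mx e
    y))%MS].
  have hr := sub_col_mxr x; split; first exact: sub_col_mxl.
    exact: submx_trans (sub_col_mxl y e) (hr _ _).
  exact: submx_trans (sub_col_mxr e y) (hr _ _).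
have t1 : (col_mx g0 (col_mx gp (0 : 'M[C]_(0, _))) <= col_mx f0 (col_mx fp (0 : 'M[C]_(0, n +
  n))))%MS.
  have [z1 z2 _] := z _ _ f0 fp 0; have w : (col_mx f0 fp <= col_mx f0 (col_mx fp (0 : 'M[C]_(0,
    n + n))))%MS by rewrite col_mx_sub z1.
  by rewrite !col_mx_sub sub0mx (submx_trans s0 w) (submx_trans s1 w).
have t2 : (col_mx g0 (col_mx (0 : 'M[C]_(0, _)) gm) <= col_mx f0 (col_mx (0 : 'M[C]_(0, n + n))
  fm))%MS.
  have [_ _ z3] := z _ _ f0 fm 0; have w : (col_mx f0 fm <= col_mx f0 (col_mx (0 : 'M[C]_(0, n +
    n)) fm))%MS by rewrite col_mx_sub z3 sub_col_mxl.
  by rewrite !col_mx_sub sub0mx (submx_trans s0' w) (submx_trans s1' w).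
have [[_ _ p _] v0 vp _] := sign_frame_unique Gh h1 h2 t1.
have [[_ _ _ m] _ _ vm] := sign_frame_unique Gh h1' h2' t2.
by split; [exists ep, em; split; [exact: ag | exact: p | exact: m] | exact: v0 | exact: vp |
  exact: vm].
Qed.

(** The comparison is made once in the complexification of a real subspace, which determines [f0]
    and [fp], and once in that of its symplectic complement, which determines [fm]. *)
Lemma gr_frames_unique : 
  fp *m (cj fp)^t* = 0 -> fm *m (cj fm)^t* = 0 ->
  gp *m (cj gp)^t* = 0 -> gm *m (cj gm)^t* = 0 ->
  (col_mx g0 (col_mx gp (cj gp)) <= col_mx f0 (col_mx fp (cj fp)))%MS ->
  (col_mx g0 (col_mx (cj gm) gm) <= col_mx f0 (col_mx (cj fm) fm))%MS -> unique_frames.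
Proof.
case: sf => [dp [dm [af rp rm]]]; case: wg => [ep [em [ag sp sm]]] q1 q2 q3 q4 s1 s2.
have h1 : strict_sign_frame G f0 fp (cj fp) dp (- dp).
  apply: (adapted_real_sign_framep af q1 rp) => [i|]; first by rewrite oppr_lt0.
  by apply: mxbar_ge0 => i; exact: ltW.
have h2 : weak_sign_frame G g0 gp (cj gp) ep (- ep).
  apply: (adapted_real_sign_framep ag q3 sp) => [i|]; first by rewrite oppr_le0.
  exact: mxbar_ge0.
have h1' : strict_sign_frame G f0 (cj fm) fm (- dm) dm.
  apply: (adapted_real_sign_framem af q2 _ rm) => [i|]; first by rewrite oppr_gt0.
  by apply: mxbar_le0 => i; exact: ltW.
have h2' : weak_sign_frame G g0 (cj gm) gm (- em) em.
  apply: (adapted_real_sign_framem ag q4 _ sm) => [i|]; first by rewrite oppr_ge0.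
  exact: mxbar_le0.
have [[_ _ p _] v0 vp _] := sign_frame_unique Gh h1 h2 s1.
have [[_ _ _ m] _ _ vm] := sign_frame_unique Gh h1' h2' s2.
by split; [exists ep, em; split; [exact: ag | exact: p | exact: m] | exact: v0 | exact: vp |
  exact: vm].
Qed.

End SubspaceFrameUniqueness.

(** * Form relations satisfied by every symplectic frame *)

Section FormFramesOfSymplectic.
Variables (R : realType) (n0 np nm : nat).
Local Notation n := (n0 + np + nm)%N.
Local Notation C := R[i].
Local Notation G := (std_form C n).
Local Notation cj := (cj (swap_mx C n)).

(** The symplectically invariant part of [adapted]: the Euclidean conditions are dropped and
    freeness of [f0] stands in for its orthonormality. This suffices to compute the type of the
    subspaces spanned. *)
Definition form_frames (f0 : 'M[C]_(n0, n + n)) (fp : 'M[C]_(np, n + n)) (fm : 'M[C]_(nm, n + n))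
    (dp : 'rV[C]_np) (dm : 'rV[C]_nm) :=
  [/\ [/\ row_free f0, cj f0 = f0, forall i, 0 < dp 0 i & forall i, dm 0 i < 0],
      [/\ f0 *m G *m f0^t* = 0, f0 *m G *m fp^t* = 0 & f0 *m G *m fm^t* = 0],
      [/\ fp *m G *m fp^t* = diag_mx dp, fm *m G *m fm^t* = diag_mx dm &
          fp *m G *m fm^t* = 0] &
      [/\ fp *m G *m (cj fp)^t* = 0, fm *m G *m (cj fm)^t* = 0 &
          fp *m G *m (cj fm)^t* = 0]].

Lemma symp_frame_forms l : symp_frame l ->
  form_frames (frame0 l) (framep l) (framem l) (const_mx 1) (- const_mx 1).
Proof.
move=> [h c].
have [[u0 up um] [u0p u0m upm]] := @unitary_rows R n0 np nm 1%:M (@unitary1 R n).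
pose e0 : 'M[C]_(n0, n) := usubmx (usubmx (1%:M : 'M[C]_n)).
pose ep : 'M[C]_(np, n) := dsubmx (usubmx (1%:M : 'M[C]_n)).
pose em : 'M[C]_(nm, n) := dsubmx (1%:M : 'M[C]_n).
have l0 : usubmx (usubmx l) = e0 *m l by rewrite !mul_usub_mx mul1mx.
have lp : dsubmx (usubmx l) = ep *m l by rewrite mul_dsub_mx mul_usub_mx mul1mx.
have lm : dsubmx l = em *m l by rewrite mul_dsub_mx mul1mx.
have B a b (x : 'M[C]_(a, n)) (y : 'M[C]_(b, n)) : x *m l *m G *m (y *m l)^t* = x *m y^t*.
  by rewrite adjmxM !mulmxA -(mulmxA x) -(mulmxA x) h mulmx1.
have Bc a b (x : 'M[C]_(a, n)) (y : 'M[C]_(b, n)) : x *m l *m G *m (cj (y *m l))^t* = 0.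
  by rewrite cjM adjmxM !mulmxA -(mulmxA x) -(mulmxA x) c mulmx0 mul0mx.
have Bc' a b (x : 'M[C]_(a, n)) (y : 'M[C]_(b, n)) : cj (x *m l) *m G *m (y *m l)^t* = 0.
  exact: (form_adj0 (std_form_herm C n)).
have Bcc a b (x : 'M[C]_(a, n)) (y : 'M[C]_(b, n)) :
    cj (x *m l) *m G *m (cj (y *m l))^t* = - mxbar (x *m y^t*).
  by rewrite cj_std_form B.
rewrite /frame0 /framep /framem l0 lp lm.
have cK := cjK (swap_mx_real C n) (swap_mx_invol C n).
have adjD a b (x y : 'M[C]_(a, b)) : (x + y)^t* = x^t* + y^t* by rewrite linearD map_mxD.
split; split.
(* Pairing with the rows of [e0 *m l] recovers x, since the conjugate summand pairs to zero with
   them. *)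
- rewrite -kermx_eq0; apply/rowV0P => x /sub_kermxP; rewrite mulmxDr => hx.
  have := congr1 (fun z => z *m G *m (e0 *m l)^t*) hx.
  rewrite !mul0mx !mulmxDl -(mulmxA x (cj _)) -(mulmxA x (cj _ *m G)) Bc' mulmx0 addr0.
  by rewrite -(mulmxA x) -(mulmxA x) B u0 mulmx1.
- by rewrite cjD cK addrC.
- by move=> i; rewrite mxE ltr01.
- by move=> i; rewrite !mxE oppr_lt0 ltr01.
- by rewrite adjD !mulmxDl !mulmxDr B Bc Bc' Bcc u0 map_mx1 addr0 add0r subrr.
- by rewrite !mulmxDl B Bc' u0p addr0.
- by rewrite !mulmxDl Bc Bcc u0m map_mx0 oppr0 addr0.
- by rewrite B up diag_const_mx.
- by rewrite Bcc um map_mx1 linearN /= diag_const_mx.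
- exact: Bc.
- exact: Bc.
- by rewrite cK Bc'.
- by rewrite cK B upm.
Qed.

End FormFramesOfSymplectic.
(** * Darboux coordinates *)

Section DarbouxCoordinates.
Variables (R : realType) (V : vectType R) (omega : {skew_symmetric V}) (n : nat).
Local Notation C := R[i].
Local Notation G := (std_form C n).
Local Notation T := (swap_mx C n).
Local Notation cj := (cj T).
Local Notation b := (vbasis {:V}).
Local Notation d := (\dim {:V}).
Local Notation rc := (real_complex R).

Let be : basis_of {:V} b := vbasisP _.

Definition omega_mx : 'M[R]_d := \matrix_(i, j) omega (tnth b i) (tnth b j).

Lemma omega_mxE v w : omega v w = (rVof b v *m omega_mx *m (rVof b w)^T) 0 0.
Proof.
rewrite -{1}(rVofK be v) -{1}(rVofK be w) /vecof linear_sumlz mxE.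
under [RHS]eq_bigr do rewrite mxE big_distrl /=.
rewrite exchange_big /=; apply: eq_bigr => i _.
rewrite linear_sumr; apply: eq_bigr => j _.
rewrite linearZl_LR linearZr_LR /= !mxE !(tnth_nth 0) /= mulrA mulrAC; congr (_ * _).
Qed.

Lemma omega_mx_skew : omega_mx^T = - omega_mx.
Proof. by apply/matrixP => i j; rewrite !mxE [LHS]hermC expr1 mulN1r. Qed.

Hypotheses (omega_symp : is_psymplectic omega) (dimV : d = (n + n)%N).

Lemma omega_mx_unit : omega_mx \in unitmx.
Proof.
case: omega_symp => nd _ _; rewrite -row_free_unit -kermx_eq0; apply/rowV0P => x /sub_kermxP xO.
have : vecof b x \in orthov omega fullv.
  apply/mem_orthovP => w _; rewrite [LHS]omega_mxE vecofK // xO mul0mx mxE //.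
move: nd; rewrite /nondegenerate => /eqP ->; rewrite memv0 vecof_eq0 //.
by move=> /eqP.
Qed.

(** The factor -i turns the real skew-symmetric matrix of omega into a Hermitian matrix that
    conjugation negates, as [darboux_mx] requires. *)
Lemma darboux_coords : exists (M : 'M[C]_(n + n, d)) (Psi : 'M[C]_(d, n + n)),
  [/\ M *m Psi = 1%:M, Psi *m M = 1%:M, cj Psi = Psi &
      Psi *m G *m Psi^t* = - 'i *: map_mx rc omega_mx].
Proof.
have cr m p (A : 'M[R]_(m, p)) : mxbar (map_mx rc A) = map_mx rc A.
  by apply/matrixP => i j; rewrite !mxE; apply/CrealP; rewrite complex_real.
apply: darboux_mx; last exact: dimV.
- rewrite adjmxZ rmorphN /= conjCi opprK (_ : _^t* = map_mx rc omega_mx^T); last first.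
    by apply/matrixP => i j; rewrite !mxE; apply/CrealP; rewrite complex_real.
  by rewrite omega_mx_skew map_mxN scalerN scaleNr.
- by rewrite map_mxZ cr rmorphN /= conjCi -scaleNr.
- rewrite unitmxZ ?map_unitmx ?omega_mx_unit // unitrN unitfE; exact: neq0Ci.
Qed.

End DarbouxCoordinates.
Lemma eqmx_col_mx (F : fieldType) m p q N (A : 'M[F]_(m, N)) (B : 'M[F]_(p, N)) (D : 'M[F]_(q, N)) :
  (A <= D)%MS -> (B <= D)%MS -> (D <= col_mx A B)%MS -> (D :=: col_mx A B)%MS.
Proof. by move=> h1 h2 h3; apply/eqmxP; rewrite h3 col_mx_sub h1 h2. Qed.

(** * Darboux coordinates on the complexification *)

Section ComplexCombinations.
Variables (C : numClosedFieldType) (N : nat).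

Lemma complex_comb_scale (p q : C) (X Y U W : 'rV[C]_N) :
  p *: X + ((- q) *: Y + U) + 'i *: (p *: Y + (q *: X + W)) =
  (p + 'i * q) *: (X + 'i *: Y) + (U + 'i *: W).
Proof.
apply/rowP => j; rewrite !mxE; have := sqrCi C; move: ('i : C) => ii i2.
have -> : p * X 0 j + (- q * Y 0 j + U 0 j) + ii * (p * Y 0 j + (q * X 0 j + W 0 j)) =
  (p + ii * q) * (X 0 j + ii * Y 0 j) + (U 0 j + ii * W 0 j) - (ii ^+ 2 + 1) * q * Y 0 j by ring.
by rewrite i2 addNr !mul0r subr0.
Qed.

Lemma complex_comb_form (G : 'M[C]_N) (X Y U W : 'rV[C]_N) :
  (X + 'i *: Y) *m G *m (U + 'i *: W)^t* =
  X *m G *m U^t* + Y *m G *m W^t* + 'i *: (Y *m G *m U^t* - X *m G *m W^t*).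
Proof.
have -> : (U + 'i *: W)^t* = U^t* - 'i *: W^t*.
  by rewrite linearD map_mxD adjmxZ conjCi scaleNr.
rewrite !mulmxDl !mulmxBr -!scalemxAl -!scalemxAr scalerA.
have := sqrCi C; rewrite expr2 => ->; rewrite scaleN1r opprK scalerBr.
by rewrite [X in _ + X]addrC addrACA; congr (_ + _); rewrite addrC.
Qed.

Lemma complex_comb_form_scalar (G : 'M[C]_N) (X Y U W : 'rV[C]_N) (p q r t : C) :
  X *m G *m U^t* = p%:M -> Y *m G *m W^t* = q%:M -> Y *m G *m U^t* = r%:M ->
  X *m G *m W^t* = t%:M ->
  (X + 'i *: Y) *m G *m (U + 'i *: W)^t* = (p + q + 'i * (r - t))%:M.
Proof.
move=> e1 e2 e3 e4; rewrite complex_comb_form e1 e2 e3 e4.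
by rewrite -!raddfD -raddfB scale_scalar_mx -raddfD.
Qed.

End ComplexCombinations.

Section ComplexCoordinates.
Variables (R : realType) (V : vectType R) (omega : {skew_symmetric V}) (n : nat).
Local Notation C := R[i].
Local Notation VC := (complexification V).
Local Notation G := (std_form C n).
Local Notation T := (swap_mx C n).
Local Notation cj := (cj T).
Local Notation b := (vbasis {:V}).
Local Notation bC := (vbasis {:VC}).
Local Notation d := (\dim {:V}).
Local Notation rc := (real_complex R).
Variables (M : 'M[C]_(n + n, d)) (Psi : 'M[C]_(d, n + n)).

Definition darboux := [/\ M *m Psi = 1%:M, Psi *m M = 1%:M, cj Psi = Psi &
      Psi *m G *m Psi^t* = - 'i *: map_mx rc (omega_mx omega)].
Hypothesis dar : darboux.

Let be : basis_of {:V} b := vbasisP _.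
Let beC : basis_of {:VC} bC := vbasisP _.

Local Notation coordV := (coord_row rc Psi).

Lemma mxbar_real m p (A : 'M[R]_(m, p)) : mxbar (map_mx rc A) = map_mx rc A.
Proof. by apply/matrixP => i j; rewrite !mxE; apply/CrealP; rewrite complex_real. Qed.

Lemma adj_real m p (A : 'M[R]_(m, p)) : (map_mx rc A)^t* = map_mx rc A^T.
Proof. by apply/matrixP => i j; rewrite !mxE; apply/CrealP; rewrite complex_real. Qed.

Lemma cj_coordV v : cj (coordV v) = coordV v.
Proof. by case: dar => _ _ cP _; rewrite /coord_row cjM mxbar_real cP. Qed.

Lemma coordV_form v w : coordV v *m G *m (coordV w)^t* = (- 'i * rc (omega v w))%:M.
Proof.
case: dar => _ _ _ gP.
rewrite /coord_row adjmxM !mulmxA -(mulmxA _ Psi) -(mulmxA _ (Psi *m G)) gP adj_real.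
rewrite -scalemxAr -scalemxAl -!map_mxM.
have -> : rVof b v *m omega_mx omega *m (rVof b w)^T = (omega v w)%:M.
  by apply/matrixP => i j; rewrite !ord1 omega_mxE [RHS]mxE eqxx mulr1n.
by rewrite map_scalar_mx scale_scalar_mx.
Qed.

Definition psi (z : VC) : 'rV[C]_(n + n) := coordV z.1 + 'i *: coordV z.2.

Lemma coordV_linear a v w : coordV (a *: v + w) = rc a *: coordV v + coordV w.
Proof. by rewrite /coord_row linearP map_mxD map_mxZ mulmxDl scalemxAl. Qed.

Lemma coordVN v : coordV (- v) = - coordV v.
Proof. by rewrite /coord_row linearN map_mxN mulNmx. Qed.

Lemma psi_conj z : psi (conj_cplx z) = cj (psi z).
Proof. by rewrite /psi cjD cjZ !cj_coordV conjCi /= coordVN scalerN scaleNr. Qed.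

Lemma psi_linear : linear psi.
Proof.
move=> [a a'] [x y] [u v]; rewrite /psi /=.
have e1 : a *: x - a' *: y + u = a *: x + ((- a') *: y + u) by rewrite scaleNr addrA.
have e2 : a *: y + a' *: x + v = a *: y + (a' *: x + v) by rewrite addrA.
have e3 : rc (- a') = - rc a' by rewrite rmorphN.
rewrite e1 e2 !coordV_linear e3 complex_comb_scale.
suff -> : Complex a a' = rc a + 'i * rc a' by [].
by apply/eqP; rewrite eq_complex /=; apply/andP; split; apply/eqP; ring.
Qed.

Definition psi_inv (r : 'rV[C]_(n + n)) : VC :=
  (vecof b (map_mx (@complex.Re R) (r *m M)), vecof b (map_mx (@complex.Im R) (r *m M))).

Lemma ReIm_rowE m (x : 'rV[C]_m) :
  map_mx rc (map_mx (@complex.Re R) x) + 'i *: map_mx rc (map_mx (@complex.Im R) x) = x.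
Proof.
apply/rowP => j; rewrite !mxE; case: (x 0 j) => p q /=.
by apply/eqP; rewrite eq_complex /=; apply/andP; split; apply/eqP; ring.
Qed.

Lemma psi_invK r : psi (psi_inv r) = r.
Proof.
case: dar => MP _ _ _; rewrite /psi /coord_row /= !vecofK // scalemxAl -mulmxDl.
by rewrite ReIm_rowE -mulmxA MP mulmx1.
Qed.

Lemma psiK z : psi_inv (psi z) = z.
Proof.
case: dar => _ PM _ _; case: z => x y; rewrite /psi_inv /psi /coord_row /= scalemxAl -mulmxDl.
rewrite -mulmxA PM mulmx1; congr (_, _); rewrite -[RHS](rVofK be); congr (vecof b _);
  by apply/rowP => j; rewrite !mxE /=; ring.
Qed.

Lemma psi_kappa z w : psi z *m G *m (psi w)^t* = (kappa omega z w)%:M.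
Proof.
case: z w => [x y] [u v].
have h := complex_comb_form_scalar (coordV_form x u) (coordV_form y v) (coordV_form y u)
  (coordV_form x v).
apply: etrans h (congr1 scalar_mx _); rewrite /kappa /omegaC /= !linearNr /=.
apply/eqP; rewrite eq_complex /=; apply/andP; split; apply/eqP; ring.
Qed.

Lemma omegaCE z w : omegaC omega z w = 'i * (psi z *m G *m (cj (psi w))^t*) 0 0.
Proof.
rewrite -psi_conj psi_kappa mxE eqxx mulr1n /kappa mulrN mulrA -expr2 sqrCi mulN1r opprK.
by case: w => u v; rewrite /conj_cplx /= opprK.
Qed.

(** The complexification comes with a basis of its own, unrelated to the chosen basis of V, so the
    coordinate map has to be rewritten in that basis before the general lemmas on [coords] apply. *)
Definition PsiC : 'M[C]_(\dim {:VC}, n + n) := \matrix_i psi (tnth bC i).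

HB.instance Definition _ := GRing.isLinear.Build C VC 'rV[C]_(n + n) _ psi psi_linear.

Lemma psiE z : psi z = rVof bC z *m PsiC.
Proof.
rewrite -{1}(rVofK beC z) /vecof linear_sum; apply/rowP => j; rewrite mxE summxE.
by apply: eq_bigr => i _; rewrite linearZ !mxE (tnth_nth 0).
Qed.

Lemma psi_coord_row z : coord_row idfun PsiC z = psi z.
Proof. by rewrite /coord_row (map_mx_id (fun=> erefl)) psiE. Qed.

Lemma psi_inj : injective psi.
Proof. exact: can_inj psiK. Qed.

Lemma PsiC_free : row_free PsiC.
Proof.
rewrite -kermx_eq0; apply/rowV0P => x /sub_kermxP h.
have : psi (vecof bC x) = psi 0 by rewrite psiE vecofK // h linear0.
by move=> /psi_inj /eqP; rewrite vecof_eq0 // => /eqP.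
Qed.

Definition invC : 'M[C]_(n + n, \dim {:VC}) := \matrix_i rVof bC (psi_inv (delta_mx 0 i)).

Lemma invCK : invC *m PsiC = 1%:M.
Proof. by apply/row_matrixP => i; rewrite row_mul rowK -psiE psi_invK row1. Qed.

Definition coordsC (F : {vspace VC}) : 'M[C]_(\dim {:VC}, n + n) := coords idfun PsiC F.

Lemma mem_coordsC z (F : {vspace VC}) : (z \in F) = (psi z <= coordsC F)%MS.
Proof. by rewrite -psi_coord_row; exact: mem_coords PsiC_free _ _. Qed.

Lemma sub_coordsC F F' : (F <= F')%VS = (coordsC F <= coordsC F')%MS.
Proof. exact: sub_coords PsiC_free _ _. Qed.

Lemma coordsC_inj F F' : (coordsC F :=: coordsC F')%MS -> F = F'.
Proof. exact: coords_inj PsiC_free _ _. Qed.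

Lemma rank_coordsC F : \rank (coordsC F) = \dim F.
Proof. exact: rank_coords PsiC_free _. Qed.

Definition spanC m (E : 'M[C]_(m, n + n)) : {vspace VC} := vsof bC <<E *m invC>>%MS.

Lemma coords_spanC m (E : 'M[C]_(m, n + n)) : (coordsC (spanC E) :=: E)%MS.
Proof.
apply: eqmx_trans (coords_vsof idfun PsiC_free _) _.
rewrite (map_mx_id (fun=> erefl)); apply: eqmx_trans (eqmxMr PsiC (genmxE _)) _.
by rewrite -mulmxA invCK mulmx1.
Qed.

Lemma mem_spanC m (E : 'M[C]_(m, n + n)) z : (z \in spanC E) = (psi z <= E)%MS.
Proof. by rewrite mem_coordsC coords_spanC. Qed.

Lemma coordsC_add F F' : (coordsC (F + F')%VS :=: col_mx (coordsC F) (coordsC F'))%MS.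
Proof.
have /eqmxP/andP[ea eb] := coords_spanC (col_mx (coordsC F) (coordsC F')).
set D := spanC _ in ea eb.
have h1 := etrans (esym (sub_coordsC F (F + F')%VS)) (addvSl F F').
have h2 := etrans (esym (sub_coordsC F' (F + F')%VS)) (addvSr F F').
have h3 := etrans (sub_coordsC F D) (submx_trans (sub_col_mxl _ _) eb).
have h4 := etrans (sub_coordsC F' D) (submx_trans (sub_col_mxr _ _) eb).
have h5 : (F + F' <= D)%VS by rewrite subv_add h3 h4.
have h6 := etrans (esym (sub_coordsC _ _)) h5.
exact: eqmx_col_mx h1 h2 (submx_trans h6 ea).
Qed.

End ComplexCoordinates.
(** * Complex Lagrangian subspaces *)

Section Eigenvalues.
Variable R : realType.
Local Notation C := R[i].

Lemma char_poly_conj n (v w A : 'M[C]_n) : w *m v = 1%:M -> v *m w = 1%:M ->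
  char_poly (w *m A *m v) = char_poly A.
Proof.
move=> wv vw; rewrite /char_poly.
have -> : char_poly_mx (w *m A *m v) = map_mx polyC w *m char_poly_mx A *m map_mx polyC v.
  rewrite /char_poly_mx mulmxBr mulmxBl -!map_mxM; congr (_ - _).
  by rewrite mul_mx_scalar -scalemxAl -map_mxM wv map_mx1 scalemx1.
rewrite !det_mulmx mulrC mulrA -det_mulmx -map_mxM vw map_mx1 det1 mul1r //.
Qed.

(** A list of roots is determined up to permutation by the product of its linear factors, so it can
    be compared with the diagonal of any similar diagonal matrix. *)
Lemma count_eigenvalues n (v w A : 'M[C]_n) (d : 'rV[C]_n) (a : pred C) :
  w *m v = 1%:M -> v *m w = 1%:M -> A = w *m diag_mx d *m v ->
  count a (eigenvalues A) = #|[pred i | a (d 0 i)]|.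
Proof.
move=> wv vw AE.
have e : perm_eq (eigenvalues A) [seq d 0 i | i <- enum 'I_n].
  apply: prod_XsubC_eq; rewrite /eigenvalues.
  case: closed_field_poly_normal => r /=; rewrite (monicP (char_poly_monic A)) scale1r => <-.
  rewrite AE char_poly_conj // char_poly_trig ?diag_mx_is_trig //.
  by rewrite big_map big_enum /=; apply: eq_bigr => i _; rewrite mxE eqxx mulr1n.
have /permP -> := e.
by rewrite count_map -sum1_count big_enum_cond /= sum1_card.
Qed.

End Eigenvalues.

Section LagrangianMatrices.
Variables (C : numClosedFieldType) (n : nat).
Local Notation G := (std_form C n).
Local Notation T := (swap_mx C n).
Local Notation cj := (cj T).

Lemma rank_cj m (Y : 'M[C]_(m, n + n)) : \rank (cj Y) = \rank Y.
Proof.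
rewrite /cj mxrankMfree ?mxrank_map // row_free_unit.
by have /mulmx1_unit[] := swap_mx_invol C n.
Qed.

Lemma rank_form_kernel m (Y : 'M[C]_(m, n + n)) :
  \rank (kermx (G *m Y^t*)) = (n + n - \rank Y)%N.
Proof.
have Gu : row_full G by rewrite row_full_unit; have /mulmx1_unit[] := std_form_invol C n.
by rewrite mxrank_ker (eqmxMfull _ Gu) mxrank_map mxrank_tr.
Qed.

Lemma sub_form0 m p k l (Y : 'M[C]_(m, n + n)) (Z : 'M[C]_(p, n + n)) (A : 'M[C]_(k, n + n)) (B :
  'M[C]_(l, n + n)) :
  Y *m G *m Z^t* = 0 -> (A <= Y)%MS -> (B <= Z)%MS -> A *m G *m B^t* = 0.
Proof.
move=> h /submxP[a ->] /submxP[b ->].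
by rewrite adjmxM !mulmxA -(mulmxA a) -(mulmxA a) h mulmx0 mul0mx.
Qed.

Lemma sub_form_kernel m k (Y : 'M[C]_(m, n + n)) (x : 'M[C]_(k, n + n)) :
  (x <= kermx (G *m Y^t*))%MS = (x *m G *m Y^t* == 0).
Proof. by rewrite (sameP sub_kermxP eqP) mulmxA. Qed.

Lemma form_kernelE m p (Y : 'M[C]_(m, n + n)) (Z : 'M[C]_(p, n + n)) :
  Z *m G *m Y^t* = 0 -> (\rank Y + \rank Z)%N = (n + n)%N -> (kermx (G *m Y^t*) :=: Z)%MS.
Proof.
move=> h r; apply: eqmx_sym; apply/eqmxP.
have s : (Z <= kermx (G *m Y^t*))%MS by rewrite sub_form_kernel h.
rewrite -(mxrank_leqif_eq s) rank_form_kernel; apply/eqP; apply: (@addnI (\rank Y)).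
by rewrite subnKC ?rank_leq_col.
Qed.

Lemma eqmx_unitary_rank m k p (B : 'M[C]_(k, p)) (Y : 'M[C]_(m, p)) : B \is unitarymx ->
  (B <= Y)%MS -> \rank Y = k -> (Y :=: B)%MS.
Proof.
move=> uB s r; apply: eqmx_sym; apply/eqmxP; rewrite -(mxrank_leqif_eq s) r.
by have := unitary_row_free uB; rewrite /row_free.
Qed.

(** By isotropy and a dimension count the orthogonal complement of [cj Y] for the form is [Y].
    Conjugating, the complement of [Y] is [cj Y], so the kernel of kappa on [Y] is the intersection
    of [Y] with its conjugate. This is the source of the real structure on the kernel. *)
Lemma lagrangian_real_kernel m (Y : 'M[C]_(m, n + n)) : \rank Y = n ->
  Y *m G *m (cj Y)^t* = 0 ->
  (cj (Y :&: kermx (G *m Y^t*))%MS <= Y :&: kermx (G *m Y^t*))%MS.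
Proof.
move=> r iso; set Z := (Y :&: _)%MS.
have cK := cjK (swap_mx_real C n) (swap_mx_invol C n).
have eK : (kermx (G *m (cj Y)^t*) :=: Y)%MS by apply: form_kernelE iso _; rewrite rank_cj r.
have ZY : (Z <= Y)%MS by exact: capmxSl.
have ZG : Z *m G *m Y^t* = 0 by apply/eqP; rewrite -sub_form_kernel; exact: capmxSr.
have h1 : cj Z *m G *m (cj Y)^t* = 0 by exact: cj_std_form0 ZG.
have h2 : Z *m G *m (cj Y)^t* = 0 by exact: sub_form0 iso ZY (submx_refl _).
have h3 := cj_std_form0 h2; rewrite cK in h3.
by rewrite sub_capmx -eK !sub_form_kernel h1 h3 !eqxx.
Qed.

Lemma real_unitary_basis m k (Y : 'M[C]_(m, n + n)) : (cj Y <= Y)%MS -> \rank Y = k ->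
  exists B : 'M[C]_(k, n + n), [/\ B \is unitarymx, cj B = B & (B :=: Y)%MS].
Proof.
by move=> h <-; apply: cj_stable_real_basis h; [exact: swap_mx_real | exact: swap_mx_sym | exact:
  swap_mx_invol].
Qed.

Lemma unitary_basis m k p (Y : 'M[C]_(m, p)) : \rank Y = k ->
  exists2 B : 'M[C]_(k, p), B \is unitarymx & (B :=: Y)%MS.
Proof.
move=> <-; exists (orthonormalize (row_base Y)); first exact: row_base_orthonormalize_unitary.
by apply: eqmx_trans (orthonormalize_eqmx (row_base_free _)) _; exact: eq_row_base.
Qed.

End LagrangianMatrices.
Lemma leq_split_sum a p m b c : (a + (p + m) = a + b + c)%N -> (p <= b)%N -> (m <= c)%N ->
  p = b /\ m = c.
Proof. by move=> *; split; lia. Qed.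

Lemma form_entry (C : numClosedFieldType) N m p (G : 'M[C]_N) (Y : 'M[C]_(m, N)) (Z : 'M[C]_(p,
  N)) i j :
  (Y *m G *m Z^t*) i j = (row i Y *m G *m (row j Z)^t*) 0 0.
Proof.
have -> : (row j Z)^t* = col j (Z^t*) by apply/matrixP => k l; rewrite !mxE.
by rewrite -row_mul [col j _]colE mulmxA -row_mul -colE [RHS]mxE [RHS]mxE.
Qed.

Lemma form_rows0 (C : numClosedFieldType) N m p (G : 'M[C]_N) (Y : 'M[C]_(m, N)) (Z : 'M[C]_(p,
  N)) :
  (forall x y : 'rV[C]_N, (x <= Y)%MS -> (y <= Z)%MS -> x *m G *m y^t* = 0) ->
  Y *m G *m Z^t* = 0.
Proof.
move=> h; apply/matrixP => i j; rewrite form_entry h ?row_sub //.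
by rewrite !mxE.
Qed.

Section LagrangianSubspaces.
Variables (R : realType) (V : vectType R) (omega : {skew_symmetric V}).
Variables n0 np nm : nat.
Local Notation n := (n0 + np + nm)%N.
Local Notation C := R[i].
Local Notation VC := (complexification V).
Local Notation G := (std_form C n).
Local Notation T := (swap_mx C n).
Local Notation cj := (cj T).
Local Notation d := (\dim {:V}).
Variables (M : 'M[C]_(n + n, d)) (Psi : 'M[C]_(d, n + n)).
Hypothesis dar : darboux omega M Psi.
Local Notation psi := (psi Psi).
Local Notation coordsC := (coordsC Psi).

Let Gh := std_form_herm C n.

Lemma sub_coordsC_row (x : 'rV[C]_(n + n)) F : (x <= coordsC F)%MS = (psi_inv M x \in F).
Proof. by rewrite (mem_coordsC dar) (psi_invK dar). Qed.

Lemma kappa_eq0 z w : (kappa omega z w = 0) <-> (psi z *m G *m (psi w)^t* = 0).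
Proof.
rewrite (psi_kappa dar); split=> [->|/matrixP/(_ 0 0)]; first by rewrite raddf0.
by rewrite !mxE eqxx mulr1n.
Qed.

Lemma coords_kappa_ker F :
  (coordsC (kappa_ker omega F) :=: coordsC F :&: kermx (G *m (coordsC F)^t*))%MS.
Proof.
apply/eqmxP/andP; split; apply/rV_subP => x; rewrite sub_coordsC_row /kappa_ker memv_cap
  sub_capmx sub_form_kernel sub_coordsC_row.
  move=> /andP[-> /mem_orthovP h] /=; apply/eqP; apply: form_rows0 => x' y.
  move=> /sub_rVP[c ->]; rewrite sub_coordsC_row => /h /kappa_eq0.
  by rewrite !(psi_invK dar) -!scalemxAl => ->; rewrite scaler0.
move=> /andP[-> /eqP h] /=; apply/mem_orthovP => w; rewrite (mem_coordsC dar) => wF.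
by apply/kappa_eq0; rewrite (psi_invK dar); apply: sub_form0 h (submx_refl _) wF.
Qed.

Lemma coords_isotropic (F : {vspace VC}) : {in F &, forall z w, omegaC omega z w = 0} <->
  coordsC F *m G *m (cj (coordsC F))^t* = 0.
Proof.
split=> [h|h z w].
  apply: form_rows0 => x y; rewrite sub_coordsC_row => xF yF.
  have cK := cjK (swap_mx_real C n) (swap_mx_invol C n).
  have : (cj y <= coordsC F)%MS by rewrite -[coordsC F]cK; apply: cjS.
  rewrite sub_coordsC_row => yF'; have := h _ _ xF yF'.
  rewrite (omegaCE dar) !(psi_invK dar) cK => /eqP; rewrite mulf_eq0 (negPf (neq0Ci _)) /= =>
    /eqP e.
  by apply/matrixP => i j; rewrite !ord1 e mxE.
rewrite !(mem_coordsC dar) => zF wF; rewrite (omegaCE dar) (sub_form0 h zF) ?mxE ?mulr0 //.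
exact: cjS.
Qed.

Lemma coordsC_frame (m : nat) (e : m.-tuple VC) F : basis_of F e ->
  (coordsC F :=: \matrix_i psi (tnth e i))%MS /\ row_free (\matrix_i psi (tnth e i)).
Proof.
move=> be; have e1 : \matrix_i psi (tnth e i) = map_mx idfun (frame_coord e) *m PsiC Psi.
  apply/row_matrixP => i; rewrite rowK row_mul psiE; congr (_ *m _).
  by rewrite (map_mx_id (fun=> erefl)); apply/rowP => j; rewrite !mxE.
rewrite e1 -(span_basis be); split; first exact: (coords_span idfun (PsiC_free dar) e).
rewrite /row_free mxrankMfree ?(PsiC_free dar) // mxrank_map.
by have := frame_coord_free e; rewrite (basis_free be) /row_free => ->.
Qed.

Lemma gram_psi (m : nat) (e : m.-tuple VC) :
  gram omega e = (\matrix_i psi (tnth e i)) *m G *m (\matrix_i psi (tnth e i))^t*.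
Proof.
apply/matrixP => i j; rewrite form_entry !rowK (psi_kappa dar) !mxE eqxx mulr1n //.
Qed.

(** The type counts eigenvalues of one Gram matrix. Diagonalizing it unitarily puts F in the setting
    of [inertia_pos_le], which bounds every positive subspace; the negative bound is the same
    argument for -G. *)
Lemma lagrangian_type_inertia (p : nat) (A : 'M[C]_(p, n + n)) F :
  lagrangian_type omega n0 np nm F -> (A <= coordsC F)%MS ->
  ((forall x : 'rV[C]_p, x != 0 -> 0 < (x *m A *m G *m (x *m A)^t*) 0 0) -> (p <= np)%N) /\
  ((forall x : 'rV[C]_p, x != 0 -> 0 < (x *m A *m - G *m (x *m A)^t*) 0 0) -> (p <= nm)%N).
Proof.
move=> [_ [e [be cp cm]]] AF; have [eE _] := coordsC_frame be.
set E := \matrix_i _ in eE; have gE : gram omega e = E *m G *m E^t* := gram_psi e.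
have qh : (gram omega e)^t* = gram omega e by rewrite gE (form_adj Gh).
have us := spectral_unitarymx (gram omega e).
have sE := hermitian_spectralE qh; have dr := hermitian_spectral_real qh.
set u := spectralmx _ in us sE; set D := spectral_diag _ in sE dr.
have uu : u *m u^t* = 1%:M by apply/unitarymxP.
have uu' : u^t* *m u = 1%:M by exact: unitary_inv.
have BG : (u *m E) *m G *m (u *m E)^t* = diag_mx D.
  rewrite adjmxM !mulmxA -(mulmxA u) -(mulmxA u) -gE sE !mulmxA uu mul1mx.
  by rewrite -mulmxA uu mulmx1.
have AB : (A <= u *m E)%MS.
  by rewrite (eqmxMfull E (_ : row_full u)) -?eE // row_full_unit; have /mulmx1_unit[] := uu.
have Dr i : D 0 i \is Num.real.
  by apply/CrealP; have := congr1 (fun z : 'rV__ => z 0 i) dr; rewrite mxE.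
split=> h.
  have := inertia_pos_le BG Dr AB h.
  by rewrite -(count_eigenvalues (fun z => 0 < z) uu' uu sE) cp.
have BG' : (u *m E) *m (- G) *m (u *m E)^t* = diag_mx (- D) by rewrite mulmxN mulNmx BG linearN.
have Dr' i : (- D) 0 i \is Num.real by rewrite mxE rpredN.
have := inertia_pos_le BG' Dr' AB h.
rewrite (eq_card (B := [pred i | D 0 i < 0])); last by move=> i; rewrite !inE mxE oppr_gt0.
by rewrite -(count_eigenvalues (fun z => z < 0) uu' uu sE) cm.
Qed.

(** A real orthonormal basis of the kernel is extended spectrally to a frame of F. Inertia bounds
    the sizes of the two definite blocks by np and nm, and since all rows together number n, both
    bounds are attained. *)
Lemma lagrangian_frames F : complex_lagrangian omega n0 np nm F ->
  lagrangian_type omega n0 np nm F ->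
  exists (f0 : 'M[C]_(n0, n + n)) (fp : 'M[C]_(np, n + n)) (fm : 'M[C]_(nm, n + n)),
  [/\ strictly_adapted f0 fp fm, fp *m fm^t* = 0,
      (coordsC F :=: col_mx f0 (col_mx fp fm))%MS & (coordsC (kappa_ker omega F) :=: f0)%MS].
Proof.
move=> [dF /coords_isotropic iso] tF; set Y := coordsC F in iso *.
have rY : \rank Y = n by rewrite (rank_coordsC dar).
have kE := coords_kappa_ker F; rewrite -/Y in kE.
have [d0 _] := tF.
have rZ : \rank (Y :&: kermx (G *m Y^t*))%MS = n0 by rewrite -kE (rank_coordsC dar).
have [f0 [u0 c0 e0]] := real_unitary_basis (lagrangian_real_kernel rY iso) rZ.
have [B uB eB] := unitary_basis rY.
have f0Y : (f0 <= Y)%MS by rewrite e0; exact: capmxSl.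
have f0G : f0 *m G *m Y^t* = 0 by apply/eqP; rewrite -sub_form_kernel e0; exact: capmxSr.
have f0B : (f0 <= B)%MS by rewrite eB.
have BY : (B <= Y)%MS by rewrite eB.
have YB : (Y <= B)%MS by rewrite eB.
have f0GB := sub_form0 f0G (submx_refl f0) BY.
have kB (x : 'rV[C]_(n + n)) : (x <= B)%MS -> x *m G *m B^t* = 0 -> (x <= f0)%MS.
  move=> xB xGB; rewrite e0 sub_capmx (submx_trans xB BY) /= sub_form_kernel.
  by rewrite (sub_form0 xGB (submx_refl _) YB).
have [p [m [fp [fm [dp [dm [sf ef epm]]]]]]] := spectral_sign_frame_kernel Gh uB u0 f0B f0GB kB.
have /(sign_frameP Gh)[[_ up um] [q0p q0m qpm] [h0 h0p h0m] [ep gpm em] [rp rm]] := sf.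
have fY : (col_mx f0 (col_mx fp fm) <= Y)%MS by rewrite ef.
move: (fY); rewrite !col_mx_sub => /and3P[_ fpY fmY].
have pn : (p <= np)%N.
  have [h _] := lagrangian_type_inertia tF fpY; apply: h; exact: (diag_gram_pos ep rp).
have mn : (m <= nm)%N.
  have [_ h] := lagrangian_type_inertia tF fmY; apply: h.
  apply: (@diag_gram_pos _ _ _ _ _ (- dm)); first by rewrite mulmxN mulNmx em linearN.
  by move=> i; rewrite mxE oppr_gt0.
have [pE mE] := leq_split_sum epm pn mn.
subst p m; exists f0, fp, fm; split=> //.
- exists dp, dm; split=> //; split.
  + by split; apply/unitarymxP.
  + by split.
  + by split.
  + by split.
  + by split; apply: (sub_form0 iso) => //; apply: cjS.
- exact: eqmx_sym (eqmx_trans ef eB).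
- exact: eqmx_trans kE (eqmx_sym e0).
Qed.

End LagrangianSubspaces.
Lemma eqmx_col_mxA (F : fieldType) m p q N (A : 'M[F]_(m, N)) (B : 'M[F]_(p, N)) (D : 'M[F]_(q,
  N)) :
  (col_mx (col_mx A B) D :=: col_mx A (col_mx B D))%MS.
Proof.
apply/eqmxP; set E := col_mx (col_mx A B) D; set E' := col_mx A (col_mx B D).
have : (E <= E)%MS && (E' <= E')%MS by rewrite !submx_refl.
by rewrite {1}/E {3}/E' !col_mx_sub => /andP[/andP[/andP[-> ->] ->] /and3P[-> -> ->]].
Qed.

Section FormFrames.
Variables (R : realType) (n0 np nm : nat).
Local Notation n := (n0 + np + nm)%N.
Local Notation C := R[i].
Local Notation G := (std_form C n).
Local Notation cj := (cj (swap_mx C n)).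
Variables (f0 : 'M[C]_(n0, n + n)) (fp : 'M[C]_(np, n + n)) (fm : 'M[C]_(nm, n + n)).
Variables (dp : 'rV[C]_np) (dm : 'rV[C]_nm).
Hypothesis ff : form_frames f0 fp fm dp dm.

Let Gh := std_form_herm C n.
Local Notation E := (col_mx (col_mx f0 fp) fm).
Local Notation D := (row_mx (row_mx (0 : 'rV[C]_n0) dp) dm).

Lemma form_frames_gram : E *m G *m E^t* = diag_mx D.
Proof.
have [_ [g0 g0p g0m] [gp gm gpm] _] := ff.
rewrite !(col_mx_form G) !diag_row_mx g0 g0p gp gm (form_adj0 Gh g0p) linear0.
have h : col_mx f0 fp *m G *m fm^t* = 0 by rewrite !mul_col_mx g0m gpm col_mx0.
by rewrite h (form_adj0 Gh h).
Qed.

Lemma form_frames_kernel (c : 'rV[C]_n) : c *m diag_mx D = 0 ->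
  c *m E = lsubmx (lsubmx c) *m f0.
Proof.
have [[_ _ rp rm] _ _ _] := ff.
move=> h; have e i : D 0 i != 0 -> c 0 i = 0.
  have := congr1 (fun z : 'rV__ => z 0 i) h; rewrite mul_mx_diag !mxE => /eqP.
  by rewrite mulf_eq0 => /orP[/eqP|/eqP ->]; rewrite ?eqxx.
have -> : c = row_mx (row_mx (lsubmx (lsubmx c)) 0) 0.
  apply/rowP => i; case: (split_ordP i) => [j|j] ->; rewrite ?row_mxEl ?row_mxEr.
    case: (split_ordP j) => [k|k] ->; rewrite ?row_mxEl ?row_mxEr ?mxE //.
    by rewrite e ?row_mxEl ?row_mxEr ?gt_eqF.
  by rewrite e ?row_mxEr ?lt_eqF // mxE.
by rewrite !mul_row_col !mul0mx !addr0 !row_mxKl.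
Qed.

(** A linear relation between the rows is annihilated by the Gram matrix, which leaves only its part
    along [f0], and [f0] is free. *)
Lemma form_frames_free : row_free E.
Proof.
have [[r0 _ _ _] _ _ _] := ff.
rewrite -kermx_eq0; apply/rowV0P => x /sub_kermxP xE.
have xD : x *m diag_mx D = 0 by rewrite -form_frames_gram !mulmxA xE !mul0mx.
have h := form_frames_kernel xD; rewrite xE in h.
have x0 : lsubmx (lsubmx x) = 0 by apply: (row_free_inj r0); rewrite -h mul0mx.
apply/rowP => i; have [[_ _ rp rm] _ _ _] := ff.
have e : D 0 i != 0 -> x 0 i = 0.
  have := congr1 (fun z : 'rV__ => z 0 i) xD; rewrite mul_mx_diag !mxE => /eqP.
  by rewrite mulf_eq0 => /orP[/eqP|/eqP ->]; rewrite ?eqxx.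
rewrite mxE; case: (split_ordP i) => [j ij|j ij]; last first.
  by apply: e; rewrite ij row_mxEr lt_eqF.
case: (split_ordP j) => [k jk|k jk]; last first.
  by apply: e; rewrite ij row_mxEl jk row_mxEr gt_eqF.
by have := congr1 (fun z : 'rV__ => z 0 k) x0; rewrite !mxE ij jk.
Qed.

Lemma form_frames_isotropic : E *m G *m (cj E)^t* = 0.
Proof.
have [[_ c0 _ _] [g0 g0p g0m] _ [kp km kpm]] := ff.
have h1 : f0 *m G *m (cj fp)^t* = 0 by rewrite -c0; exact: cj_std_form0.
have h2 : f0 *m G *m (cj fm)^t* = 0 by rewrite -c0; exact: cj_std_form0.
have h3 : fm *m G *m (cj fp)^t* = 0.
  apply: (form_adj0 Gh); have := cj_std_form0 kpm.
  by rewrite (cjK (swap_mx_real C n) (swap_mx_invol C n)).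
rewrite !cj_col_mx c0 !mul_col_mx !adj_col_mx !mul_mx_row.
by rewrite g0 h1 h2 kp kpm km h3 (form_adj0 Gh g0p) (form_adj0 Gh g0m) !row_mx0 !col_mx0.
Qed.

Lemma card_form_frames :
  #|[pred i : 'I_n | (0 < D 0 i)%R]| = np /\ #|[pred i : 'I_n | (D 0 i < 0)%R]| = nm.
Proof.
have [[_ _ rp rm] _ _ _] := ff.
have z (P : pred C) (bp bm : bool) : P 0 = false -> (forall i, P (dp 0 i) = bp) ->
    (forall i, P (dm 0 i) = bm) -> #|[pred i : 'I_n | P (D 0 i)]| = (np * bp + nm * bm)%N.
  move=> P0 Pp Pm; rewrite -sum1_card big_mkcond big_split_ord big_split_ord /=.
  rewrite big1 ?add0n => [|i _]; last by rewrite inE row_mxEl row_mxEl mxE P0.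
  congr (_ + _)%N.
    rewrite (eq_bigr (fun=> bp : nat)) ?sum_nat_const ?card_ord // => i _.
    by rewrite inE row_mxEl row_mxEr Pp; case: bp {Pp}.
  rewrite (eq_bigr (fun=> bm : nat)) ?sum_nat_const ?card_ord // => i _.
  by rewrite inE row_mxEr Pm; case: bm {Pm}.
split.
  rewrite (z (fun x => 0 < x) true false) ?ltxx ?muln0 ?muln1 ?addn0 // => i.
  by apply: lt_gtF; exact: rm.
rewrite (z (fun x => x < 0) false true) ?ltxx ?muln0 ?muln1 ?add0n // => i.
by apply: lt_gtF; exact: rp.
Qed.

End FormFrames.

Section LagrangianFrames.
Variables (R : realType) (V : vectType R) (omega : {skew_symmetric V}).
Variables n0 np nm : nat.
Local Notation n := (n0 + np + nm)%N.
Local Notation C := R[i].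
Local Notation VC := (complexification V).
Local Notation G := (std_form C n).
Local Notation d := (\dim {:V}).
Variables (M : 'M[C]_(n + n, d)) (Psi : 'M[C]_(d, n + n)).
Hypothesis dar : darboux omega M Psi.
Local Notation psi := (psi Psi).
Local Notation coordsC := (coordsC Psi).

Lemma free_psi (m : nat) (e : m.-tuple VC) : free e = row_free (\matrix_i psi (tnth e i)).
Proof.
have -> : \matrix_i psi (tnth e i) = map_mx idfun (frame_coord e) *m PsiC Psi.
  apply/row_matrixP => i; rewrite rowK row_mul psiE; congr (_ *m _).
  by rewrite (map_mx_id (fun=> erefl)); apply/rowP => j; rewrite !mxE.
by rewrite -frame_coord_free /row_free mxrankMfree ?(PsiC_free dar) // mxrank_map.
Qed.

Section Frames.
Variables (f0 : 'M[C]_(n0, n + n)) (fp : 'M[C]_(np, n + n)) (fm : 'M[C]_(nm, n + n)).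
Variables (dp : 'rV[C]_np) (dm : 'rV[C]_nm) (F : {vspace VC}).
Hypothesis ff : form_frames f0 fp fm dp dm.
Hypothesis FE : (coordsC F :=: col_mx f0 (col_mx fp fm))%MS.

Local Notation E := (col_mx (col_mx f0 fp) fm).
Local Notation D := (row_mx (row_mx (0 : 'rV[C]_n0) dp) dm).

Let FE' : (coordsC F :=: E)%MS.
Proof. exact: eqmx_trans FE (eqmx_sym (eqmx_col_mxA _ _ _)). Qed.

Lemma form_frames_dim : \dim F = n.
Proof. by rewrite -(rank_coordsC dar) FE'; have := form_frames_free ff;
  rewrite /row_free => /eqP. Qed.

Lemma form_frames_lagrangian : complex_lagrangian omega n0 np nm F.
Proof.
split; first exact: form_frames_dim.
apply/(coords_isotropic dar); apply: (sub_form0 (form_frames_isotropic ff)); first by rewrite FE'.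
by apply: cjS; rewrite FE'.
Qed.

Lemma form_frames_kappa_ker : (coordsC (kappa_ker omega F) :=: f0)%MS.
Proof.
have [_ [g0 g0p g0m] _ _] := ff.
apply: eqmx_trans (coords_kappa_ker dar F) _; apply/eqmxP/andP; split; last first.
  rewrite sub_capmx FE' sub_form_kernel.
  have s : (f0 <= E)%MS by apply: submx_trans (sub_col_mxl _ _) (sub_col_mxl _ _).
  rewrite s /=; apply/eqP; apply: (@sub_form0 _ _ _ _ _ _ f0 E) => //; last by rewrite FE'.
  by rewrite !adj_col_mx !mul_mx_row g0 g0p g0m !row_mx0.
apply/rV_subP => x; rewrite sub_capmx FE' sub_form_kernel => /andP[/submxP[c ->] /eqP h].
have : c *m diag_mx D = 0.
  rewrite -(form_frames_gram ff) !mulmxA.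
  by apply: (sub_form0 h) => //; rewrite FE'.
by move=> /(form_frames_kernel ff) ->; exact: submxMl.
Qed.

Lemma form_frames_type : lagrangian_type omega n0 np nm F.
Proof.
have [[r0 _ _ _] _ _ _] := ff.
split; first by rewrite -(rank_coordsC dar) form_frames_kappa_ker; apply/eqP.
pose e : n.-tuple VC := [tuple psi_inv M (row i E) | i < n].
have eE : \matrix_i psi (tnth e i) = E.
  by apply/row_matrixP => i; rewrite rowK tnth_mktuple (psi_invK dar).
have g : gram omega e = E *m G *m E^t* by rewrite (gram_psi dar) eE.
have g' : gram omega e = 1%:M *m diag_mx D *m 1%:M by rewrite g (form_frames_gram ff) mul1mx mulmx1.
have [cp cm] := card_form_frames ff.
have i1 : 1%:M *m 1%:M = 1%:M :> 'M[C]_n by rewrite mulmx1.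
exists e; split.
- rewrite basisEfree; apply/and3P; split.
  + by rewrite free_psi eE; exact: form_frames_free ff.
  + apply/span_subvP => _ /tnthP[i ->]; rewrite (mem_coordsC dar) tnth_mktuple (psi_invK dar) FE'.
    exact: row_sub.
  + by rewrite size_tuple form_frames_dim.
- by rewrite (count_eigenvalues (fun z => 0 < z) i1 i1 g') cp.
- by rewrite (count_eigenvalues (fun z => z < 0) i1 i1 g') cm.
Qed.

End Frames.

End LagrangianFrames.
Lemma eqmx_col_mx_cong (C : numClosedFieldType) m m' p p' N (A : 'M[C]_(m, N)) (A' : 'M[C]_(m', N))
    (B : 'M[C]_(p, N)) (B' : 'M[C]_(p', N)) :
  (A :=: A')%MS -> (B :=: B')%MS -> (col_mx A B :=: col_mx A' B')%MS.
Proof.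
move=> eA eB; apply/eqmxP/andP; split; rewrite col_mx_sub.
  by rewrite eA eB sub_col_mxl sub_col_mxr.
by rewrite -eA -eB sub_col_mxl sub_col_mxr.
Qed.

Lemma lag_rel_sub (C : numClosedFieldType) N n0 np nm k (f0 : 'M[C]_(n0, N)) (fp : 'M[C]_(np, N))
  (fm : 'M[C]_(nm, N))
    (Y : 'M[C]_(k, N)) (q : Prop) :
  [/\ f0 *m orthoproj Y = f0, fp *m orthoproj Y = fp, fm *m orthoproj Y = fm & q] <->
  (col_mx f0 (col_mx fp fm) <= Y)%MS /\ q.
Proof.
rewrite !col_mx_sub !sub_orthoproj; split=> [[-> -> -> h]|[/and3P[/eqP h1 /eqP h2 /eqP h3] h4]].
  by rewrite !eqxx.
by split.
Qed.

(** * The homotopy equivalence for complex Lagrangian subspaces *)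

Section LagrangianCosets.
Variables (R : realType) (V : vectType R) (omega : {skew_symmetric V}).
Variables n0 np nm : nat.
Local Notation n := (n0 + np + nm)%N.
Local Notation C := R[i].
Local Notation VC := (complexification V).
Local Notation d := (\dim {:V}).
Local Notation symp := (symp_space R n).
Variables (M : 'M[C]_(n + n, d)) (Psi : 'M[C]_(d, n + n)).
Hypothesis dar : darboux omega M Psi.
Local Notation coordsC := (coordsC Psi).
Local Notation spanC := (spanC M).
Local Notation LagC := (LagC omega n0 np nm).

Lemma idfun_continuous (S : Type) (F : set_system S) (FF : Filter F) (f : S -> C) (a : C) :
  f @ F --> a -> (fun x => idfun (f x) : C) @ F --> (idfun a : C).
Proof. by []. Qed.

Definition lag_rows (s : symp) : 'M[C]_(n, n + n) :=
  col_mx (col_mx (frame0 (val s)) (framep (val s))) (framem (val s)).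
Definition lag_subspace (s : symp) : {vspace VC} := spanC (lag_rows s).

Lemma lag_subspaceE s :
  (coordsC (lag_subspace s) :=: col_mx (frame0 (val s)) (col_mx (framep (val s)) (framem (val
    s))))%MS.
Proof. exact: eqmx_trans (coords_spanC dar _) (eqmx_col_mxA _ _ _). Qed.

Let forms (s : symp) := symp_frame_forms (symp_spaceP s).

Lemma lag_subspace_dim s : \dim (lag_subspace s) = n.
Proof. exact: (form_frames_dim dar (forms s) (lag_subspaceE s)). Qed.

Definition lag_gr (s : symp) : grassmannian VC n :=
  SigSub (mem_set (lag_subspace_dim s) : lag_subspace s \in [set W | \dim W = n]).

Lemma lag_grP s : complex_lagrangian omega n0 np nm (val (lag_gr s)) /\
  lagrangian_type omega n0 np nm (val (lag_gr s)).
Proof.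
split; first exact: (form_frames_lagrangian dar (forms s) (lag_subspaceE s)).
exact: (form_frames_type dar (forms s) (lag_subspaceE s)).
Qed.

Definition lag_proj (s : symp) : LagC :=
  SigSub (mem_set (lag_grP s) : lag_gr s \in [set F : grassmannian VC n |
    complex_lagrangian omega n0 np nm (val F) /\ lagrangian_type omega n0 np nm (val F)]).

Lemma LagC_inj (x y : LagC) : val (val x) = val (val y) -> x = y.
Proof. by move=> e; apply: val_inj; apply: val_inj. Qed.

Lemma lag_rows_continuous : continuous lag_rows.
Proof.
have cv : continuous (val : symp -> 'M[C]_(n, n + n)) by exact: continuous_val.
move=> s; have FF := nbhs_filter s.
exact: (cvg_col_mx (cvg_col_mx (cvg_frame0 FF (cv s)) (cvg_framep FF (cv s))) (cvg_framem FF (cv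
  s))).
Qed.

Lemma lag_gr_continuous : continuous lag_gr.
Proof.
apply: (@continuous_to_grassmannian R C idfun VC (n + n) (PsiC Psi) (PsiC_free dar) n symp
  (fun s => lag_rows s *m invC M) lag_gr).
  have cI : continuous (fun _ : symp => invC M : 'M[C]_(n + n, \dim {:VC})) by exact:
    cst_continuous.
  by move=> s; exact: (cvg_mulmx (@lag_rows_continuous s) (cI s)).
move=> s; have e : map_mx idfun (lag_rows s *m invC M) *m PsiC Psi = lag_rows s.
  by rewrite (map_mx_id (fun=> erefl)) -mulmxA (invCK dar) mulmx1.
by rewrite e; exact: (coords_spanC dar (lag_rows s)).
Qed.

Lemma lag_proj_continuous : continuous lag_proj.
Proof. by apply: continuous_set_type; exact: lag_gr_continuous. Qed.

Definition lag_orthoproj (x : LagC) : 'M[C]_(n + n) := orthoproj (coordsC (val (val x))).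

Lemma lag_orthoproj_continuous : continuous lag_orthoproj.
Proof.
have h1 : continuous (val : LagC -> grassmannian VC n) by exact: continuous_val.
have h2 := coords_proj_continuous (k := n) (PsiC_free dar) (@idfun_continuous).
by move=> x; have h3 := continuous_comp (h1 x) (h2 (val x)); exact: h3.
Qed.

(** In F only the kernel of kappa is canonical. Requiring [fp] and [fm] to be orthogonal for the
    Euclidean product too singles out the spectral decomposition of kappa. Containment in F is
    expressed by the projector to make the relation visibly closed. *)
Definition lag_rel (x : LagC) (f0 : 'M[C]_(n0, n + n)) (fp : 'M[C]_(np, n + n)) (fm : 'M[C]_(nm,
  n + n)) :=
  [/\ f0 *m lag_orthoproj x = f0, fp *m lag_orthoproj x = fp, fm *m lag_orthoproj x = fm &
      fp *m fm^t* = 0].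

Lemma lag_relP x (f0 : 'M[C]_(n0, n + n)) (fp : 'M[C]_(np, n + n)) (fm : 'M[C]_(nm, n + n)) :
  lag_rel x f0 fp fm <->
  (col_mx f0 (col_mx fp fm) <= coordsC (val (val x)))%MS /\ fp *m fm^t* = 0.
Proof.
rewrite /lag_rel /lag_orthoproj; move: (coordsC _) => Y; exact: lag_rel_sub.
Qed.

Lemma LagC_frames (x : LagC) :
  exists (f0 : 'M[C]_(n0, n + n)) (fp : 'M[C]_(np, n + n)) (fm : 'M[C]_(nm, n + n)),
  [/\ strictly_adapted f0 fp fm, fp *m fm^t* = 0 &
      (coordsC (val (val x)) :=: col_mx f0 (col_mx fp fm))%MS].
Proof.
have [lx tx] := set_mem (valP x); move: (val (val x)) lx tx => F lx tx.
have [f0 [fp [fm [sf q e _]]]] := lagrangian_frames dar lx tx.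
by exists f0, fp, fm; split; [exact: sf | exact: q | exact: e].
Qed.

Lemma homotopy_equivalent_LagC :
  homotopy_equivalent R LagC (unitary_coset_space R n0 np nm).
Proof.
have rkx (x : LagC) : \rank (coordsC (val (val x))) = n.
  by rewrite (rank_coordsC dar); have /set_mem := valP (val x).
have eqx (x : LagC) f0 fp fm : strictly_adapted f0 fp fm -> lag_rel x f0 fp fm ->
    (coordsC (val (val x)) :=: col_mx f0 (col_mx fp fm))%MS.
  move=> sf /lag_relP[s q]; have [dp [dm [ad rp rm]]] := sf.
  have [uE _ _ _] := adapted_sign_frame (rel := fun x y => x < y) ad q rp rm.
  by apply: (eqmx_unitary_rank uE s); rewrite rkx addnA.
apply: (@homotopy_equivalent_of_frames R n0 np nm LagC lag_proj lag_rel).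
- exact: lag_proj_continuous.
- move=> s s' [e0 ep em]; apply: LagC_inj; apply: (coordsC_inj dar).
  apply: eqmx_trans (lag_subspaceE s) (eqmx_trans _ (eqmx_sym (lag_subspaceE s'))).
  by apply: eqmx_col_mx_cong; [exact: e0 | apply: eqmx_col_mx_cong; [exact: ep | exact: em]].
- move=> Y x f0 fp fm cx c0 cp cm.
  have cP : continuous (fun y => lag_orthoproj (x y)).
    by move=> y; have h := continuous_comp (cx y) (@lag_orthoproj_continuous (x y)); exact: h.
  rewrite (_ : [set y | _] = [set y | f0 y *m lag_orthoproj (x y) = f0 y /\
    (fp y *m lag_orthoproj (x y) = fp y /\
      (fm y *m lag_orthoproj (x y) = fm y /\ fp y *m (fm y)^t* = 0))]); last first.
    by apply/seteqP; split=> y /=; [case | case=> ? [? [? ?]]].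
  apply: closed_and; first by apply: (closed_eqmx _ c0) => y; exact: (cvg_mulmx (c0 y) (cP y)).
  apply: closed_and; first by apply: (closed_eqmx _ cp) => y; exact: (cvg_mulmx (cp y) (cP y)).
  apply: closed_and; first by apply: (closed_eqmx _ cm) => y; exact: (cvg_mulmx (cm y) (cP y)).
  apply: closed_eqmx; first by move=> y; exact: (cvg_mulmx (cp y) (cvg_adjmx (cm y))).
  exact: cst_continuous.
- move=> x; have [f0 [fp [fm [sf q e]]]] := LagC_frames x.
  by exists f0, fp, fm; split; [exact: sf | apply/lag_relP; rewrite e].
- move=> x g0 gp gm wg /lag_relP[s q].
  have [f0 [fp [fm [sf q' e]]]] := LagC_frames x.
  by rewrite e in s; have [] := lag_frames_unique sf wg q' q s.
- move=> x f0 fp fm g0 gp gm sf rf sg /lag_relP[s q].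
  have /lag_relP[_ q'] := rf.
  rewrite (eqx _ _ _ _ sf rf) in s.
  by have [] := lag_frames_unique sf (strictly_weakly_adapted sg) q' q s.
- move=> x f0 fp fm s sf rf [e0 ep em]; apply: LagC_inj; apply: (coordsC_inj dar).
  apply: eqmx_trans (lag_subspaceE s) (eqmx_trans _ (eqmx_sym (eqx _ _ _ _ sf rf))).
  by apply: eqmx_col_mx_cong; [exact: e0 | apply: eqmx_col_mx_cong; [exact: ep | exact: em]].
- move=> f0 fp fm s sf q _ _ [e0 ep em]; apply/lag_relP; split=> //.
  have h : (coordsC (lag_subspace s) :=: col_mx f0 (col_mx fp fm))%MS.
    apply: eqmx_trans (lag_subspaceE s) _.
    by apply: eqmx_col_mx_cong; [exact: e0 | apply: eqmx_col_mx_cong; [exact: ep | exact: em]].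
  by have /eqmxP/andP[_ ->] := h.
Qed.

End LagrangianCosets.
(** * Split complex Lagrangian subspaces *)

Section SymplecticMaps.
Variables (R : realType) (V : vectType R) (omega : {skew_symmetric V}) (n : nat).
Local Notation C := R[i].
Local Notation VC := (complexification V).
Local Notation G := (std_form C n).
Local Notation T := (swap_mx C n).
Local Notation cj := (cj T).
Local Notation d := (\dim {:V}).
Local Notation b := (vbasis {:V}).
Local Notation rc := (real_complex R).
Local Notation symp := (symp_space R n).
Variables (M : 'M[C]_(n + n, d)) (Psi : 'M[C]_(d, n + n)).
Hypothesis dar : darboux omega M Psi.
Local Notation psi := (psi Psi).
Local Notation coordsC := (coordsC Psi).
Local Notation coordV := (coord_row rc Psi).

Let be : basis_of {:V} b := vbasisP _.

(* The matrix of g acting on complex Darboux coordinates. *)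
Definition sp_mx (g : 'End(V)) : 'M[C]_(n + n) := M *m map_mx rc (mxof b b g) *m Psi.

Lemma coordV_sp (g : 'End(V)) v : coordV (g v) = coordV v *m sp_mx g.
Proof.
case: dar => _ PM _ _; rewrite /coord_row /sp_mx (rVof_app b be) map_mxM.
by rewrite !mulmxA -(mulmxA _ Psi) PM mulmx1.
Qed.

Lemma psi_sp (g : 'End(V)) z : psi (linfun (cplx_map g) z) = psi z *m sp_mx g.
Proof. by rewrite lfunE /psi /= !coordV_sp mulmxDl scalemxAl. Qed.

Lemma coordsC_img (g : 'End(V)) (F : {vspace VC}) :
  (coordsC (linfun (cplx_map g) @: F)%VS :=: coordsC F *m sp_mx g)%MS.
Proof.
apply/eqmxP/andP; split; apply/rV_subP => x.
  rewrite -[x in (x <= coordsC _)%MS](psi_invK dar) -(mem_coordsC dar) => /memv_imgP[z zF].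
  move=> /(congr1 psi); rewrite (psi_invK dar) psi_sp => ->.
  by apply: submxMr; rewrite -(mem_coordsC dar).
move=> /submxP[c ->]; rewrite mulmxA -[c *m coordsC F](psi_invK dar) -psi_sp -(mem_coordsC dar).
by apply: memv_img; rewrite (mem_coordsC dar) (psi_invK dar) submxMl.
Qed.

Definition symp_mx (l : 'M[C]_(n, n + n)) : 'M[C]_(n + n) := col_mx l (cj l).

Lemma symp_mx_free l : symp_frame l -> row_free (symp_mx l).
Proof.
move=> sl; have gl := symp_frame_mx sl.
have h : symp_mx l *m (G *m (symp_mx l)^t* *m G) = 1%:M by rewrite !mulmxA gl std_form_invol.
by have /mulmx1_unit[h' _] := h; rewrite row_free_unit.
Qed.

(** Taking real parts loses nothing: [symp_mx l] commutes with conjugation, so its matrix in a basis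
    of V is real. *)
Definition sp_end (l : 'M[C]_(n, n + n)) : 'End(V) :=
  hommx b b (map_mx (@complex.Re R) (Psi *m symp_mx l *m M)).

Lemma mxbar_real_mx m p (A : 'M[C]_(m, p)) : mxbar A = A ->
  map_mx rc (map_mx (@complex.Re R) A) = A.
Proof.
move=> /matrixP h; apply/matrixP => i j; rewrite !mxE.
by have := h i j; rewrite mxE => /conjC_fixed.
Qed.

Lemma mxbar_Psi : mxbar Psi = Psi *m T.
Proof. by case: dar => _ _ cP _; rewrite -[in RHS]cP -mulmxA swap_mx_invol mulmx1. Qed.

Lemma mxbar_M : mxbar M = T *m M.
Proof.
case: dar => MP PM _ _.
have h : mxbar M *m mxbar Psi = 1%:M by rewrite -map_mxM MP map_mx1.
rewrite mxbar_Psi mulmxA in h.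
have := congr1 (fun z => z *m T *m M) h; rewrite mul1mx -[_ *m T *m T]mulmxA swap_mx_invol mulmx1.
by rewrite -mulmxA PM mulmx1.
Qed.

Lemma sp_mx_end l : sp_mx (sp_end l) = symp_mx l.
Proof.
case: dar => MP PM cP _; rewrite /sp_mx /sp_end hommxK //.
have bP := mxbar_Psi; have bM := mxbar_M.
have bL : mxbar (symp_mx l) = T *m symp_mx l *m T.
  have cjE m (x : 'M[C]_(m, n + n)) : mxbar x = cj x *m T.
    by rewrite -[cj x]/(mxbar x *m T) -mulmxA swap_mx_invol mulmx1.
  by rewrite cjE cj_col_mx (cjK (swap_mx_real C n) (swap_mx_invol C n)) -mul_swap_col.
have r : mxbar (Psi *m symp_mx l *m M) = Psi *m symp_mx l *m M.
  rewrite !map_mxM bP bM bL !mulmxA -(mulmxA _ T T) swap_mx_invol mulmx1.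
  by rewrite -(mulmxA _ T T) swap_mx_invol mulmx1.
by rewrite mxbar_real_mx // !mulmxA MP mul1mx -mulmxA MP mulmx1.
Qed.

Lemma sp_end_symplectic l : symp_frame l -> symplectic_map omega (sp_end l).
Proof.
move=> sl; have gl := symp_frame_mx sl.
have h v w : omega (sp_end l v) (sp_end l w) = omega v w.
  have := coordV_form dar (sp_end l v) (sp_end l w); rewrite !coordV_sp sp_mx_end.
  rewrite adjmxM !mulmxA -(mulmxA _ (symp_mx l)) -(mulmxA _ (symp_mx l *m G)) gl.
  rewrite (coordV_form dar) => /matrixP/(_ 0 0); rewrite !mxE eqxx !mulr1n.
  have i0 : (- 'i : C) != 0 by rewrite oppr_eq0 neq0Ci.
  by move=> /(mulfI i0) [].
split=> //; apply/eqP/lker0P => v w e.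
have e' : coordV v *m symp_mx l = coordV w *m symp_mx l by rewrite -!sp_mx_end -!coordV_sp e.
have e2 := row_free_inj (symp_mx_free sl) e'.
suff : psi (v, 0) = psi (w, 0) by move=> /(psi_inj dar) [].
exact: (congr1 (fun z => z + 'i *: coordV 0) e2).
Qed.

Definition sp_of (s : symp) : Sp omega :=
  SigSub (mem_set (sp_end_symplectic (symp_spaceP s)) :
    sp_end (val s) \in [set g : End_space V | symplectic_map omega (g : 'End(V))]).

Lemma sp_of_continuous : continuous sp_of.
Proof.
have cv : continuous (val : symp -> 'M[C]_(n, n + n)) by exact: continuous_val.
have cL : continuous (fun s : symp => symp_mx (val s)).
  have cT : continuous (fun _ : symp => T) by exact: cst_continuous.
  by move=> s; exact: (cvg_col_mx (cv s) (cvg_mulmx (cvg_mxbar (cv s)) (cT s))).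
have cA : continuous (fun s : symp => Psi *m symp_mx (val s) *m M).
  have cP : continuous (fun _ : symp => Psi) by exact: cst_continuous.
  have cM : continuous (fun _ : symp => M) by exact: cst_continuous.
  by move=> s; exact: (cvg_mulmx (cvg_mulmx (cP s) (cL s)) (cM s)).
have cR : continuous (fun s : symp => map_mx (@complex.Re R) (Psi *m symp_mx (val s) *m M)).
  apply: continuous_mx => i j; under eq_fun do rewrite mxE.
  by move=> s; exact: (cvgC_Re (continuous_coord cA (x := s))).
have cR' : continuous (fun t : symp => mxof b b (sp_end (val t))).
  rewrite (_ : (fun t => _) = fun t : symp => map_mx (@complex.Re R) (Psi *m symp_mx (val t) *m
    M)) //.
  by apply/funext => t; exact: hommxK.
apply: continuous_set_type => s.
have h := @cvg_initial _ _ (mxof b b) _ _ (nbhs_filter s) (fun t => sp_end (val t)) (sp_end (val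
  s)) (cR' s).
exact: h.
Qed.

Lemma sp_mx_continuous : continuous (fun g : Sp omega => sp_mx (val g)).
Proof.
have c1 : continuous (fun g : Sp omega => mxof b b (val g)).
  have h1 : continuous (val : Sp omega -> End_space V) by exact: continuous_val.
  have h2 : continuous (mxof b b : End_space V -> _) by exact: initial_continuous.
  by move=> g; have h3 := continuous_comp (h1 g) (h2 (val g)); exact: h3.
have c2 : continuous (fun g : Sp omega => map_mx rc (mxof b b (val g))).
  apply: continuous_mx => i j; under eq_fun do rewrite mxE.
  by move=> g; exact: (cvgC_R (continuous_coord c1 (x := g))).
have cP : continuous (fun _ : Sp omega => Psi) by exact: cst_continuous.
have cM : continuous (fun _ : Sp omega => M) by exact: cst_continuous.
by move=> g; exact: (cvg_mulmx (cvg_mulmx (cM g) (c2 g)) (cP g)).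
Qed.

Lemma coordsC_img_continuous F :
  continuous (fun g : Sp omega => orthoproj (coordsC (linfun (cplx_map (val g : 'End(V))) @:
    F)%VS)).
Proof.
have [B uB eB] := @unitary_basis _ _ (\dim F) _ (coordsC F) (rank_coordsC dar F).
have eg (g : Sp omega) : (coordsC (linfun (cplx_map (val g : 'End(V))) @: F)%VS :=: B *m sp_mx
  (val g))%MS.
  exact: eqmx_trans (coordsC_img _ F) (eqmxMr _ (eqmx_sym eB)).
have cB : continuous (fun g : Sp omega => B *m sp_mx (val g)).
  have c0 : continuous (fun _ : Sp omega => B) by exact: cst_continuous.
  by move=> g; exact: (cvg_mulmx (c0 g) (@sp_mx_continuous g)).
rewrite (_ : (fun g => _) = fun g : Sp omega => orthoproj (B *m sp_mx (val g))).
  apply: continuous_orthoproj cB _ => g.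
  rewrite /row_free -eg (rank_coordsC dar); apply/eqP; apply: (dim_cplx_map (omega := omega)).
  by have /set_mem := valP g.
by apply/funext => g; apply: eqmx_orthoproj; exact: eg.
Qed.

End SymplecticMaps.
Lemma leq_split_sum3 a b c p m : (a + b + c <= a + p + m)%N -> (p <= b)%N -> (m <= c)%N ->
  p = b /\ m = c.
Proof. by move=> *; split; lia. Qed.

Lemma addv_dup (K : fieldType) (U : vectType K) (W W1 W2 : {vspace U}) :
  (W + W1 + W2 = (W + W1) + (W + W2))%VS.
Proof. by rewrite -[RHS]addvA (addvA W1) (addvC W1) -(addvA _ W1) [RHS]addvA addvv addvA. Qed.

Section SplittingCosets.
Variables (R : realType) (V : vectType R) (omega : {skew_symmetric V}).
Variables n0 np nm : nat.
Local Notation n := (n0 + np + nm)%N.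
Local Notation C := R[i].
Local Notation VC := (complexification V).
Local Notation G := (std_form C n).
Local Notation cj := (cj (swap_mx C n)).
Local Notation d := (\dim {:V}).
Local Notation symp := (symp_space R n).
Variables (M : 'M[C]_(n + n, d)) (Psi : 'M[C]_(d, n + n)).
Hypothesis dar : darboux omega M Psi.
Local Notation psi := (psi Psi).
Local Notation coordsC := (coordsC Psi).
Local Notation spanC := (spanC M).
Local Notation splitting := (splitting omega n0 np nm).
Local Notation LagC_oplus := (LagC_oplus omega n0 np nm).

Let Gh := std_form_herm C n.

Definition plus_part (t : splitting) : {vspace VC} := (kappa_ker omega (val t).1.1 + (val
  t).1.2)%VS.
Definition minus_part (t : splitting) : {vspace VC} := (kappa_ker omega (val t).1.1 + (val t).2)%VS.

Lemma splittingP (t : splitting) : [/\ complex_lagrangian omega n0 np nm (val t).1.1,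
  lagrangian_type omega n0 np nm (val t).1.1 & splits omega (val t)].
Proof. by have /set_mem := valP t. Qed.

Lemma splitting_sum (t : splitting) : (val t).1.1 = (plus_part t + minus_part t)%VS.
Proof.
have [_ _] := splittingP t; rewrite /plus_part /minus_part.
case: (val t) => [[F Fp] Fm] /= [FE _ _ _ _]; rewrite {1}FE.
exact: addv_dup.
Qed.

(** The underlying Lagrangian is the sum of the two parts, so the two parts alone determine the
    equivalence class. *)
Lemma pi_eq (t t' : splitting) : plus_part t = plus_part t' -> minus_part t = minus_part t' ->
  \pi_LagC_oplus t = \pi_LagC_oplus t'.
Proof.
move=> ep em; apply/eqmodP; rewrite /= /splitting_eqv.
have eF : (val t).1.1 = (val t').1.1 by rewrite (splitting_sum t) (splitting_sum t') ep em.
move: ep em eF; rewrite /plus_part /minus_part.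
by case: (val t) => [[F Fp] Fm]; case: (val t') => [[F' Fp'] Fm'] /= -> -> ->; rewrite !eqxx.
Qed.

Lemma pi_eqP (t t' : splitting) : \pi_LagC_oplus t = \pi_LagC_oplus t' ->
  plus_part t = plus_part t' /\ minus_part t = minus_part t'.
Proof.
move=> /eqmodP; rewrite /= /splitting_eqv /plus_part /minus_part.
case: (val t) => [[F Fp] Fm]; case: (val t') => [[F' Fp'] Fm'] /=.
by move=> /and3P[_ /eqP -> /eqP ->].
Qed.

Definition plus_proj (x : LagC_oplus) : 'M[C]_(n + n) := orthoproj (coordsC (plus_part (repr x))).
Definition minus_proj (x : LagC_oplus) : 'M[C]_(n + n) := orthoproj (coordsC (minus_part (repr x))).

Lemma plus_proj_pi t : plus_proj (\pi_LagC_oplus t) = orthoproj (coordsC (plus_part t)).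
Proof. by rewrite /plus_proj; have [-> _] := pi_eqP (reprK (\pi_LagC_oplus t)). Qed.

Lemma minus_proj_pi t : minus_proj (\pi_LagC_oplus t) = orthoproj (coordsC (minus_part t)).
Proof. by rewrite /minus_proj; have [_ ->] := pi_eqP (reprK (\pi_LagC_oplus t)). Qed.

Lemma Sp_symplectic (g : Sp omega) : symplectic_map omega (val g : 'End(V)).
Proof. by have /set_mem := valP g. Qed.

Lemma plus_part_act (g : Sp omega) t :
  plus_part (Sp_act g t) = (linfun (cplx_map (val g : 'End(V))) @: plus_part t)%VS.
Proof. by rewrite /plus_part /= (kappa_ker_cplx_map (Sp_symplectic g)) limgD. Qed.

Lemma minus_part_act (g : Sp omega) t :
  minus_part (Sp_act g t) = (linfun (cplx_map (val g : 'End(V))) @: minus_part t)%VS.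
Proof. by rewrite /minus_part /= (kappa_ker_cplx_map (Sp_symplectic g)) limgD. Qed.

Lemma continuous_on_orbits (Y : topologicalType) (f : LagC_oplus -> Y) :
  (forall t, continuous (fun g : Sp omega => f (\pi_LagC_oplus (Sp_act g t)))) -> continuous f.
Proof.
move=> h; apply/continuousP => A oA.
have op : LagC_oplus_open (f @^-1` A) by move=> t; have /continuousP/(_ A oA) := h t.
exact: op.
Qed.

Lemma plus_proj_continuous : continuous plus_proj.
Proof.
apply: continuous_on_orbits => t.
rewrite (_ : (fun g => _) = fun g : Sp omega =>
  orthoproj (coordsC (linfun (cplx_map (val g : 'End(V))) @: plus_part t)%VS)).
  exact: (coordsC_img_continuous dar).
by apply/funext => g; rewrite plus_proj_pi plus_part_act.
Qed.

Lemma minus_proj_continuous : continuous minus_proj.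
Proof.
apply: continuous_on_orbits => t.
rewrite (_ : (fun g => _) = fun g : Sp omega =>
  orthoproj (coordsC (linfun (cplx_map (val g : 'End(V))) @: minus_part t)%VS)).
  exact: (coordsC_img_continuous dar).
by apply/funext => g; rewrite minus_proj_pi minus_part_act.
Qed.

Lemma coords_plus (F1 F2 : {vspace VC}) p q (A : 'M[C]_(p, n + n)) (B : 'M[C]_(q, n + n)) :
  (coordsC F1 :=: A)%MS -> (coordsC F2 :=: B)%MS -> (coordsC (F1 + F2)%VS :=: col_mx A B)%MS.
Proof. move=> eA eB; exact: eqmx_trans (coordsC_add dar _ _) (eqmx_col_mx_cong eA eB). Qed.

Section FrameSplitting.
Variables (f0 : 'M[C]_(n0, n + n)) (fp : 'M[C]_(np, n + n)) (fm : 'M[C]_(nm, n + n)).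
Variables (dp : 'rV[C]_np) (dm : 'rV[C]_nm) (F : {vspace VC}).
Hypothesis ff : form_frames f0 fp fm dp dm.
Hypothesis FE : (coordsC F :=: col_mx f0 (col_mx fp fm))%MS.

Lemma frames_split : splits omega (F, spanC fp, spanC fm).
Proof.
have [[_ _ rp rm] _ [gp gm gpm] _] := ff.
have k0 := form_frames_kappa_ker dar ff FE.
have ep := coords_spanC dar fp; have em := coords_spanC dar fm.
have sE : F = (kappa_ker omega F + spanC fp + spanC fm)%VS.
  apply: (coordsC_inj dar); apply: eqmx_trans (eqmx_trans FE (eqmx_sym (eqmx_col_mxA _ _ _))) _.
  exact: eqmx_sym (coords_plus (coords_plus k0 ep) em).
have mf z p (f : 'M[C]_(p, n + n)) : z \in spanC f -> (psi z <= f)%MS by rewrite (mem_spanC dar).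
split; first exact: sE.
(* Directness by counting: the three summands have dimensions at most n0, np and nm, which add up to
   the dimension of F. *)
- have dl k (A : 'M[C]_(k, n + n)) (W : {vspace VC}) : (coordsC W :=: A)%MS -> (\dim W <= k)%N.
    by move=> e; rewrite -(rank_coordsC dar) e rank_leq_row.
  rewrite directvEgeq /= -sE (form_frames_dim dar ff FE).
  exact: leq_add (leq_add (dl _ _ _ k0) (dl _ _ _ ep)) (dl _ _ _ em).
- move=> z w zp wm; apply/(kappa_eq0 dar); exact: sub_form0 gpm (mf _ _ _ zp) (mf _ _ _ wm).
- move=> z zp z0; have /submxP[c cE] := mf _ _ _ zp.
  have c0 : c != 0.
    apply: contraNneq z0 => c0; move: cE; rewrite c0 mul0mx => e.
    by apply/eqP/(psi_inj dar); rewrite e linear0.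
  have := diag_gram_pos gp rp c0; rewrite -cE (psi_kappa dar) mxE eqxx mulr1n //.
- move=> z zm z0; have /submxP[c cE] := mf _ _ _ zm.
  have c0 : c != 0.
    apply: contraNneq z0 => c0; move: cE; rewrite c0 mul0mx => e.
    by apply/eqP/(psi_inj dar); rewrite e linear0.
  have gm' : fm *m (- G) *m fm^t* = diag_mx (- dm) by rewrite mulmxN mulNmx gm linearN.
  have rm' i : 0 < (- dm) 0 i by rewrite mxE oppr_gt0.
  have := diag_gram_pos gm' rm' c0; rewrite -cE mulmxN mulNmx (psi_kappa dar) !mxE eqxx mulr1n //.
Qed.

End FrameSplitting.

Let forms (s : symp) := symp_frame_forms (symp_spaceP s).

Definition frame_splits (s : symp) : {vspace VC} * {vspace VC} * {vspace VC} :=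
  (lag_subspace M s, spanC (framep (val s)), spanC (framem (val s))).

Lemma frame_splitsP s : [/\ complex_lagrangian omega n0 np nm (frame_splits s).1.1,
  lagrangian_type omega n0 np nm (frame_splits s).1.1 & splits omega (frame_splits s)].
Proof.
have e := lag_subspaceE dar s; split.
- exact: (form_frames_lagrangian dar (forms s) e).
- exact: (form_frames_type dar (forms s) e).
- exact: (frames_split (forms s) e).
Qed.

Definition splitting_of (s : symp) : splitting :=
  SigSub (mem_set (frame_splitsP s) : frame_splits s \in [set s | [/\ complex_lagrangian omega n0
    np nm s.1.1,
    lagrangian_type omega n0 np nm s.1.1 & splits omega s]]).

Lemma plus_part_of s :
  (coordsC (plus_part (splitting_of s)) :=: col_mx (frame0 (val s)) (framep (val s)))%MS.
Proof.
apply: coords_plus; last exact: (coords_spanC dar (framep (val s))).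
exact: (form_frames_kappa_ker dar (forms s) (lag_subspaceE dar s)).
Qed.

Lemma minus_part_of s :
  (coordsC (minus_part (splitting_of s)) :=: col_mx (frame0 (val s)) (framem (val s)))%MS.
Proof.
apply: coords_plus; last exact: (coords_spanC dar (framem (val s))).
exact: (form_frames_kappa_ker dar (forms s) (lag_subspaceE dar s)).
Qed.

Definition oplus_proj (s : symp) : LagC_oplus := \pi_LagC_oplus (splitting_of s).

Lemma frames_mul_symp (l : 'M[C]_(n, n + n)) : let l1 := row_mx 1%:M 0 in
  [/\ frame0 l1 *m symp_mx l = frame0 l, framep l1 *m symp_mx l = framep l &
      framem l1 *m symp_mx l = framem l].
Proof.
have h m (a b : 'M[C]_(m, n)) : row_mx a b *m symp_mx l = a *m l + b *m cj l.
  by rewrite mul_row_col.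
have e : row_mx 1%:M 0 *m symp_mx l = l by rewrite h mul1mx mul0mx addr0.
have cm m (x : 'M[C]_(m, n + n)) : cj x *m symp_mx l = cj (x *m symp_mx l).
  rewrite -[x]hsubmxK cj_row_mx !h cjD (cjM _ _ l) (cjM _ _ (cj l)) (cjK (swap_mx_real C n)
    (swap_mx_invol C n)).
  by rewrite addrC.
move: (row_mx 1%:M 0 : 'M[C]_(n, n + n)) e => l1 e.
have uE : usubmx l1 *m symp_mx l = usubmx l by rewrite mul_usub_mx e.
have dE : dsubmx l1 *m symp_mx l = dsubmx l by rewrite mul_dsub_mx e.
have u0 : usubmx (usubmx l1) *m symp_mx l = usubmx (usubmx l) by rewrite mul_usub_mx uE.
have up : dsubmx (usubmx l1) *m symp_mx l = dsubmx (usubmx l) by rewrite mul_dsub_mx uE.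
by split; [rewrite /frame0 mulmxDl cm u0 | exact: up | rewrite /framem cm dE].
Qed.

Definition base_symp : symp := symp_of (row_mx 1%:M 0).

(** [LagC_oplus] has the final topology for the orbit maps. Writing the splitting of a frame as a
    translate of one base splitting therefore reduces continuity of the projection to continuity of
    [sp_of]. *)
Lemma splitting_ofE s : splitting_of s = Sp_act (sp_of dar s) (splitting_of base_symp).
Proof.
have [e0 ep em] := frames_mul_symp (val s).
have bE : val base_symp = row_mx 1%:M 0 := val_symp_of (@symp_frame1 R n).
have sE p (A : 'M[C]_(p, n + n)) (B : 'M[C]_(p, n + n)) : B *m symp_mx (val s) = A ->
    spanC A = (linfun (cplx_map (sp_end M Psi (val s))) @: spanC B)%VS.
  move=> e; apply: (coordsC_inj dar).
  apply: eqmx_trans (coords_spanC dar A) (eqmx_sym _).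
  apply: eqmx_trans (coordsC_img dar _ _) _; rewrite (sp_mx_end dar) -e.
  exact: eqmxMr (coords_spanC dar B).
apply: val_inj; congr ((_, _), _).
- by apply: sE; rewrite /lag_rows bE !mul_col_mx e0 ep em.
- by apply: sE; rewrite bE ep.
- by apply: sE; rewrite bE em.
Qed.

Lemma oplus_proj_continuous : continuous oplus_proj.
Proof.
apply/continuousP => A oA; have oA' : LagC_oplus_open A := oA.
have cs : continuous (sp_of dar) by exact: sp_of_continuous.
have /continuousP/(_ _ (oA' (splitting_of base_symp))) := cs.
rewrite (_ : oplus_proj @^-1` A = sp_of dar @^-1` [set g : Sp omega |
  A (\pi_LagC_oplus (Sp_act g (splitting_of base_symp)))]) //.
by apply/seteqP; split=> s; rewrite /= /oplus_proj (splitting_ofE s).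
Qed.

End SplittingCosets.

(** * Frames of the sum of the kernel and a definite subspace *)

Section DefiniteParts.
Variables (R : realType) (V : vectType R) (omega : {skew_symmetric V}).
Variables n0 np nm : nat.
Local Notation n := (n0 + np + nm)%N.
Local Notation C := R[i].
Local Notation VC := (complexification V).
Local Notation G := (std_form C n).
Local Notation d := (\dim {:V}).
Variables (M : 'M[C]_(n + n, d)) (Psi : 'M[C]_(d, n + n)).
Hypothesis dar : darboux omega M Psi.
Local Notation psi := (psi Psi).
Local Notation coordsC := (coordsC Psi).

Let Gh := std_form_herm C n.

Variable F : {vspace VC}.
Local Notation K := (kappa_ker omega F).

Lemma kappa_kerl k w : k \in K -> w \in F -> kappa omega k w = 0.
Proof. by rewrite memv_cap => /andP[_ /mem_orthovP h]; exact: h. Qed.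

Lemma kappa_kerr k w : k \in K -> w \in F -> kappa omega w k = 0.
Proof. by move=> kK wF; rewrite kappa_hermitian (kappa_kerl kK wF) conjC0 mulr0. Qed.

Lemma kappa_ker_sub : (K <= F)%VS.
Proof. exact: capvSl. Qed.

Lemma kappa_add_ker k q k' q' : k \in K -> q \in F -> k' \in K -> q' \in F ->
  kappa omega (k + q) (k' + q') = kappa omega q q'.
Proof.
move=> kK qF kK' qF'; have kF := subvP kappa_ker_sub _ kK'.
rewrite linearDl linearDr /= linearDr /= (kappa_kerl kK kF) (kappa_kerl kK qF') (kappa_kerr kK' qF).
by rewrite !add0r.
Qed.

(** A vector of K + Q orthogonal to all of K + Q is in particular orthogonal to its own component in
    Q, which must vanish because [Q] has no nonzero isotropic vector. So the kernel of kappa on K +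
    Q is exactly K, with basis [f0]. *)
Lemma definite_part (f0 : 'M[C]_(n0, n + n)) (Q : {vspace VC}) : (Q <= F)%VS ->
  f0 \is unitarymx -> (coordsC K :=: f0)%MS ->
  {in Q, forall z, z != 0 -> kappa omega z z != 0} ->
  exists (p m : nat) (Ep : 'M[C]_(p, n + n)) (Em : 'M[C]_(m, n + n)) (dp : 'rV[C]_p) (dm :
    'rV[C]_m),
  [/\ strict_sign_frame G f0 Ep Em dp dm, (col_mx f0 (col_mx Ep Em) :=: coordsC (K + Q)%VS)%MS &
      (n0 + (p + m))%N = \dim (K + Q)%VS].
Proof.
move=> QF u0 e0 def; set Y := coordsC (K + Q)%VS.
have rY : \rank Y = \dim (K + Q)%VS := rank_coordsC dar _.
have [B uB eB] := unitary_basis rY.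
have f0B : (f0 <= B)%MS by rewrite eB -e0 -(sub_coordsC dar) addvSl.
have f0G : f0 *m G *m B^t* = 0.
  have h : coordsC K *m G *m Y^t* = 0.
    apply: form_rows0 => x y; rewrite (sub_coordsC_row dar) (sub_coordsC_row dar) => xK yY.
    rewrite -(psi_invK dar x) -(psi_invK dar y); apply/(kappa_eq0 dar); apply: (kappa_kerl xK).
    by apply: (subvP _ _ yY); rewrite subv_add kappa_ker_sub QF.
  by apply: (sub_form0 h); [rewrite e0 | rewrite eB].
have kB (x : 'rV[C]_(n + n)) : (x <= B)%MS -> x *m G *m B^t* = 0 -> (x <= f0)%MS.
  rewrite eB (sub_coordsC_row dar) => /memv_addP[k kK [q qQ zE]] xG.
  have qF := subvP QF _ qQ.
  have qB : (psi q <= B)%MS by rewrite eB -(mem_coordsC dar); apply: (subvP (addvSr K Q)).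
  have : kappa omega (psi_inv M x) q = 0.
    by apply/(kappa_eq0 dar); rewrite (psi_invK dar); exact: sub_form0 xG (submx_refl _) qB.
  have e := kappa_add_ker kK qF (mem0v K) qF; rewrite add0r in e; rewrite zE e => qq.
  have q0 : q = 0 by apply/eqP; apply: contraT => /(def _ qQ); rewrite qq eqxx.
  by rewrite -e0 (sub_coordsC_row dar) zE q0 addr0.
have [p [m [Ep [Em [dp [dm [sf ef epm]]]]]]] := spectral_sign_frame_kernel Gh uB u0 f0B f0G kB.
exists p, m, Ep, Em, dp, dm; split; [exact: sf | exact: eqmx_trans ef eB | exact: epm].
Qed.

Lemma definite_part_sign (Q : {vspace VC}) (x : 'rV[C]_(n + n)) : (Q <= F)%VS ->
  (x <= coordsC (K + Q)%VS)%MS ->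
  exists2 q, q \in Q & (x *m G *m x^t*) 0 0 = kappa omega q q.
Proof.
move=> QF; rewrite (sub_coordsC_row dar) => /memv_addP[k kK [q qQ zE]]; exists q => //.
have qF := subvP QF _ qQ.
rewrite -[x in LHS](psi_invK dar) (psi_kappa dar) mxE eqxx mulr1n zE.
exact: kappa_add_ker.
Qed.

End DefiniteParts.

Lemma strict_sign_frame_nonneg (C : numClosedFieldType) N (G : 'M[C]_N) n0 p m (E0 : 'M[C]_(n0, N))
    (Ep : 'M[C]_(p, N)) (Em : 'M[C]_(m, N)) dp dm : G^t* = G ->
  strict_sign_frame G E0 Ep Em dp dm ->
  (forall x : 'rV[C]_N, (x <= Em)%MS -> 0 <= (x *m G *m x^t*) 0 0) -> m = 0%N.
Proof.
move=> Gh /(sign_frameP Gh)[_ _ _ [_ _ em] [_ rm]] h; case: m Em dm em rm h => // m Em dm em rm h.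
have := h (row 0 Em) (row_sub _ _); rewrite -form_entry em mxE eqxx mulr1n => h'.
by have := lt_le_trans (rm 0) h'; rewrite ltxx.
Qed.

Lemma strict_sign_frame_nonpos (C : numClosedFieldType) N (G : 'M[C]_N) n0 p m (E0 : 'M[C]_(n0, N))
    (Ep : 'M[C]_(p, N)) (Em : 'M[C]_(m, N)) dp dm : G^t* = G ->
  strict_sign_frame G E0 Ep Em dp dm ->
  (forall x : 'rV[C]_N, (x <= Ep)%MS -> (x *m G *m x^t*) 0 0 <= 0) -> p = 0%N.
Proof.
move=> Gh /(sign_frameP Gh)[_ _ _ [ep _ _] [rp _]] h; case: p Ep dp ep rp h => // p Ep dp ep rp h.
have := h (row 0 Ep) (row_sub _ _); rewrite -form_entry ep mxE eqxx mulr1n => h'.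
by have := lt_le_trans (rp 0) h'; rewrite ltxx.
Qed.
Lemma rank_eqmx_unitary (C : numClosedFieldType) m k N (Y : 'M[C]_(m, N)) (B : 'M[C]_(k, N)) :
  (Y :=: B)%MS -> B \is unitarymx -> \rank Y = k.
Proof. by move=> -> /unitary_row_free /eqP. Qed.

Lemma sub_eqmx (F : fieldType) m k l N (A : 'M[F]_(m, N)) (B : 'M[F]_(k, N)) (D : 'M[F]_(l, N)) :
  (B :=: D)%MS -> (A <= B)%MS -> (A <= D)%MS.
Proof. by move=> ->. Qed.

Lemma eqmx_sub (F : fieldType) k l N (B : 'M[F]_(k, N)) (D : 'M[F]_(l, N)) :
  (B :=: D)%MS -> (D <= B)%MS.
Proof. by move=> ->. Qed.

Lemma iff_and (A A' B B' : Prop) : (A <-> A') -> (B <-> B') -> (A /\ B <-> A' /\ B').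
Proof. by move=> [h1 h2] [h3 h4]; split=> -[a b]; split; auto. Qed.

Lemma leq_sum_cap a b c k p m : (a + b + c + k = (a + p) + (a + m))%N -> (a <= k)%N ->
  (a + b + c <= a + p + m)%N.
Proof. lia. Qed.

Lemma oplus_rel_sub (C : numClosedFieldType) N n0 np k (f0 : 'M[C]_(n0, N)) (fp : 'M[C]_(np, N))
  (Y : 'M[C]_(k, N)) :
  (f0 *m orthoproj Y = f0 /\ fp *m orthoproj Y = fp) <-> (col_mx f0 fp <= Y)%MS.
Proof.
rewrite !col_mx_sub !sub_orthoproj; split=> [[-> ->]|/andP[/eqP h1 /eqP h2]]; by rewrite ?eqxx.
Qed.

Lemma eqmx_col_mx0l (C : numClosedFieldType) m p N (A : 'M[C]_(m, N)) (B : 'M[C]_(p, N)) (D :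
  'M[C]_(0, N)) :
  (col_mx A (col_mx D B) :=: col_mx A B)%MS.
Proof.
have D0 : D = 0 by exact: flatmx0.
by apply/eqmxP; rewrite D0 !col_mx_sub sub0mx sub_col_mxl sub_col_mxr sub_col_mxl /=;
  apply: submx_trans (sub_col_mxr _ _) (sub_col_mxr _ _).
Qed.

Lemma eqmx_col_mx0r (C : numClosedFieldType) m p N (A : 'M[C]_(m, N)) (B : 'M[C]_(p, N)) (D :
  'M[C]_(0, N)) :
  (col_mx A (col_mx B D) :=: col_mx A B)%MS.
Proof.
have D0 : D = 0 by exact: flatmx0.
apply/eqmxP; rewrite D0 !col_mx_sub sub0mx sub_col_mxl sub_col_mxr sub_col_mxl /=.
by apply: submx_trans (sub_col_mxl _ _) (sub_col_mxr _ _).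
Qed.

(** * The homotopy equivalence for splittings *)

Section SplittingHomotopy.
Variables (R : realType) (V : vectType R) (omega : {skew_symmetric V}).
Variables n0 np nm : nat.
Local Notation n := (n0 + np + nm)%N.
Local Notation C := R[i].
Local Notation G := (std_form C n).
Local Notation d := (\dim {:V}).
Variables (M : 'M[C]_(n + n, d)) (Psi : 'M[C]_(d, n + n)).
Hypothesis dar : darboux omega M Psi.
Local Notation coordsC := (coordsC Psi).
Local Notation splitting := (splitting omega n0 np nm).
Local Notation LagC_oplus := (LagC_oplus omega n0 np nm).

Let Gh := std_form_herm C n.

(** The two parts are diagonalized separately over the same real basis [f0] of the kernel. Kappa is
    nonnegative on the first and nonpositive on the second, so one sign block of each is empty.
    Inertia bounds the two remaining blocks by np and nm, and the dimension of F forces equality. *)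
Lemma split_frames F Fp Fm : complex_lagrangian omega n0 np nm F ->
  lagrangian_type omega n0 np nm F -> splits omega (F, Fp, Fm) ->
  exists (f0 : 'M[C]_(n0, n + n)) (fp : 'M[C]_(np, n + n)) (fm : 'M[C]_(nm, n + n)),
  [/\ strictly_adapted f0 fp fm, (coordsC (kappa_ker omega F + Fp)%VS :=: col_mx f0 fp)%MS &
      (coordsC (kappa_ker omega F + Fm)%VS :=: col_mx f0 fm)%MS].
Proof.
move=> lF tF [FE _ pm pp mm]; set K := kappa_ker omega F in FE *.
have [f0 [fp0 [fm0 [sf0 _ _ e0]]]] := lagrangian_frames dar lF tF; rewrite -/K in e0.
have [dp0 [dm0 [[[u0 _ _] [c0 _ _] _ _ _] _ _]]] := sf0.
have uf0 : f0 \is unitarymx by apply/unitarymxP.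
have [dF /(coords_isotropic dar) iso] := lF; have [d0 _] := tF.
have KF : (K <= F)%VS := kappa_ker_sub omega F.
have pF : (Fp <= F)%VS by rewrite FE; apply: subv_trans (addvSr K Fp) (addvSl _ _).
have mF : (Fm <= F)%VS by rewrite FE addvSr.
have KpF : (K + Fp <= F)%VS by rewrite subv_add KF pF.
have KmF : (K + Fm <= F)%VS by rewrite subv_add KF mF.
have ndp : {in Fp, forall z, z != 0 -> kappa omega z z != 0}.
  by move=> z zp z0; rewrite gt_eqF //; exact: pp.
have ndm : {in Fm, forall z, z != 0 -> kappa omega z z != 0}.
  by move=> z zm z0; rewrite lt_eqF // -oppr_gt0; exact: mm.
have [p1 [m1 [Ep [Em1 [dp [dm1 [sf1 ef1 e1]]]]]]] := definite_part dar pF uf0 e0 ndp.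
have [p2 [m2 [Ep2 [Em [dp2 [dm [sf2 ef2 e2]]]]]]] := definite_part dar mF uf0 e0 ndm.
have s1 : (Ep <= coordsC (K + Fp)%VS)%MS.
  by rewrite -ef1; apply: submx_trans (sub_col_mxl _ _) (sub_col_mxr _ _).
have s1' : (Em1 <= coordsC (K + Fp)%VS)%MS.
  by rewrite -ef1; apply: submx_trans (sub_col_mxr _ _) (sub_col_mxr _ _).
have s2 : (Em <= coordsC (K + Fm)%VS)%MS.
  by rewrite -ef2; apply: submx_trans (sub_col_mxr _ _) (sub_col_mxr _ _).
have s2' : (Ep2 <= coordsC (K + Fm)%VS)%MS.
  by rewrite -ef2; apply: submx_trans (sub_col_mxl _ _) (sub_col_mxr _ _).
have m10 : m1 = 0%N.
  apply: (strict_sign_frame_nonneg Gh sf1) => x xE.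
  have [q qQ ->] := definite_part_sign dar pF (submx_trans xE s1').
  by have [->|q0] := eqVneq q 0; [rewrite linear0l | rewrite ltW //; exact: pp].
have p20 : p2 = 0%N.
  apply: (strict_sign_frame_nonpos Gh sf2) => x xE.
  have [q qQ ->] := definite_part_sign dar mF (submx_trans xE s2').
  by have [->|q0] := eqVneq q 0; [rewrite linear0l | rewrite ltW // -oppr_gt0; exact: mm].
subst m1 p2; rewrite add0n in e2; rewrite addn0 in e1.
have /(sign_frameP Gh)[[_ up _] [q0p _ _] [g0 g0p _] [gp _ _] [rp _]] := sf1.
have /(sign_frameP Gh)[[_ _ um] [_ q0m _] [_ _ g0m] [_ _ gm] [_ rm]] := sf2.
have EpF : (Ep <= coordsC F)%MS by apply: submx_trans s1 _; rewrite -(sub_coordsC dar).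
have EmF : (Em <= coordsC F)%MS by apply: submx_trans s2 _; rewrite -(sub_coordsC dar).
have pn : (p1 <= np)%N.
  by have [h _] := lagrangian_type_inertia dar tF EpF; apply: h; exact: (diag_gram_pos gp rp).
have mn : (m2 <= nm)%N.
  have [_ h] := lagrangian_type_inertia dar tF EmF; apply: h.
  apply: (@diag_gram_pos _ _ _ _ _ (- dm)); first by rewrite mulmxN mulNmx gm linearN.
  by move=> i; rewrite mxE oppr_gt0.
have dsum : (n0 + np + nm <= n0 + p1 + m2)%N.
  have FE' : F = ((K + Fp) + (K + Fm))%VS.
    by rewrite {1}FE; exact: addv_dup.
  have dI : (n0 <= \dim ((K + Fp) :&: (K + Fm)))%N by rewrite -d0 dimvS // subv_cap !addvSl.
  have := dimv_sum_cap (K + Fp)%VS (K + Fm)%VS; rewrite -FE' dF -e1 -e2 => h.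
  by move: h dI; exact: leq_sum_cap.
have [pE mE] := leq_split_sum3 dsum pn mn.
subst p1 m2; exists f0, Ep, Em; split.
- exists dp, dm; split; [split | exact: rp | exact: rm].
  + by split; apply/unitarymxP.
  + by split; [exact: c0 | exact: q0p | exact: q0m].
  + by split; [exact: g0 | exact: g0p | exact: g0m].
  + split; [exact: gp | exact: gm |].
    have h : coordsC (K + Fp)%VS *m G *m (coordsC (K + Fm)%VS)^t* = 0.
      apply: form_rows0 => x y; rewrite (sub_coordsC_row dar) (sub_coordsC_row dar).
      move=> /memv_addP[k kK [q qp xE]] /memv_addP[k' kK' [q' qm yE]].
      rewrite -(psi_invK dar x) -(psi_invK dar y); apply/(kappa_eq0 dar); rewrite xE yE.
      rewrite (kappa_add_ker kK (subvP pF _ qp) kK' (subvP mF _ qm)); exact: pm.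
    exact: sub_form0 h s1 s2.
  + by split; apply: (sub_form0 iso) => //; apply: cjS.
- exact: eqmx_trans (eqmx_sym ef1) (eqmx_col_mx0r _ _ _).
- exact: eqmx_trans (eqmx_sym ef2) (eqmx_col_mx0l _ _ _).
Qed.

Lemma splitting_frames (t : splitting) :
  exists (f0 : 'M[C]_(n0, n + n)) (fp : 'M[C]_(np, n + n)) (fm : 'M[C]_(nm, n + n)),
  [/\ strictly_adapted f0 fp fm, (coordsC (plus_part t) :=: col_mx f0 fp)%MS &
      (coordsC (minus_part t) :=: col_mx f0 fm)%MS].
Proof.
have [l0 t0 s0] := splittingP t; rewrite /plus_part /minus_part.
case: (val t) l0 t0 s0 => [[F Fp] Fm] l0 t0 s0; exact: split_frames l0 t0 s0.
Qed.

Definition oplus_rel (x : LagC_oplus) (f0 : 'M[C]_(n0, n + n)) (fp : 'M[C]_(np, n + n)) (fm :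
  'M[C]_(nm, n + n)) :=
  (f0 *m plus_proj Psi x = f0 /\ fp *m plus_proj Psi x = fp) /\
  (f0 *m minus_proj Psi x = f0 /\ fm *m minus_proj Psi x = fm).

Lemma oplus_relP (t : splitting) (f0 : 'M[C]_(n0, n + n)) (fp : 'M[C]_(np, n + n)) (fm :
  'M[C]_(nm, n + n)) :
  oplus_rel (\pi_LagC_oplus t) f0 fp fm <->
  (col_mx f0 fp <= coordsC (plus_part t))%MS /\ (col_mx f0 fm <= coordsC (minus_part t))%MS.
Proof.
rewrite /oplus_rel (plus_proj_pi Psi t) (minus_proj_pi Psi t).
exact: iff_and (oplus_rel_sub f0 fp (coordsC (plus_part t))) (oplus_rel_sub f0 fm (coordsC
  (minus_part t))).
Qed.

Lemma LagC_oplus_ind (P : LagC_oplus -> Prop) : (forall t, P (\pi_LagC_oplus t)) -> forall x, P x.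
Proof. by move=> h x; have := h (repr x); rewrite reprK. Qed.

Lemma homotopy_equivalent_LagC_oplus :
  homotopy_equivalent R LagC_oplus (unitary_coset_space R n0 np nm).
Proof.
have rank_parts (t : splitting) : \rank (coordsC (plus_part t)) = (n0 + np)%N /\
    \rank (coordsC (minus_part t)) = (n0 + nm)%N.
  have [f0 [fp [fm [[dp [dm [ad rp rm]]] e1 e2]]]] := splitting_frames t.
  have [[u0 up um] [_ q0p q0m] _ _ _] := ad.
  have u1 : col_mx f0 fp \is unitarymx by apply/col_mx_unitaryP; split=> //; apply/unitarymxP.
  have u2 : col_mx f0 fm \is unitarymx by apply/col_mx_unitaryP; split=> //; apply/unitarymxP.
  by split; [exact: rank_eqmx_unitary e1 u1 | exact: rank_eqmx_unitary e2 u2].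
have eqx (t : splitting) f0 fp fm : strictly_adapted f0 fp fm ->
  oplus_rel (\pi_LagC_oplus t) f0 fp fm ->
    (coordsC (plus_part t) :=: col_mx f0 fp)%MS /\ (coordsC (minus_part t) :=: col_mx f0 fm)%MS.
  move=> [dp [dm [ad rp rm]]] /oplus_relP[s1 s2]; have [r1 r2] := rank_parts t.
  have [[u0 up um] [_ q0p q0m] _ _ _] := ad.
  have u1 : col_mx f0 fp \is unitarymx by apply/col_mx_unitaryP; split=> //; apply/unitarymxP.
  have u2 : col_mx f0 fm \is unitarymx by apply/col_mx_unitaryP; split=> //; apply/unitarymxP.
  by split; [exact: eqmx_unitary_rank u1 s1 r1 | exact: eqmx_unitary_rank u2 s2 r2].
apply: (@homotopy_equivalent_of_frames R n0 np nm LagC_oplus (oplus_proj dar) oplus_rel).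
- exact: oplus_proj_continuous.
- move=> s s' [e0 ep em]; apply: pi_eq; apply: (coordsC_inj dar).
    apply: eqmx_trans (plus_part_of dar s) (eqmx_trans (eqmx_col_mx_cong e0 ep) (eqmx_sym
      (plus_part_of dar s'))).
  apply: eqmx_trans (minus_part_of dar s) (eqmx_trans (eqmx_col_mx_cong e0 em) (eqmx_sym
    (minus_part_of dar s'))).
- move=> Y x f0 fp fm cx c0 cp cm.
  have c1 : continuous (plus_proj Psi : LagC_oplus -> _) := plus_proj_continuous dar.
  have c2 : continuous (minus_proj Psi : LagC_oplus -> _) := minus_proj_continuous dar.
  have cP : continuous (fun y => plus_proj Psi (x y)).
    by move=> y; have h := continuous_comp (cx y) (c1 (x y)); exact: h.
  have cQ : continuous (fun y => minus_proj Psi (x y)).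
    by move=> y; have h := continuous_comp (cx y) (c2 (x y)); exact: h.
  apply: closed_and; apply: closed_and.
  + by apply: (closed_eqmx _ c0) => y; exact: (cvg_mulmx (c0 y) (cP y)).
  + by apply: (closed_eqmx _ cp) => y; exact: (cvg_mulmx (cp y) (cP y)).
  + by apply: (closed_eqmx _ c0) => y; exact: (cvg_mulmx (c0 y) (cQ y)).
  + by apply: (closed_eqmx _ cm) => y; exact: (cvg_mulmx (cm y) (cQ y)).
- apply: LagC_oplus_ind => t; have [f0 [fp [fm [sf e1 e2]]]] := splitting_frames t.
  by exists f0, fp, fm; split; [exact: sf | apply/oplus_relP; split;
    [exact: eqmx_sub e1 | exact: eqmx_sub e2]].
- apply: LagC_oplus_ind => t g0 gp gm wg /oplus_relP[s1 s2].
  have [f0 [fp [fm [sf e1 e2]]]] := splitting_frames t.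
  by have [h _ _ _] := oplus_frames_unique sf wg (sub_eqmx e1 s1) (sub_eqmx e2 s2).
- apply: LagC_oplus_ind => t f0 fp fm g0 gp gm sf rf sg /oplus_relP[s1 s2].
  have [e1 e2] := eqx _ _ _ _ sf rf; 
  by have [_ h1 h2 h3] := oplus_frames_unique sf (strictly_weakly_adapted sg) (sub_eqmx e1 s1)
    (sub_eqmx e2 s2).
- apply: LagC_oplus_ind => t f0 fp fm s sf rf [e0 ep em].
  have [e1 e2] := eqx _ _ _ _ sf rf; apply: pi_eq; apply: (coordsC_inj dar).
    exact: eqmx_trans (plus_part_of dar s) (eqmx_trans (eqmx_col_mx_cong e0 ep) (eqmx_sym e1)).
  exact: eqmx_trans (minus_part_of dar s) (eqmx_trans (eqmx_col_mx_cong e0 em) (eqmx_sym e2)).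
- move=> f0 fp fm s sf _ _ _ [e0 ep em]; apply/oplus_relP.
  have h1 := eqmx_trans (plus_part_of dar s) (eqmx_col_mx_cong e0 ep).
  have h2 := eqmx_trans (minus_part_of dar s) (eqmx_col_mx_cong e0 em).
  by split; [exact: eqmx_sub h1 | exact: eqmx_sub h2].
Qed.

End SplittingHomotopy.
(** * Real subspaces *)

Section RealSubspaceMatrices.
Variables (C : numClosedFieldType) (n : nat).
Local Notation G := (std_form C n).
Local Notation cj := (cj (swap_mx C n)).

Let Gh := std_form_herm C n.
Let cK := cjK (swap_mx_real C n) (swap_mx_invol C n).

Section Pair.
Variables (k p : nat) (f0 : 'M[C]_(k, n + n)) (f : 'M[C]_(p, n + n)).
Hypotheses (r0 : row_free f0) (c0 : cj f0 = f0) (g0f : f0 *m G *m f^t* = 0).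
Hypotheses (gff : f *m G *m f^t* = 1%:M) (gfc : f *m G *m (cj f)^t* = 0).
Local Notation E := (col_mx f0 (col_mx f (cj f))).

Let g0c : f0 *m G *m (cj f)^t* = 0.
Proof. by rewrite -c0; exact: cj_std_form0. Qed.

(** Pairing a combination of rows with [f] and [cj f] reads off its coefficients up to sign, because
    [f0] is orthogonal to both and [f] is orthogonal to [cj f]. *)
Lemma pair_kernel (c : 'rV[C]_(k + (p + p))) : c *m E *m G *m f^t* = 0 ->
  c *m E *m G *m (cj f)^t* = 0 -> c *m E = lsubmx c *m f0 /\ rsubmx c = 0.
Proof.
have gcc : cj f *m G *m (cj f)^t* = - 1%:M by rewrite cj_std_form gff map_mx1.
have gcf := form_adj0 Gh gfc.
have E1 : c *m E = lsubmx c *m f0 + (lsubmx (rsubmx c) *m f + rsubmx (rsubmx c) *m cj f).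
  by rewrite -{1}[c]hsubmxK -{1}[rsubmx c]hsubmxK !mul_row_col.
have m q (x : 'rV[C]_q) (A : 'M[C]_(q, n + n)) (B : 'M[C]_(p, n + n)) :
  x *m A *m G *m B^t* = x *m (A *m G *m B^t*) by rewrite !mulmxA.
rewrite E1 !mulmxDl !m g0f gff gcf g0c gfc gcc !mulmx0 !add0r addr0 mulmx1 mulmxN mulmx1.
move=> a0 /eqP; rewrite oppr_eq0 => /eqP b0.
rewrite a0 b0 !mul0mx !addr0; split=> //.
by rewrite -[rsubmx c]hsubmxK a0 b0 row_mx0.
Qed.

Lemma pair_free : row_free E.
Proof.
rewrite -kermx_eq0; apply/rowV0P => x /sub_kermxP xE.
have h B : x *m E *m G *m B = 0 :> 'rV[C]_p by rewrite xE !mul0mx.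
have [e r] := pair_kernel (h _) (h _); rewrite xE in e.
have l0 : lsubmx x = 0 by apply: (row_free_inj r0); rewrite -e mul0mx.
by rewrite -[x]hsubmxK l0 r row_mx0.
Qed.

Lemma pair_sub_kernel (x : 'rV[C]_(n + n)) : (x <= E)%MS -> x *m G *m E^t* = 0 -> (x <= f0)%MS.
Proof.
move=> /submxP[c ->] h.
have s (B : 'M[C]_(p, n + n)) : (B <= E)%MS -> c *m E *m G *m B^t* = 0.
  exact: sub_form0 h (submx_refl _).
have [-> _] := pair_kernel (s _ (submx_trans (sub_col_mxl _ _) (sub_col_mxr _ _)))
  (s _ (submx_trans (sub_col_mxr _ _) (sub_col_mxr _ _))).
exact: submxMl.
Qed.

(** Twice the real part of [f] and, up to sign, twice its imaginary part. These rows are fixed by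
    conjugation, so they are coordinates of vectors of V. *)
Definition real_rows : 'M[C]_(k + (p + p), n + n) := col_mx f0 (col_mx (f + cj f) ('i *: (f - cj
  f))).

Lemma real_rows_cj : cj real_rows = real_rows.
Proof.
rewrite /real_rows !cj_col_mx c0 cjD cK cjZ conjCi cjB cK scaleNr -scalerN opprB.
by rewrite [cj f + f]addrC.
Qed.

Lemma real_rows_eqmx : (real_rows :=: E)%MS.
Proof.
apply: eqmx_col_mx_cong => //; apply/eqmxP/andP; split; rewrite col_mx_sub; apply/andP; split.
- by apply: addmx_sub; [exact: sub_col_mxl | exact: sub_col_mxr].
- by apply: scalemx_sub; apply: addmx_sub; [exact: sub_col_mxl | rewrite eqmx_opp;
  exact: sub_col_mxr].
- have e : f = 2^-1 *: ((f + cj f) + (- 'i) *: ('i *: (f - cj f))).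
    rewrite scalerA mulNr -expr2 sqrCi opprK scale1r addrACA subrr addr0.
    by rewrite scalerDr -scalerDl -[2^-1]mul1r -splitr scale1r.
  rewrite [X in (X <= _)%MS]e; apply: scalemx_sub; apply: addmx_sub; first exact: sub_col_mxl.
  by apply: scalemx_sub; exact: sub_col_mxr.
- have e : cj f = 2^-1 *: ((f + cj f) + 'i *: ('i *: (f - cj f))).
    rewrite scalerA -expr2 sqrCi scaleN1r opprB addrC addrA subrK.
    by rewrite scalerDr -scalerDl -[2^-1]mul1r -splitr scale1r.
  rewrite [X in (X <= _)%MS]e; apply: scalemx_sub; apply: addmx_sub; first exact: sub_col_mxl.
  by apply: scalemx_sub; exact: sub_col_mxr.
Qed.

End Pair.

(** [Y] and its projector each factor through the other. This expresses orthogonality to a moving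
    subspace by its continuous projector. *)
Lemma mul_orthoproj_eq0 m p (x : 'M[C]_(m, n + n)) (Y : 'M[C]_(p, n + n)) :
  (x *m orthoproj Y = 0) <-> (x *m Y^t* = 0).
Proof.
have [Ph PP] := orthoprojP Y; split=> h.
  have YP : Y *m orthoproj Y = Y by apply/eqP; rewrite -sub_orthoproj.
  by rewrite -YP adjmxM Ph mulmxA h mul0mx.
have /submxP[D PE] : (orthoproj Y <= Y)%MS by rewrite sub_orthoproj PP.
by rewrite -Ph PE adjmxM mulmxA h mul0mx.
Qed.

End RealSubspaceMatrices.
Lemma cvg_castmx (R : realType) (X : topologicalType) m m' k (e : m = m') (f : X -> 'M[R]_(m, k)) :
  continuous f -> continuous (fun x => castmx (e, erefl k) (f x)).
Proof.
by case: m' / e => cf; rewrite (_ : (fun x => _) = f).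
Qed.

Lemma map_castmx_mul (K : numFieldType) (F : fieldType) (iota : {rmorphism K ->
  F}) m m' k N (e : m = m')
    (A : 'M[K]_(m, k)) (Psi : 'M[F]_(k, N)) :
  (map_mx iota (castmx (e, erefl k) A) *m Psi :=: map_mx iota A *m Psi)%MS.
Proof. by case: m' / e; rewrite castmx_id. Qed.

Lemma double_add_rank a b c : (a + (c + c) + (a + (b + b)) = (a + b + c) + (a + b + c))%N.
Proof. lia. Qed.

Lemma double_add_rank2 a b c : (a + b.*2 + (a + c.*2) = (a + b + c) + (a + b + c))%N.
Proof. by rewrite -!addnn; lia. Qed.

Lemma addn_double_inj a p b : (a + (p + p) = a + b.*2)%N -> p = b.
Proof. by rewrite -addnn; lia. Qed.

Section RealCoordinates.
Variables (R : realType) (V : vectType R) (omega : {skew_symmetric V}) (n : nat).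
Local Notation C := R[i].
Local Notation G := (std_form C n).
Local Notation T := (swap_mx C n).
Local Notation cj := (cj T).
Local Notation d := (\dim {:V}).
Local Notation b := (vbasis {:V}).
Local Notation rc := (real_complex R).
Variables (M : 'M[C]_(n + n, d)) (Psi : 'M[C]_(d, n + n)).
Hypothesis dar : darboux omega M Psi.
Local Notation coordV := (coord_row rc Psi).

Let be : basis_of {:V} b := vbasisP _.

Definition coordsR (W : {vspace V}) : 'M[C]_(d, n + n) := coords rc Psi W.

Lemma Psi_free : row_free Psi.
Proof. by case: dar => _ PM _ _; apply/row_freeP; exists M. Qed.

Lemma mem_coordsR v (W : {vspace V}) : (v \in W) = (coordV v <= coordsR W)%MS.
Proof. exact: (mem_coords rc Psi_free v W). Qed.

Lemma sub_coordsR W W' : (W <= W')%VS = (coordsR W <= coordsR W')%MS.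
Proof. exact: (sub_coords rc Psi_free W W'). Qed.

Lemma coordsR_inj W W' : (coordsR W :=: coordsR W')%MS -> W = W'.
Proof. exact: (coords_inj Psi_free). Qed.

Lemma rank_coordsR W : \rank (coordsR W) = \dim W.
Proof. exact: (rank_coords rc Psi_free W). Qed.

Lemma cj_real_mul m (A : 'M[R]_(m, d)) : cj (map_mx rc A *m Psi) = map_mx rc A *m Psi.
Proof. by case: dar => _ _ cP _; rewrite cjM mxbar_real cP. Qed.

Lemma cj_coordsR W : cj (coordsR W) = coordsR W.
Proof. exact: cj_real_mul. Qed.

Definition real_coef m (E : 'M[C]_(m, n + n)) : 'M[R]_(m, d) := map_mx (@complex.Re R) (E *m M).

Lemma real_coefK m (E : 'M[C]_(m, n + n)) : cj E = E -> map_mx rc (real_coef E) *m Psi = E.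
Proof.
move=> cE; have r : mxbar (E *m M) = E *m M.
  by rewrite map_mxM (mxbar_M dar) mulmxA -[in RHS]cE.
by case: dar => MP _ _ _; rewrite /real_coef (mxbar_real_mx r) -mulmxA MP mulmx1.
Qed.

(** A row space stable under conjugation has a basis of real rows, so inclusions can be tested on
    vectors of V. *)
Lemma real_sub m p (Z : 'M[C]_(m, n + n)) (Y : 'M[C]_(p, n + n)) : (cj Z <= Z)%MS ->
  (forall v, (coordV v <= Z)%MS -> (coordV v <= Y)%MS) -> (Z <= Y)%MS.
Proof.
move=> cZ h; have [B [_ cB eB]] := real_unitary_basis cZ (erefl _).
rewrite -eB; apply/row_subP => i.
have e : row i B = coordV (vecof b (row i (real_coef B))).
  by rewrite /coord_row vecofK // map_row -row_mul (real_coefK cB).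
by rewrite e; apply: h; rewrite -e; apply: submx_trans (row_sub i B) _;
  exact: (eqmx_sub (eqmx_sym eB)).
Qed.

(** On real vectors the Hermitian form is -i times omega, so the two notions of orthogonality agree
    there; the complement for the form is stable under conjugation, and [real_sub] reduces to real
    vectors. *)
Lemma coords_orthov W : (coordsR (orthov omega W) :=: kermx (G *m (coordsR W)^t*))%MS.
Proof.
have rowE (U : {vspace V}) i : exists2 v, v \in U & row i (coordsR U) = coordV v.
  exists (vecof b (row i (msof b U))); first by rewrite mem_vecof // row_sub.
  by rewrite /coord_row vecofK // map_row -row_mul.
apply/eqmxP/andP; split.
  rewrite sub_form_kernel; apply/eqP/matrixP => i j; rewrite form_entry.
  have [v vW ->] := rowE (orthov omega W) i; have [w wW ->] := rowE W j.
  have /mem_orthovP h := vW.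
  by rewrite (coordV_form dar) (h w wW) rmorph0 mulr0 !mxE mul0rn.
apply: real_sub => [|v].
  rewrite sub_form_kernel -[in X in _ *m X^t*]cj_coordsR; apply/eqP; apply: cj_std_form0.
  by apply/eqP; rewrite -sub_form_kernel.
rewrite sub_form_kernel -mem_coordsR => /eqP h; apply/mem_orthovP => w.
rewrite mem_coordsR => wW.
have := sub_form0 h (submx_refl _) wW; rewrite (coordV_form dar) => /matrixP/(_ 0 0).
rewrite !mxE eqxx mulr1n => /eqP; rewrite mulf_eq0 oppr_eq0 (negPf (neq0Ci _)) /=.
by move=> /eqP [].
Qed.

Lemma coordsR_cap W W' : (coordsR (W :&: W')%VS :=: coordsR W :&: coordsR W')%MS.
Proof.
apply/eqmxP/andP; split; first by rewrite sub_capmx -!sub_coordsR capvSl capvSr.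
apply: real_sub => [|v].
  have s1 := cjS T (capmxSl (coordsR W) (coordsR W')).
  have s2 := cjS T (capmxSr (coordsR W) (coordsR W')).
  by rewrite cj_coordsR in s1; rewrite cj_coordsR in s2; rewrite sub_capmx s1 s2.
by rewrite sub_capmx -!mem_coordsR memv_cap.
Qed.

Definition spanR m (A : 'M[R]_(m, d)) : {vspace V} := vsof b <<A>>%MS.

Lemma coords_spanR m (A : 'M[R]_(m, d)) : (coordsR (spanR A) :=: map_mx rc A *m Psi)%MS.
Proof.
apply: eqmx_trans (coords_vsof rc Psi_free _) (eqmxMr Psi _).
by apply/eqmxP; rewrite !map_submx !genmxE submx_refl.
Qed.

End RealCoordinates.

(** * Frames of real subspaces and the projection to the Grassmannian *)

Section SubspaceCosets.
Variables (R : realType) (V : vectType R) (omega : {skew_symmetric V}).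
Variables n0 np nm : nat.
Local Notation n := (n0 + np + nm)%N.
Local Notation C := R[i].
Local Notation G := (std_form C n).
Local Notation T := (swap_mx C n).
Local Notation cj := (cj T).
Local Notation d := (\dim {:V}).
Local Notation rc := (real_complex R).
Local Notation symp := (symp_space R n).
Variables (M : 'M[C]_(n + n, d)) (Psi : 'M[C]_(d, n + n)).
Hypothesis dar : darboux omega M Psi.
Local Notation coordsR := (coordsR Psi).
Local Notation Gr := (Gr omega n0 np nm).

Let Gh := std_form_herm C n.
Let cK := cjK (swap_mx_real C n) (swap_mx_invol C n).

(** W and its symplectic complement are complements of each other and have the same radical. Their
    complexifications are stable under conjugation, so [real_spectral_sign_frame] describes each by
    a common real basis of the radical, a positive block and its conjugate; the quotient dimensions
    identify the block sizes as np and nm. *)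
Lemma subspace_frames W : subspace_type omega n0 np nm W ->
  exists (f0 : 'M[C]_(n0, n + n)) (fp : 'M[C]_(np, n + n)) (fm : 'M[C]_(nm, n + n)),
  [/\ strictly_adapted f0 fp fm, fp *m (cj fp)^t* = 0 /\ fm *m (cj fm)^t* = 0,
      (coordsR W :=: col_mx f0 (col_mx fp (cj fp)))%MS &
      (kermx (G *m (coordsR W)^t*) :=: col_mx f0 (col_mx (cj fm) fm))%MS].
Proof.
move=> [d0 dp dm]; set Y := coordsR W.
set W0 := symp_radical omega W in d0 dp dm *.
have W0W : (W0 <= W)%VS := capvSl _ _.
have W0o : (W0 <= orthov omega W)%VS := capvSr _ _.
have rY : \rank Y = (n0 + np.*2)%N.
  by rewrite (rank_coordsR dar) -d0 -dp subnKC // dimvS.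
have eZ := coords_orthov dar W; rewrite -/Y in eZ; set Z := coordsR (orthov omega W) in eZ *.
have rZ : \rank Z = (n0 + nm.*2)%N.
  by rewrite (rank_coordsR dar) -d0 -dm subnKC // dimvS.
have e0 : (coordsR W0 :=: Y :&: Z)%MS := coordsR_cap dar W (orthov omega W).
have rW0 : \rank (coordsR W0) = n0 by rewrite (rank_coordsR dar).
have cW0 : (cj (coordsR W0) <= coordsR W0)%MS by rewrite (cj_coordsR dar).
have [f0 [u0 c0 ef0]] := real_unitary_basis cW0 rW0.
have f0Y : (f0 <= Y)%MS by rewrite ef0 e0 capmxSl.
have f0Z : (f0 <= Z)%MS by rewrite ef0 e0 capmxSr.
have ZGY : Z *m G *m Y^t* = 0 by apply/eqP; rewrite -sub_form_kernel eZ.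
have YGZ := form_adj0 Gh ZGY.
have eY : (kermx (G *m Z^t*) :=: Y)%MS.
  apply: (form_kernelE YGZ); rewrite rY rZ addnC; exact: double_add_rank2.
have sub0 (x : 'rV[C]_(n + n)) : (x <= Y)%MS -> (x <= Z)%MS -> (x <= f0)%MS.
  by move=> xY xZ; apply: (sub_eqmx (eqmx_sym ef0)); apply: (sub_eqmx (eqmx_sym e0));
    rewrite sub_capmx xY.
have sT := swap_mx_sym C n; have rT := swap_mx_real C n; have iT := swap_mx_invol C n.
have gT := swap_std_form C n.
have [BY uBY eBY] := unitary_basis rY.
have BYs := eqmx_sub (eqmx_sym eBY).
have f0BY := sub_eqmx (eqmx_sym eBY) f0Y.
have f0GBY := sub_form0 ZGY f0Z BYs.
have kBY (x : 'rV[C]_(n + n)) : (x <= BY)%MS -> x *m G *m BY^t* = 0 -> (x <= f0)%MS.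
  move=> xB xG; have xY := submx_trans xB BYs.
  have xk : (x <= kermx (G *m Y^t*))%MS.
    by rewrite sub_form_kernel (sub_form0 xG (submx_refl _) (eqmx_sub eBY)).
  exact: sub0 xY (sub_eqmx (eqmx_sym eZ) xk).
have cBY : (cj BY <= BY)%MS.
  apply: (sub_eqmx (eqmx_sym eBY)); rewrite -[X in (_ <= X)%MS](cj_coordsR dar); exact: cjS.
have [p [fp [ep [sfp efp epp]]]] := real_spectral_sign_frame Gh rT sT iT gT uBY u0 f0BY f0GBY kBY
  c0 cBY.
have [BZ uBZ eBZ] := unitary_basis rZ.
have BZs := eqmx_sub (eqmx_sym eBZ).
have f0BZ := sub_eqmx (eqmx_sym eBZ) f0Z.
have f0GBZ := sub_form0 YGZ f0Y BZs.
have kBZ (x : 'rV[C]_(n + n)) : (x <= BZ)%MS -> x *m G *m BZ^t* = 0 -> (x <= f0)%MS.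
  move=> xB xG; have xZ := submx_trans xB BZs.
  have xk : (x <= kermx (G *m Z^t*))%MS.
    by rewrite sub_form_kernel (sub_form0 xG (submx_refl _) (eqmx_sub eBZ)).
  exact: sub0 (sub_eqmx eY xk) xZ.
have cBZ : (cj BZ <= BZ)%MS.
  apply: (sub_eqmx (eqmx_sym eBZ)); rewrite -[X in (_ <= X)%MS](cj_coordsR dar); exact: cjS.
have [m [fc [em [sfm efm emm]]]] := real_spectral_sign_frame Gh rT sT iT gT uBZ u0 f0BZ f0GBZ kBZ
  c0 cBZ.
have pE := addn_double_inj epp; have mE := addn_double_inj emm; subst p m.
have eYf := eqmx_trans efp eBY; have eZf := eqmx_trans efm eBZ.
have /(sign_frameP Gh)[[_ up _] [q0p _ qpp] [g0 g0p _] [gp gpc _] [rp _]] := sfp.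
have /(sign_frameP Gh)[[_ uc um] [_ q0m qmm] [_ _ g0m] [_ gmc gm] [_ rm]] := sfm.
have fpY := sub_eqmx eYf (submx_trans (sub_col_mxl fp (cj fp)) (sub_col_mxr f0 _)).
have fcZ := sub_eqmx eZf (submx_trans (sub_col_mxl fc (cj fc)) (sub_col_mxr f0 _)).
have fmZ := sub_eqmx eZf (submx_trans (sub_col_mxr fc (cj fc)) (sub_col_mxr f0 _)).
(* For the complement it is the negative half that becomes [fm], whose conjugate [fc] is positive,
   as the rows of a symplectic frame must be. *)
exists f0, fp, (cj fc); rewrite !cK; split.
- exists ep, (- em); split; [split | exact: rp | exact: rm].
  + by split; apply/unitarymxP.
  + by split; [exact: c0 | exact: q0p | exact: q0m].
  + by split; [exact: g0 | exact: g0p | exact: g0m].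
  + by split; [exact: gp | exact: gm | exact: sub_form0 YGZ fpY fmZ].
  + rewrite cK; split; [exact: gpc | exact: (form_adj0 Gh gmc) | exact: sub_form0 YGZ fpY fcZ].
- by split; [exact: qpp | exact: inner_adj0 qmm].
- exact: eqmx_sym eYf.
- exact: eqmx_trans (eqmx_sym eZ) (eqmx_sym eZf).
Qed.

Let forms (s : symp) := symp_frame_forms (symp_spaceP s).

Definition gr_coef (s : symp) : 'M[R]_(n0 + (np + np), d) :=
  real_coef M (real_rows (frame0 (val s)) (framep (val s))).

Definition gr_subspace (s : symp) : {vspace V} := spanR (gr_coef s).

Lemma gr_coefK s : map_mx rc (gr_coef s) *m Psi = real_rows (frame0 (val s)) (framep (val s)).
Proof. by have [[_ c0 _ _] _ _ _] := forms s; apply: (real_coefK dar); exact: real_rows_cj. Qed.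

Lemma gr_subspaceE s :
  (coordsR (gr_subspace s) :=: col_mx (frame0 (val s)) (col_mx (framep (val s)) (cj (framep (val
    s)))))%MS.
Proof.
apply: eqmx_trans (coords_spanR dar _) _; rewrite gr_coefK; exact: real_rows_eqmx.
Qed.

Section FrameType.
Variables (f0 : 'M[C]_(n0, n + n)) (fp : 'M[C]_(np, n + n)) (fm : 'M[C]_(nm, n + n)) (W : {vspace
  V}).
Hypothesis ff : form_frames f0 fp fm (const_mx 1) (- const_mx 1).
Hypothesis WE : (coordsR W :=: col_mx f0 (col_mx fp (cj fp)))%MS.

(** The rows [f0], [cj fm] and [fm] are orthogonal to W and have complementary rank, so by
    nondegeneracy they span the symplectic complement. All dimensions then follow from freeness of
    the two families. *)
Lemma frame_subspace_type : \dim W = (n0 + np.*2)%N /\ subspace_type omega n0 np nm W.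
Proof.
have [[r0 c0 _ _] [g0 g0p g0m] [gp gm gpm] [kp km kpm]] := ff.
rewrite diag_const_mx in gp; rewrite linearN /= diag_const_mx in gm.
set Z := col_mx f0 (col_mx (cj fm) (cj (cj fm))).
pose Y := col_mx f0 (col_mx fp (cj fp)); have WY : (coordsR W :=: Y)%MS := WE.
have g0c : f0 *m G *m (cj fm)^t* = 0 by rewrite -c0; exact: cj_std_form0.
have g0pc : f0 *m G *m (cj fp)^t* = 0 by rewrite -c0; exact: cj_std_form0.
have gcc : cj fm *m G *m (cj fm)^t* = 1%:M by rewrite cj_std_form gm map_mxN map_mx1 opprK.
have gcm : cj fm *m G *m (cj (cj fm))^t* = 0 by rewrite cK; exact: form_adj0.
have rY : \rank Y = (n0 + (np + np))%N by apply/eqP; exact: (pair_free r0 c0 g0p gp kp).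
have rZ : \rank Z = (n0 + (nm + nm))%N by apply/eqP; exact: (pair_free r0 c0 g0c gcc gcm).
have ZGY : Z *m G *m Y^t* = 0.
  have k1 : cj fm *m G *m (cj fp)^t* = 0 by exact: cj_std_form0 (form_adj0 Gh gpm).
  have k2 : fm *m G *m (cj fp)^t* = 0.
    by have := cj_std_form0 (form_adj0 Gh kpm); rewrite cK.
  rewrite /Z /Y cK !mul_col_mx !adj_col_mx !mul_mx_row g0 g0p g0pc.
  rewrite (form_adj0 Gh g0c) (form_adj0 Gh kpm) k1 (form_adj0 Gh g0m) (form_adj0 Gh gpm) k2.
  by rewrite !row_mx0 !col_mx0.
have eZ : (coordsR (orthov omega W) :=: Z)%MS.
  apply: eqmx_trans (coords_orthov dar W) _; apply: form_kernelE.
    by apply: (sub_form0 ZGY (submx_refl _)); rewrite WY.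
  by rewrite WY rY rZ addnC double_add_rank.
have dW : \dim W = (n0 + (np + np))%N by rewrite -(rank_coordsR dar) WY.
have dZ : \dim (orthov omega W) = (n0 + (nm + nm))%N by rewrite -(rank_coordsR dar) eZ.
have e0 : (coordsR (symp_radical omega W) :=: f0)%MS.
  apply: eqmx_trans (coordsR_cap dar W (orthov omega W)) _; apply/eqmxP/andP; split.
    apply/rV_subP => x; rewrite sub_capmx WY eZ => /andP[xY xZ].
    by apply: (pair_sub_kernel c0 g0p gp kp xY); exact: sub_form0 ZGY xZ (submx_refl _).
  by rewrite sub_capmx WY eZ !sub_col_mxl.
have d0 : \dim (symp_radical omega W) = n0 by rewrite -(rank_coordsR dar) e0; apply/eqP.
split; first by rewrite dW addnn.
by split; [exact: d0 | rewrite dW d0 addKn addnn | rewrite dZ d0 addKn addnn].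
Qed.

End FrameType.

Lemma gr_subspace_dim s : \dim (gr_subspace s) = (n0 + np.*2)%N.
Proof. by have [] := frame_subspace_type (forms s) (gr_subspaceE s). Qed.

Definition gr_point (s : symp) : grassmannian V (n0 + np.*2) :=
  SigSub (mem_set (gr_subspace_dim s) : gr_subspace s \in [set W | \dim W = (n0 + np.*2)%N]).

Lemma gr_pointP s : subspace_type omega n0 np nm (val (gr_point s)).
Proof. by have [] := frame_subspace_type (forms s) (gr_subspaceE s). Qed.

Definition gr_proj (s : symp) : Gr :=
  SigSub (mem_set (gr_pointP s) : gr_point s \in
    [set W : grassmannian V (n0 + np.*2) | subspace_type omega n0 np nm (val W)]).

Lemma Gr_inj (x y : Gr) : val (val x) = val (val y) -> x = y.
Proof. by move=> e; apply: val_inj; apply: val_inj. Qed.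

Lemma gr_point_continuous : continuous gr_point.
Proof.
have cv : continuous (val : symp -> 'M[C]_(n, n + n)) by exact: continuous_val.
have cE : continuous (fun s : symp => real_rows (frame0 (val s)) (framep (val s))).
  have h0 : continuous (fun s : symp => frame0 (val s)).
    by move=> s; exact: (cvg_frame0 (nbhs_filter s) (cv s)).
  have hp : continuous (fun s : symp => framep (val s)).
    by move=> s; exact: (cvg_framep (nbhs_filter s) (cv s)).
  have hc : continuous (fun s : symp => cj (framep (val s))).
    by move=> s; exact: (cvg_cj (nbhs_filter s) (hp s)).
  have cN : continuous (fun _ : symp => -1 : C) by exact: cst_continuous.
  have ci : continuous (fun _ : symp => 'i : C) by exact: cst_continuous.
  have hN : continuous (fun s : symp => -1 *: cj (framep (val s))).
    by move=> s; exact: (cvg_scalemx (cN s) (hc s)).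
  have hD : continuous (fun s : symp => framep (val s) + -1 *: cj (framep (val s))).
    by move=> s; exact: (cvg_addmx (hp s) (hN s)).
  have hA : continuous (fun s : symp => framep (val s) + cj (framep (val s))).
    by move=> s; exact: (cvg_addmx (hp s) (hc s)).
  have hi : continuous (fun s : symp => 'i *: (framep (val s) + -1 *: cj (framep (val s)))).
    by move=> s; exact: (cvg_scalemx (ci s) (hD s)).
  rewrite (_ : (fun s => _) = fun s : symp => col_mx (frame0 (val s)) (col_mx (framep (val s) +
    cj (framep (val s)))
    ('i *: (framep (val s) + -1 *: cj (framep (val s)))))).
    by move=> s; exact: (cvg_col_mx (h0 s) (cvg_col_mx (hA s) (hi s))).
  by apply/funext => s; rewrite scaleN1r.
have cM : continuous (fun _ : symp => M) by exact: cst_continuous.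
have cEM : continuous (fun s : symp => real_rows (frame0 (val s)) (framep (val s)) *m M).
  by move=> s; exact: (cvg_mulmx (cE s) (cM s)).
have cA : continuous gr_coef.
  apply: continuous_mx => i j; rewrite /gr_coef /real_coef; under eq_fun do rewrite mxE.
  by move=> s; exact: (cvgC_Re (continuous_coord cEM (x := s))).
(* The frame has np + np rows while the Grassmannian is indexed by [np.*2]; the cast along [e]
   leaves row spaces unchanged. *)
pose e : (n0 + (np + np) = n0 + np.*2)%N := congr1 (addn n0) (addnn np).
have ir : forall (S : Type) (F : set_system S) (FF : Filter F) (f : S -> R) (a : R),
  f @ F --> a -> (fun x => rc (f x) : C) @ F --> (rc a : C) by move=> S F FF f a; exact: cvgC_R.
apply: (@continuous_to_grassmannian R R rc V (n + n) Psi (Psi_free dar) (n0 + np.*2) symp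
  (fun s => castmx (e, erefl d) (gr_coef s)) gr_point).
  exact: cvg_castmx.
move=> s; exact: eqmx_trans (coords_spanR dar (gr_coef s)) (eqmx_sym (map_castmx_mul rc e
  (gr_coef s) Psi)).
Qed.

End SubspaceCosets.
Lemma double_rank_compl a b c : ((a + b + c) + (a + b + c) - (a + b.*2) = a + (c + c))%N.
Proof. by rewrite -addnn; lia. Qed.

Lemma gr_rel_sub (C : numClosedFieldType) n n0 nm k (f0 : 'M[C]_(n0, n + n)) (fm : 'M[C]_(nm, n +
  n))
    (Y : 'M[C]_(k, n + n)) :
  (f0 *m std_form C n *m orthoproj Y = 0 /\ fm *m std_form C n *m orthoproj Y = 0) <->
  (col_mx f0 fm <= kermx (std_form C n *m Y^t*))%MS.
Proof.
rewrite col_mx_sub !sub_form_kernel; split=> [[/mul_orthoproj_eq0 -> /mul_orthoproj_eq0 ->]|].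
  by rewrite !eqxx.
by move=> /andP[/eqP h1 /eqP h2]; split; apply/mul_orthoproj_eq0.
Qed.

(** * The homotopy equivalence for real subspaces *)

Section SubspaceHomotopy.
Variables (R : realType) (V : vectType R) (omega : {skew_symmetric V}).
Variables n0 np nm : nat.
Local Notation n := (n0 + np + nm)%N.
Local Notation C := R[i].
Local Notation G := (std_form C n).
Local Notation T := (swap_mx C n).
Local Notation cj := (cj T).
Local Notation d := (\dim {:V}).
Variables (M : 'M[C]_(n + n, d)) (Psi : 'M[C]_(d, n + n)).
Hypothesis dar : darboux omega M Psi.
Local Notation coordsR := (coordsR Psi).
Local Notation Gr := (Gr omega n0 np nm).

Lemma strict_real_frames_unitary (f0 : 'M[C]_(n0, n + n)) (fp : 'M[C]_(np, n + n)) (fm :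
  'M[C]_(nm, n + n)) :
  strictly_adapted f0 fp fm -> fp *m (cj fp)^t* = 0 -> fm *m (cj fm)^t* = 0 ->
  col_mx f0 (col_mx fp (cj fp)) \is unitarymx /\ col_mx f0 (col_mx (cj fm) fm) \is unitarymx.
Proof.
move=> [dp [dm [af rp rm]]] q1 q2.
have h1 : strict_sign_frame G f0 fp (cj fp) dp (- dp).
  apply: (adapted_real_sign_framep af q1 rp) => [i|]; first by rewrite oppr_lt0.
  by apply: mxbar_ge0 => i; exact: ltW.
have h2 : strict_sign_frame G f0 (cj fm) fm (- dm) dm.
  apply: (adapted_real_sign_framem af q2 _ rm) => [i|]; first by rewrite oppr_gt0.
  by apply: mxbar_le0 => i; exact: ltW.
by case: h1 => u1 _ _ _; case: h2 => u2 _ _ _.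
Qed.

Definition gr_orthoproj (x : Gr) : 'M[C]_(n + n) := orthoproj (coordsR (val (val x))).

Lemma gr_orthoproj_continuous : continuous gr_orthoproj.
Proof.
have h1 : continuous (val : Gr -> grassmannian V (n0 + np.*2)) by exact: continuous_val.
have ir : forall (S : Type) (F : set_system S) (FF : Filter F) (f : S -> R) (a : R),
  f @ F --> a -> (fun x => real_complex R (f x) : C) @ F --> (real_complex R a : C).
  by move=> S F FF f a; exact: cvgC_R.
have h2 := coords_proj_continuous (k := n0 + np.*2) (Psi_free dar) ir.
by move=> x; have h3 := continuous_comp (h1 x) (h2 (val x)); exact: h3.
Qed.

(** The conditions containing [G] place [f0] and [fm] in the symplectic complement. The last two
    orthogonality relations select, in the subspace and in its complement, the decomposition into
    spectral positive and negative parts, which are conjugate to each other. *)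
Definition gr_rel (x : Gr) (f0 : 'M[C]_(n0, n + n)) (fp : 'M[C]_(np, n + n)) (fm : 'M[C]_(nm, n +
  n)) :=
  (f0 *m gr_orthoproj x = f0 /\ fp *m gr_orthoproj x = fp) /\
  ((f0 *m G *m gr_orthoproj x = 0 /\ fm *m G *m gr_orthoproj x = 0) /\
  (fp *m (cj fp)^t* = 0 /\ fm *m (cj fm)^t* = 0)).

Lemma col_cj_sub p (f0 : 'M[C]_(n0, n + n)) (f : 'M[C]_(p, n + n)) W :
  (col_mx f0 f <= coordsR W)%MS -> (cj f <= coordsR W)%MS.
Proof.
by rewrite col_mx_sub => /andP[_ fW]; rewrite -(cj_coordsR dar); exact: cjS.
Qed.

Lemma gr_relP x (f0 : 'M[C]_(n0, n + n)) (fp : 'M[C]_(np, n + n)) (fm : 'M[C]_(nm, n + n)) :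
  gr_rel x f0 fp fm <->
  (col_mx f0 (col_mx fp (cj fp)) <= coordsR (val (val x)))%MS /\
  ((col_mx f0 (col_mx (cj fm) fm) <= kermx (G *m (coordsR (val (val x)))^t*))%MS /\
  (fp *m (cj fp)^t* = 0 /\ fm *m (cj fm)^t* = 0)).
Proof.
rewrite /gr_rel /gr_orthoproj; move: (val (val x) : {vspace V}) => W.
have h1 := oplus_rel_sub f0 fp (coordsR W); have h2 := gr_rel_sub f0 fm (coordsR W).
apply: (iff_and (iff_trans h1 _) (iff_and (iff_trans h2 _) (iff_refl _))).
  split=> [h|]; last by rewrite !col_mx_sub => /and3P[-> ->].
  have hc := col_cj_sub h; move: h; rewrite !col_mx_sub => /andP[-> ->].
  by rewrite hc.
have e := coords_orthov dar W; split=> [h|]; last by rewrite !col_mx_sub => /and3P[-> _ ->].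
have hc := sub_eqmx e (col_cj_sub (sub_eqmx (eqmx_sym e) h)).
by move: h; rewrite !col_mx_sub => /andP[-> ->]; rewrite hc.
Qed.

Lemma Gr_frames (x : Gr) :
  exists (f0 : 'M[C]_(n0, n + n)) (fp : 'M[C]_(np, n + n)) (fm : 'M[C]_(nm, n + n)),
  [/\ strictly_adapted f0 fp fm, fp *m (cj fp)^t* = 0 /\ fm *m (cj fm)^t* = 0,
      (coordsR (val (val x)) :=: col_mx f0 (col_mx fp (cj fp)))%MS &
      (kermx (G *m (coordsR (val (val x)))^t*) :=: col_mx f0 (col_mx (cj fm) fm))%MS].
Proof. exact: (subspace_frames dar (set_mem (valP x))). Qed.

Lemma Gr_eqmx (x : Gr) (f0 : 'M[C]_(n0, n + n)) (fp : 'M[C]_(np, n + n)) (fm : 'M[C]_(nm, n + n)) :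
  strictly_adapted f0 fp fm -> gr_rel x f0 fp fm ->
  (coordsR (val (val x)) :=: col_mx f0 (col_mx fp (cj fp)))%MS /\
  (kermx (G *m (coordsR (val (val x)))^t*) :=: col_mx f0 (col_mx (cj fm) fm))%MS.
Proof.
move=> sf /gr_relP[s1 [s2 [q1 q2]]]; have [u1 u2] := strict_real_frames_unitary sf q1 q2.
have r : \rank (coordsR (val (val x))) = (n0 + np.*2)%N.
  by apply: etrans (rank_coordsR dar _) _; have /set_mem := valP (val x).
have r1 : \rank (coordsR (val (val x))) = (n0 + (np + np))%N by rewrite r addnn.
split; first exact: eqmx_unitary_rank u1 s1 r1.
apply: (eqmx_unitary_rank u2 s2); rewrite rank_form_kernel r; exact: double_rank_compl.
Qed.

Lemma homotopy_equivalent_Gr :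
  homotopy_equivalent R Gr (unitary_coset_space R n0 np nm).
Proof.
have cg3 (f0 g0 : 'M[C]_(n0, n + n)) (fp gp : 'M[C]_(np, n + n)) : (f0 :=: g0)%MS ->
  (fp :=: gp)%MS ->
    (col_mx f0 (col_mx fp (cj fp)) :=: col_mx g0 (col_mx gp (cj gp)))%MS.
  move=> e0 ep; apply: eqmx_col_mx_cong e0 (eqmx_col_mx_cong ep _).
  by apply/eqmxP/andP; split; apply: cjS; [exact: eqmx_sub (eqmx_sym ep) | exact: eqmx_sub ep].
apply: (@homotopy_equivalent_of_frames R n0 np nm Gr (gr_proj dar) gr_rel).
- by apply: continuous_set_type; exact: gr_point_continuous.
- move=> s s' [e0 ep _]; apply: Gr_inj; apply: (coordsR_inj dar).
  exact: eqmx_trans (gr_subspaceE dar s) (eqmx_trans (cg3 _ _ _ _ e0 ep) (eqmx_sym (gr_subspaceE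
    dar s'))).
- move=> Y x f0 fp fm cx c0 cp cm.
  have c1 : continuous (fun y => gr_orthoproj (x y)).
    by move=> y; have h := continuous_comp (cx y) (@gr_orthoproj_continuous (x y)); exact: h.
  have cG : continuous (fun _ : Y => G) by exact: cst_continuous.
  have cz m : continuous (fun _ : Y => 0 : 'M[C]_(m, n + n)) by exact: cst_continuous.
  have cGP m (f : Y -> 'M[C]_(m, n + n)) : continuous f ->
      closed [set y | f y *m G *m gr_orthoproj (x y) = 0].
    move=> cf; apply: (closed_eqmx _ (cz m)) => y.
    exact: (cvg_mulmx (cvg_mulmx (cf y) (cG y)) (c1 y)).
  have cI m (f : Y -> 'M[C]_(m, n + n)) : continuous f -> closed [set y | f y *m (cj (f y))^t* = 0].
    move=> cf; apply: closed_eqmx => [y|].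
      exact: (cvg_mulmx (cf y) (cvg_adjmx (cvg_cj (nbhs_filter y) (cf y)))).
    exact: cst_continuous.
  have cP m (f : Y -> 'M[C]_(m, n + n)) : continuous f -> closed [set y | f y *m gr_orthoproj (x
    y) = f y].
    by move=> cf; apply: (closed_eqmx _ cf) => y; exact: (cvg_mulmx (cf y) (c1 y)).
  apply: closed_and; first by apply: closed_and; [exact: cP c0 | exact: cP cp].
  apply: closed_and; first by apply: closed_and; [exact: cGP c0 | exact: cGP cm].
  by apply: closed_and; [exact: cI cp | exact: cI cm].
- move=> x; have [f0 [fp [fm [sf q e1 e2]]]] := Gr_frames x.
  exists f0, fp, fm; split; [exact: sf | apply/gr_relP].
  by split; [exact: eqmx_sub e1 | split; [exact: eqmx_sub e2 | exact: q]].
- move=> x g0 gp gm wg /gr_relP[s1 [s2 [q3 q4]]].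
  have [f0 [fp [fm [sf [q1 q2] e1 e2]]]] := Gr_frames x.
  by have [h _ _ _] := gr_frames_unique sf wg q1 q2 q3 q4 (sub_eqmx e1 s1) (sub_eqmx e2 s2).
- move=> x f0 fp fm g0 gp gm sf rf sg /gr_relP[s1 [s2 [q3 q4]]].
  have [e1 e2] := Gr_eqmx sf rf; have /gr_relP[_ [_ [q1 q2]]] := rf.
  by have [_ h1 h2 h3] := gr_frames_unique sf (strictly_weakly_adapted sg) q1 q2 q3 q4 (sub_eqmx
    e1 s1) (sub_eqmx e2 s2).
- move=> x f0 fp fm s sf rf [e0 ep _]; have [e1 _] := Gr_eqmx sf rf.
  apply: Gr_inj; apply: (coordsR_inj dar).
  exact: eqmx_trans (gr_subspaceE dar s) (eqmx_trans (cg3 _ _ _ _ e0 ep) (eqmx_sym e1)).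
- move=> f0 fp fm s sf _ q1 q2 [e0 ep em]; apply/gr_relP.
  have h := eqmx_trans (gr_subspaceE dar s) (cg3 _ _ _ _ e0 ep).
  have [dp [dm [[_ [c0 _ _] [g0 g0p g0m] [_ _ gpm] [_ _ kpm]] _ _]]] := sf.
  have Gh := std_form_herm C n.
  split; [exact: eqmx_sub h | split; last by split].
  rewrite sub_form_kernel; apply/eqP; apply: (@sub_form0 _ _ _ _ _ _ _ (col_mx f0 (col_mx fp (cj
    fp)))) (submx_refl _) (eqmx_sub (eqmx_sym h)).
  have k1 : cj fm *m G *m (cj fp)^t* = 0 := cj_std_form0 (form_adj0 Gh gpm).
  have k2 : fm *m G *m (cj fp)^t* = 0.
    have := cj_std_form0 (form_adj0 Gh kpm).
    by rewrite (cjK (swap_mx_real C n) (swap_mx_invol C n)).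
  have g0pc : f0 *m G *m (cj fp)^t* = 0 by rewrite -c0; exact: cj_std_form0.
  have g0c : cj fm *m G *m f0^t* = 0 by rewrite -c0; exact: cj_std_form0 (form_adj0 Gh g0m).
  rewrite !mul_col_mx !adj_col_mx !mul_mx_row g0 g0p g0pc g0c k1 k2.
  rewrite (form_adj0 Gh kpm) (form_adj0 Gh g0m) (form_adj0 Gh gpm).
  by rewrite !row_mx0 !col_mx0.
Qed.

End SubspaceHomotopy.

Theorem corollary4p7 (R : realType) (n : nat) (V : vectType R)
    (omega : {skew_symmetric V}) (omega_symp : is_psymplectic omega)
    (dimV : \dim {:V} = (2 * n)%N)
    (n0 np nm : nat) (n_sum : (n0 + np + nm)%N = n) :
  [/\ homotopy_equivalent R (Gr omega n0 np nm) (unitary_coset_space R n0 np nm),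
      homotopy_equivalent R (LagC omega n0 np nm) (unitary_coset_space R n0 np nm) &
      homotopy_equivalent R (LagC_oplus omega n0 np nm)
        (unitary_coset_space R n0 np nm)].
Proof.
have d : \dim {:V} = ((n0 + np + nm) + (n0 + np + nm))%N by rewrite dimV n_sum mul2n addnn.
have [M [Psi dar]] := darboux_coords omega_symp d.
by split; [exact: homotopy_equivalent_Gr dar | exact: homotopy_equivalent_LagC dar |
  exact: homotopy_equivalent_LagC_oplus dar].
Qed.
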